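(* Fix $E\in\mathbb{R}$ and let $P(E):=\{(\alpha,r,\theta)\in\mathbb{R}\times(0,\infty)\times\mathbb{R}: E\in\sigma_p(H_{\alpha,r,\theta})\}$. Then: (a) For fixed $\alpha_0\in\mathbb{R}$, $r_0>0$, the set $\{(\alpha_0,r_0,\theta):\theta\in\mathbb{R}\}\cap P(E)$ is empty or countable. (b) For fixed $\alpha_0,\theta_0\in\mathbb{R}$, the set $\{(\alpha_0,r,\theta_0): r>0\}\cap P(E)$ has at most one element or equals $\{\alpha_0\}\times(0,\infty)\times\{\theta_0\}$. (c) For fixed $r_0>0$, $\theta_0\in\mathbb{R}$, the set $\{(\alpha,r_0,\theta_0):\alpha\in\mathbb{R}\}\cap P(E)$ has at most one element or equals $\mathbb{R}\times\{r_0\}\times\{\theta_0\}$.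
   Context: Let $-\infty\le a<b\le\infty$, $V\in L^1_{\mathrm{loc}}(a,b)$ real-valued, $\tau f:=-f''+Vf$, and let $M=\{x_n\}_{n\in I}\subset(a,b)$, $I\subseteq\mathbb{Z}$, be a discrete set of (distinct) points accumulating at most at $a$ or $b$. Let $\Lambda=\{\alpha_n\}_{n\in I}\subset\mathbb{R}$, $R=\{r_n\}_{n\in I}\subset(0,\infty)$, $\Theta=\{\theta_n\}_{n\in I}\subset\mathbb{R}$, and set $$A_{\alpha_n,r_n,\theta_n}:=\begin{pmatrix}1&\alpha_n\\0&1\end{pmatrix}\begin{pmatrix}r_n&0\\0&1/r_n\end{pmatrix}\begin{pmatrix}\cos\theta_n&-\sin\theta_n\\ \sin\theta_n&\cos\theta_n\end{pmatrix}.$$ Interface conditions: $(f(x_n+),f'(x_n+))^T=A_{\alpha_n,r_n,\theta_n}(f(x_n-),f'(x_n-))^T$ for all $n\in I$. The maximal operator $T_{\Lambda,R,\Theta}f=\tau f$ has as domain all $f\in L^2(a,b)$ with $f,f'$ (locally) absolutely continuous in $(a,b)\setminus M$, $-f''+Vf\in L^2(a,b)$, satisfying the interface conditions. For $z\in\mathbb{C}$, a solution of $(\tau_{\Lambda,R,\Theta}-z)f=0$ is a function $f$ with $f,f'$ (locally) absolutely continuous in $(a,b)\setminus M$, $-f''+Vf-zf=0$, satisfying the interface conditions. It lies right (left) in $L^2(a,b)$ if it is square integrable in a neighborhood of $b$ (of $a$). $\tau_{\Lambda,R,\Theta}$ is in the limit circle case (lcc) at $b$ if for every $z\in\mathbb{C}$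 all solutions of $(\tau_{\Lambda,R,\Theta}-z)f=0$ lie right in $L^2(a,b)$, and in the limit point case at $b$ if for every $z\in\mathbb{C}$ at least one solution does not; similarly at $a$ (with ''left''). Exactly one of these two cases occurs at each endpoint. For $f,g$ let $[f,g]_x=\overline{f(x+)}g'(x+)-\overline{f'(x+)}g(x+)$, and $[f,g]_a=\lim_{x\to a+}[f,g]_x$, $[f,g]_b=\lim_{x\to b-}[f,g]_x$ (these limits exist where used). The selfadjoint operator $H_{\Lambda,R,\Theta}$ is the restriction of $T_{\Lambda,R,\Theta}$ to those $f$ in its domain with $[v,f]_a=0$ if $\tau_{\Lambda,R,\Theta}$ is lcc at $a$, and $[w,f]_b=0$ if it is lcc at $b$ (no condition at a limit point endpoint), where $v$ and $w$ are fixed non-trivial real-valued solutions of $(\tau_{\Lambda,R,\Theta}-\lambda)f=0$ near $a$ and near $b$, respectively, for some $\lambda\in\mathbb{R}$. Fix $n_0\in I$, fix $V,M,v,w$ and all $\alpha_n,r_n,\theta_n$ with $n\ne n_0$, and vary only $\alpha=\alpha_{n_0}$, $r=r_{n_0}$, $\theta=\theta_{n_0}$. Write $H_{\alpha,r,\theta}$ for the resulting operator $H_{\Lambda,R,\Theta}$. ($v$ and $w$ are solutions on neighborhoods of the endpoints not containing $x_{n_0}$, so they do not depend on $\alpha,r,\theta$.) $\sigma_p$ denotes the set of eigenvalues. *)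

(* Defs.v *)
From HB Require Import structures.
From mathcomp Require Import all_boot all_order all_algebra.
From mathcomp Require Import complex.
From mathcomp Require Import all_classical all_reals all_analysis.
Set Implicit Arguments.
Unset Strict Implicit.
Unset Printing Implicit Defensive.
Import Order.TTheory GRing.Theory Num.Theory.
Import numFieldNormedType.Exports.
Local Open Scope classical_set_scope.
Local Open Scope complex_scope.
Local Open Scope ring_scope.

(* Functions on a subset of the line are total functions R -> R[i]; values
   outside the set, and at the interaction points, never matter.  Limits,
   derivatives and absolute continuity of complex-valued functions are taken
   on real and imaginary parts. *)

Section Functions.
Context {R : realType}.
Local Notation mu := (@lebesgue_measure R).
Implicit Types (f g : R -> R[i]) (D : set R) (p q : \bar R).

Definition oint p q : set R := [set y | (p < y%:E < q)%E].

Definition reF f : R -> R := fun y => complex.Re (f y).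
Definition imF f : R -> R := fun y => complex.Im (f y).

Definition realF (u : R -> R) : R -> R[i] := fun y => (u y)%:C.

Definition derF f : R -> R[i] := fun y => derive1 (reF f) y +i* derive1 (imF f) y.

Definition derivableF f (y : R) : Prop :=
  derivable (reF f) y 1 /\ derivable (imF f) y 1.

Definition abs_continuous (c d : R) (u : R -> R) : Prop :=
  forall e : R, 0 < e -> exists2 dl : R, 0 < dl &
    forall (n : nat) (s t : 'I_n -> R),
      (forall i, c <= s i /\ s i <= t i /\ t i <= d) ->
      trivIset [set: 'I_n] (fun i => `]s i, t i[%classic) ->
      \sum_(i < n) (t i - s i) < dl ->
      \sum_(i < n) `|u (t i) - u (s i)| < e.

Definition loc_abs_continuous D (u : R -> R) : Prop :=
  forall c d : R, `[c, d]%classic `<=` D -> abs_continuous c d u.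

Definition loc_abs_continuousF D f : Prop :=
  loc_abs_continuous D (reF f) /\ loc_abs_continuous D (imF f).

(* The two differentiability clauses follow from the absolute continuity of
   f and f'; they ensure that derF f and derF (derF f) are genuine derivatives
   (everywhere on D, resp. almost everywhere) and not default values. *)
Definition regularF D f : Prop :=
  [/\ forall y, D y -> derivableF f y,
      loc_abs_continuousF D f,
      loc_abs_continuousF D (derF f) &
      {ae mu, forall y, D y -> derivableF (derF f) y}].

Definition ae_null D f : Prop := {ae mu, forall y, D y -> f y = 0}.

(* measurable_fun refers to the Borel sigma-algebra; the a.e. equal
   representative g accounts for Lebesgue measurability. *)
Definition L2 D f : Prop :=
  exists g, [/\ measurable_fun D (reF g), measurable_fun D (imF g),
    mu.-integrable D (EFin \o (fun y => reF g y ^+ 2 + imF g y ^+ 2)) &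
    {ae mu, forall y, D y -> f y = g y}].

Definition cvgF (F : set_system R) f (l : R[i]) : Prop :=
  (reF f @ F --> complex.Re l) /\ (imF f @ F --> complex.Im l).

Definition is_cvgF (F : set_system R) f : Prop :=
  cvg (reF f @ F) /\ cvg (imF f @ F).

Definition limF (F : set_system R) f : R[i] :=
  lim (reF f @ F) +i* lim (imF f @ F).

(* Filters of x -> p+ and x -> q- for the endpoints of a nonempty interval
   oint p q, so that p is finite or -oo and q is finite or +oo. *)
Definition lend p : set_system R :=
  match p with EFin c => c^'+ | _ => ninfty_nbhs R end.
Definition rend q : set_system R :=
  match q with EFin c => c^'- | _ => pinfty_nbhs R end.

(* [f, g]_y *)
Definition bracket f g : R -> R[i] := fun y =>
  (limF y^'+ f)^* * limF y^'+ (derF g) - (limF y^'+ (derF f))^* * limF y^'+ g.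

Definition mx2 {T : Type} (m00 m01 m10 m11 : T) : 'M[T]_2 :=
  \matrix_(i < 2, j < 2)
    if i == 0 then (if j == 0 then m00 else m01)
    else (if j == 0 then m10 else m11).

Definition interface_mx (alpha r theta : R) : 'M[R]_2 :=
  mx2 1 alpha 0 1 *m mx2 r 0 0 r^-1
    *m mx2 (cos theta) (- sin theta) (sin theta) (cos theta).

Definition col2 {T : Type} (t0 t1 : T) : 'cV[T]_2 :=
  \col_(i < 2) if i == 0 then t0 else t1.

Definition interface (A : 'M[R]_2) f (y : R) : Prop :=
  [/\ is_cvgF y^'+ f, is_cvgF y^'+ (derF f),
      is_cvgF y^'- f, is_cvgF y^'- (derF f) &
      col2 (limF y^'+ f) (limF y^'+ (derF f)) =
      map_mx (real_complex R) A *m col2 (limF y^'- f) (limF y^'- (derF f))].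

(* Eigenvalues of an operator act with domain dom in L^2(D), whose elements
   are identified when equal a.e. *)
Definition eigenvalues D (dom : set (R -> R[i]))
    (act : (R -> R[i]) -> (R -> R[i])) : set R[i] :=
  [set z | exists f, [/\ dom f, ~ ae_null D f &
     {ae mu, forall y, D y -> act f y = z * f y}]].

End Functions.

Section Operators.
Context {R : realType}.
Local Notation mu := (@lebesgue_measure R).
Variables (a b : \bar R) (V : R -> R) (I : set int) (x : int -> R).
(* A n is the interface matrix at the point x n *)
Variable A : int -> 'M[R]_2.
Implicit Types (f g : R -> R[i]) (p q : \bar R).

Definition interaction_points : Prop :=
  [/\ set_inj I x, x @` I `<=` oint a b &
      forall y, oint a b y -> ~ limit_point (x @` I) y].

Definition tau f : R -> R[i] := fun y => - derF (derF f) y + (V y)%:C * f y.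

Definition solution_on p q (z : R[i]) f : Prop :=
  [/\ regularF (oint p q `\` x @` I) f,
      {ae mu, forall y, oint p q y -> tau f y - z * f y = 0} &
      forall n, I n -> oint p q (x n) -> interface (A n) f (x n)].

Definition left_L2 f : Prop :=
  exists2 c : R, oint a b c & L2 (oint a c%:E) f.
Definition right_L2 f : Prop :=
  exists2 c : R, oint a b c & L2 (oint c%:E b) f.

Definition lcc_left : Prop :=
  forall (z : R[i]) f, solution_on a b z f -> left_L2 f.
Definition lcc_right : Prop :=
  forall (z : R[i]) f, solution_on a b z f -> right_L2 f.

Definition domT : set (R -> R[i]) :=
  [set f | [/\ L2 (oint a b) f, regularF (oint a b `\` x @` I) f,
     L2 (oint a b) (tau f) & forall n, I n -> interface (A n) f (x n)]].

Definition domH (v w : R -> R) : set (R -> R[i]) :=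
  [set f | [/\ domT f,
     lcc_left -> cvgF (lend a) (bracket (realF v) f) 0 &
     lcc_right -> cvgF (rend b) (bracket (realF w) f) 0]].

Definition sigma_p (v w : R -> R) : set R[i] :=
  eigenvalues (oint a b) (domH v w) tau.

End Operators.

Section Family.
Context {R : realType}.

Definition interface_family (alpha r theta : int -> R) : int -> 'M[R]_2 :=
  fun n => interface_mx (alpha n) (r n) (theta n).

(* P(E), with the parameters at n0 replaced by the triple; triples are
   (alpha, r, theta) = ((alpha, r), theta). *)
Definition P_set (a b : \bar R) (V : R -> R) (I : set int) (x : int -> R)
    (alpha r theta : int -> R) (v w : R -> R) (n0 : int) (E : R) :
    set (R * R * R) :=
  [set p | 0 < p.1.2 /\
     sigma_p a b V I x
       (interface_family [eta alpha with n0 |-> p.1.1]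
          [eta r with n0 |-> p.1.2] [eta theta with n0 |-> p.2])
       v w (E%:C)].

End Family.

(* Main.v *)
Require Import Defs.
From HB Require Import structures.
From mathcomp Require Import all_boot all_order all_algebra.
From mathcomp Require Import complex.
From mathcomp Require Import all_classical all_reals all_analysis.
From mathcomp Require Import measurable_realfun.
From mathcomp Require Import ring lra.
Set Implicit Arguments.
Unset Strict Implicit.
Unset Printing Implicit Defensive.
Import Order.TTheory GRing.Theory Num.Theory.
Import numFieldNormedType.Exports.
Local Open Scope classical_set_scope.
Local Open Scope complex_scope.
Local Open Scope ring_scope.

(** Suppose that [E] is an eigenvalue for two triples of parameters at [x n0].
    The operators are real, so there are real eigenfunctions [u1] and [u2]
    ([eigenvalue_real_eigenfunction]). On either side of [x n0] both satisfy the
    same equation and the same interface conditions; as the interface matrices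
    have determinant 1, the Wronskian of [u1] and [u2] is constant on each side
    ([wr_eig_const]).

    Both constants are 0 ([wr_eigenfunctions]). Otherwise [u1] and [u2] would
    span the solutions for [E] near an end-point, and be square integrable
    there; by Weyl's argument ([weyl_square_integrable]) the solutions for every
    complex energy would then be square integrable, so that the end-point would
    be in the limit circle case. This case does not depend on what happens at
    [x n0] ([lcc_transfer]), so both eigenfunctions satisfy the boundary
    condition given by [v] (or [w]): the brackets of [v] with [u1] and with [u2]
    tend to 0. The estimate behind Weyl's argument turns this into [v = 0] near
    the end-point ([weyl_vanish]), hence everywhere by uniqueness
    ([eig_unique]), although [v] is non-trivial.

    Let [l] be the pair of the left limits of [u1] and its derivative at [x n0];
    it is not 0. Since the two Wronskians vanish, the interface matrices [A1]
    and [A2] of the two triples send [l] to proportional vectors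
    ([eigenfunctions_jump]). Conversely, if [A2 l = k A1 l] with [k] not 0, then
    multiplying [u1] by [k] to the right of [x n0] yields an eigenfunction for
    the second triple ([eigenfunction_transfer]). So everything is decided by the
    determinant of the pair [A1 l], [A2 l]. Write [m] for [l] rotated by
    [theta]; then [A l = (r m1 + alpha m2 / r, m2 / r)].
    - If only [theta] varies, the determinant is [|l|^2 sin (theta' - theta)], so
      the admissible angles differ by multiples of [pi].
    - If only [r] varies, it is [m1 m2 (r / r' - r' / r)]. Two values of [r]
      force [m1 m2 = 0], and then [A l] keeps its direction for every [r].
    - If only [alpha] varies, it is [(alpha - alpha') m2^2 / r^2]. Two values of
      [alpha] force [m2 = 0], and then [A l] does not depend on [alpha].

    The potential being only locally integrable, solutions are studied through
    absolute continuity: the fundamental theorem of calculus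
    ([abs_continuous_FTC]) gives Lagrange's identity across the interaction
    points ([wr_global]) and the local estimate behind uniqueness, and Picard
    iteration gives existence ([eig_exists]). A solution for a complex energy is
    a pair of real functions, coupled through source terms. *)

(** * Almost everywhere, and induction along a segment *)

Ltac between := apply/andP; split; lra.

Section AlmostEverywhere.
Context {R : realType}.
Local Notation mu := (@lebesgue_measure R).

Lemma aeS (P Q : R -> Prop) : (forall y, P y -> Q y) ->
  {ae mu, forall y, P y} -> {ae mu, forall y, Q y}.
Proof. by move=> PQ; apply: filterS; first exact: (ae_filter_ringOfSetsType mu). Qed.

Lemma aeS2 (P Q S : R -> Prop) : (forall y, P y -> Q y -> S y) ->
  {ae mu, forall y, P y} -> {ae mu, forall y, Q y} -> {ae mu, forall y, S y}.
Proof. by move=> PQ; apply: filterS2; first exact: (ae_filter_ringOfSetsType mu). Qed.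

Lemma aeS3 (P Q S T : R -> Prop) : (forall y, P y -> Q y -> S y -> T y) ->
  {ae mu, forall y, P y} -> {ae mu, forall y, Q y} -> {ae mu, forall y, S y} ->
  {ae mu, forall y, T y}.
Proof. by move=> PQ; apply: filterS3; first exact: (ae_filter_ringOfSetsType mu). Qed.

Lemma ae_notin_countable (M : set R) : countable M -> {ae mu, forall y, ~ M y}.
Proof.
move=> cM; apply: negligibleS (_ : mu.-negligible M); first by move=> y /= /contrapT.
by apply/negligibleP; [exact: countable_measurable|exact: countable_lebesgue_measure0].
Qed.

End AlmostEverywhere.

Section Induction.
Context {R : realType}.

(** The supremum of the points reached is itself reached from a point just
    before it, and no point can be the last one reached. *)
Lemma interval_induction (c d : R) (P : R -> Prop) : c <= d -> P c ->
  (forall t, c <= t <= d -> exists2 e : R, 0 < e & forall x y,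
     c <= x <= t -> t <= y <= d -> t - e < x -> y < t + e -> P x -> P y) ->
  P d.
Proof.
move=> cd Pc step.
pose S := [set x | c <= x <= d /\ P x].
have hS : has_sup S.
  split; first by exists c; split=> //; rewrite lexx cd.
  by exists d => x [/andP[]].
have cS : c <= sup S.
  by apply: sup_upper_bound => //; split=> //; rewrite lexx cd.
have Sd : sup S <= d.
  by apply: ge_sup; [case: hS | move=> x [/andP[]]].
have cSd : c <= sup S <= d by rewrite cS Sd.
have [e e0 he] := step _ cSd.
have [x [/andP[cx xd] Px] xe] := sup_adherent e0 hS.
have xS : x <= sup S by apply: sup_upper_bound => //; split=> //; rewrite cx xd.
have PS : P (sup S).
  by apply: (he x) => //; rewrite ?cx ?xS ?lexx ?Sd ?ltrDl.
have [E|Sltd] : sup S = d \/ sup S < d.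
  by move: Sd; rewrite le_eqVlt => /orP[/eqP|]; [left|right].
  by rewrite -E.
pose y := Num.min d (sup S + e / 2).
have yd : y <= d by rewrite /y ge_min lexx.
have Sy : sup S < y by rewrite /y lt_min Sltd ltrDl divr_gt0.
have ye : y < sup S + e.
  apply: (@le_lt_trans _ _ (sup S + e / 2)); last lra.
  by rewrite /y ge_min lexx orbT.
have Py : P y.
  apply: (he (sup S)) => //; rewrite ?cS ?lexx ?yd ?(ltW Sy) //; lra.
have /(lt_le_trans Sy) : y <= sup S.
  by apply: (sup_upper_bound hS); split=> //; rewrite yd (le_trans cS (ltW Sy)).
by rewrite ltxx.
Qed.

End Induction.

(** * Absolutely continuous functions *)

Section AbsCont.
Context {R : realType}.
Local Notation mu := (@lebesgue_measure R).
Implicit Types (c d e : R) (u v F : R -> R).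

Lemma abs_continuousS c d c' d' u : c <= c' -> d' <= d ->
  abs_continuous c d u -> abs_continuous c' d' u.
Proof.
move=> cc dd ac e e0; have [dl dl0 h] := ac e e0; exists dl => // n s t st.
apply: h => i; have [h1 [h2 h3]] := st i.
by split; [exact: le_trans h1|split=> //; exact: le_trans dd].
Qed.

Lemma abs_continuous_eq c d u v : (forall y, c <= y <= d -> u y = v y) ->
  abs_continuous c d u -> abs_continuous c d v.
Proof.
move=> uv ac e e0; have [dl dl0 h] := ac e e0; exists dl => // n s t st tr lt.
rewrite (eq_bigr (fun i => `|u (t i) - u (s i)|)); first exact: h.
move=> i _; have [h1 [h2 h3]] := st i.
by rewrite !uv// ?(le_trans h1 h2) ?h3 ?h1 ?(le_trans h2 h3).
Qed.

Lemma abs_continuous_cst c d (k : R) : abs_continuous c d (fun=> k).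
Proof.
move=> e e0; exists 1 => // n s t _ _ _.
by rewrite big1// => i _; rewrite subrr normr0.
Qed.

Lemma abs_continuous_osc c d u e : abs_continuous c d u -> 0 < e ->
  exists2 dl : R, 0 < dl &
    forall s t, c <= s -> s <= t -> t <= d -> t - s < dl -> `|u t - u s| < e.
Proof.
move=> ac e0; have [dl dl0 h] := ac e e0; exists dl => // s t cs st td lt.
have := h 1%N (fun=> s) (fun=> t).
by rewrite !big_ord1; apply => //; move=> i j _ _ _; rewrite !ord1.
Qed.

Lemma abs_continuous_bounded c d u : c <= d -> abs_continuous c d u ->
  exists2 K : R, 0 < K & forall y, c <= y <= d -> `|u y| <= K.
Proof.
move=> cd ac; have [dl dl0 h] := abs_continuous_osc ac ltr01.
suff [K K0 hK] : exists2 K : R, 0 < K & forall y, c <= y <= d -> `|u y| <= K.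
  by exists K.
apply: (@interval_induction _ c d
  (fun x => exists2 K : R, 0 < K & forall y, c <= y <= x -> `|u y| <= K)) => //.
  exists (`|u c| + 1); first by rewrite ltr_pwDr.
  move=> y /andP[y1 y2]; have -> : y = c by apply/eqP; rewrite eq_le y1 y2.
  by rewrite lerDl.
move=> t /andP[ct td]; exists (dl / 2); first by rewrite divr_gt0.
move=> x y /andP[cx xt] /andP[ty yd] tx yt [K K0 hK].
exists (K + 1); first lra.
move=> z /andP[cz zy]; have [zx|xz] := leP z x.
  by apply: (le_trans (hK z _)); [rewrite cz zx|lra].
have hx : `|u x| <= K by apply: hK; rewrite cx lexx.
have : `|u z - u x| < 1 by apply: h => //; lra.
have := ler_normD (u z - u x) (u x); rewrite subrK => *; lra.
Qed.

Lemma abs_continuousD c d u v : abs_continuous c d u -> abs_continuous c d v ->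
  abs_continuous c d (fun y => u y + v y).
Proof.
move=> au av e e0; have e2 : 0 < e / 2 by rewrite divr_gt0.
have [d1 d10 h1] := au _ e2; have [d2 d20 h2] := av _ e2.
exists (Num.min d1 d2); first by rewrite lt_min d10 d20.
move=> n s t st tr; rewrite lt_min => /andP[l1 l2].
have := h1 n s t st tr l1; have := h2 n s t st tr l2.
suff : \sum_(i < n) `|u (t i) + v (t i) - (u (s i) + v (s i))| <=
  \sum_(i < n) `|u (t i) - u (s i)| + \sum_(i < n) `|v (t i) - v (s i)|.
  move=> *; lra.
rewrite -big_split/=; apply: ler_sum => i _.
by rewrite opprD addrACA; exact: ler_normD.
Qed.

Lemma abs_continuousM c d u v : c <= d ->
  abs_continuous c d u -> abs_continuous c d v ->
  abs_continuous c d (fun y => u y * v y).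
Proof.
move=> cd au av e e0.
have [Ku Ku0 hu] := abs_continuous_bounded cd au.
have [Kv Kv0 hv] := abs_continuous_bounded cd av.
have eu : 0 < e / 2 / Ku by rewrite !divr_gt0.
have ev : 0 < e / 2 / Kv by rewrite !divr_gt0.
have [d1 d10 h1] := au _ ev; have [d2 d20 h2] := av _ eu.
exists (Num.min d1 d2); first by rewrite lt_min d10 d20.
move=> n s t st tr; rewrite lt_min => /andP[l1 l2].
have := h1 n s t st tr l1; have := h2 n s t st tr l2.
rewrite !ltr_pdivlMr// => h4 h3.
suff : \sum_(i < n) `|u (t i) * v (t i) - (u (s i) * v (s i))| <=
  (\sum_(i < n) `|u (t i) - u (s i)|) * Kv +
  (\sum_(i < n) `|v (t i) - v (s i)|) * Ku.
  move=> *; lra.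
rewrite !mulr_suml -big_split/=; apply: ler_sum => i _.
have [a1 [a2 a3]] := st i.
rewrite (_ : _ - _ = (u (t i) - u (s i)) * v (t i) +
   (v (t i) - v (s i)) * u (s i)); last by ring.
rewrite (le_trans (ler_normD _ _))// !normrM lerD// ler_wpM2l//.
  by apply: hv; rewrite a3 (le_trans a1 a2).
by apply: hu; rewrite a1 (le_trans a2 a3).
Qed.

Lemma abs_continuousZ c d (k : R) u : c <= d -> abs_continuous c d u ->
  abs_continuous c d (fun y => k * u y).
Proof.
by move=> cd au; apply: (abs_continuousM cd) => //; exact: abs_continuous_cst.
Qed.

Lemma abs_continuousB c d u v : c <= d ->
  abs_continuous c d u -> abs_continuous c d v ->
  abs_continuous c d (fun y => u y - v y).
Proof.
move=> cd au av; apply: abs_continuousD => //.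
apply: (@abs_continuous_eq _ _ (fun y => (-1) * v y)).
  by move=> y _; rewrite mulN1r.
exact: abs_continuousZ.
Qed.

(** An interval straddling the junction is clipped on either side of it, which
    keeps the family disjoint and does not increase its total length. *)
Lemma abs_continuous_cat c x d u : c <= x -> x <= d ->
  abs_continuous c x u ->
  abs_continuous x d u -> abs_continuous c d u.
Proof.
move=> cx xd a1 a2 e e0; have e2 : 0 < e / 2 by rewrite divr_gt0.
have [d1 d10 h1] := a1 _ e2; have [d2 d20 h2] := a2 _ e2.
exists (Num.min d1 d2); first by rewrite lt_min d10 d20.
move=> n s t st tr; rewrite lt_min => /andP[l1 l2].
pose s1 i := Num.min (s i) x; pose t1 i := Num.min (t i) x.
pose s2 i := Num.max (s i) x; pose t2 i := Num.max (t i) x.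
have E i : [/\ s1 i <= t1 i, s2 i <= t2 i, t1 i - s1 i <= t i - s i,
   t2 i - s2 i <= t i - s i &
   `|u (t i) - u (s i)| <= `|u (t1 i) - u (s1 i)| + `|u (t2 i) - u (s2 i)|].
  have [b1 [b2 b3]] := st i.
  rewrite /s1 /t1 /s2 /t2 /Num.min /Num.max.
  have := ler_normD (u (t i) - u x) (u x - u (s i)).
  rewrite addrA subrK => b4.
  have [?|?] := ltP (s i) x; have [?|?] := ltP (t i) x;
    rewrite ?subrr ?normr0 ?addr0 ?add0r ?lexx; split => //; lra.
have tr1 : trivIset [set: 'I_n] (fun i => `]s1 i, t1 i[%classic).
  move=> i j _ _ [z /= []]; rewrite !in_itv/= /s1 /t1 !gt_min !lt_min.
  move=> /andP[/orP[h1'|h1'] /andP[h2' h3']] /andP[/orP[h4|h4] /andP[h5 h6]];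
    try by exfalso; lra.
  by apply: tr => //; exists z; rewrite /= !in_itv/= h1' h2' h4 h5.
have tr2 : trivIset [set: 'I_n] (fun i => `]s2 i, t2 i[%classic).
  move=> i j _ _ [z /= []]; rewrite !in_itv/= /s2 /t2 !gt_max !lt_max.
  move=> /andP[/andP[h1' h2'] /orP[h3'|h3']] /andP[/andP[h4 h5] /orP[h6|h6]];
    try by exfalso; lra.
  by apply: tr => //; exists z; rewrite /= !in_itv/= h1' h3' h4 h6.
have H1 : \sum_(i < n) `|u (t1 i) - u (s1 i)| < e / 2.
  apply: h1 => //.
    move=> i; have [b1 [b2 b3]] := st i; have [b4 _ _ _ _] := E i.
    by rewrite /s1 le_min b1 cx; split=> //; split=> //; rewrite /t1 ge_min lexx orbT.
  by apply: le_lt_trans l1; apply: ler_sum => i _; have [] := E i.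
have H2 : \sum_(i < n) `|u (t2 i) - u (s2 i)| < e / 2.
  apply: h2 => //.
    move=> i; have [b1 [b2 b3]] := st i; have [_ b4 _ _ _] := E i.
    by rewrite {1}/s2 le_max lexx orbT; split=> //; split=> //; rewrite /t2 ge_max b3.
  by apply: le_lt_trans l2; apply: ler_sum => i _; have [] := E i.
rewrite (@le_lt_trans _ _ (\sum_(i < n) `|u (t1 i) - u (s1 i)| +
  \sum_(i < n) `|u (t2 i) - u (s2 i)|)) //; last lra.
by rewrite -big_split/=; apply: ler_sum => i _; have [] := E i.
Qed.

Local Notation itg c d := (mu.-integrable `[c, d]).

Lemma Rint_cat c x d (f : R -> R) : c <= x <= d -> itg c d (EFin \o f) ->
  \int[mu]_(t in `[c, d]) f t =
  \int[mu]_(t in `[c, x]) f t + \int[mu]_(t in `[x, d]) f t.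
Proof.
move=> /andP[cx xd] fi.
have := @Rintegral_itvB _ f (BLeft c) (BRight d) x fi.
rewrite !bnd_simp => /(_ cx xd) /eqP; rewrite subr_eq => /eqP ->.
rewrite addrC Rintegral_itv_obnd_cbnd//.
by apply: integrableS fi => //; apply: subset_itv; rewrite bnd_simp.
Qed.

Lemma integral_absolute_continuity (D : set R) (f : R -> R) e :
  measurable D -> mu.-integrable D (EFin \o f) -> 0 < e ->
  exists2 dl : R, 0 < dl & forall A, measurable A -> A `<=` D ->
    (mu A < dl%:E)%E -> \int[mu]_(t in A) `|f t| < e.
Proof.
move=> mD fi e0; pose g := f \_ D.
have gi : mu.-integrable setT (EFin \o g).
  by rewrite -restrict_EFin; apply/integrable_restrict => //=; rewrite setTI.
have [dl [dl0 h]] := integral_normr_continuous gi e0.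
exists dl => // A mA AD /(h _ mA); congr (_ < _).
apply: eq_Rintegral => t /set_mem At.
by rewrite /g patchE ifT// inE; exact: AD.
Qed.

Lemma Rint_setU_ord n (s t : 'I_n -> R) (f : R -> R) (D : set R) :
  measurable D -> mu.-integrable D (EFin \o f) ->
  (forall i, s i <= t i) -> (forall i, `[s i, t i]%classic `<=` D) ->
  trivIset [set: 'I_n] (fun i => `]s i, t i[%classic) ->
  \sum_(i < n) \int[mu]_(x in `[s i, t i]) `|f x| =
  \int[mu]_(x in \big[setU/set0]_(i < n) `]s i, t i[%classic) `|f x|.
Proof.
move=> mD fi st sD tr.
have mf : measurable_fun D f by case/integrableP: fi => /measurable_EFinP.
have UD : \big[setU/set0]_(i < n) `]s i, t i[%classic `<=` D.
  rewrite -bigcup_seq => x [i _] /= h; apply: (sD i); apply: subset_itv h; by rewrite bnd_simp.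
rewrite /Rintegral ge0_integral_bigsetU//=.
- rewrite -sum_fine; last first.
    move=> i _; apply: integrable_fin_num => //.
    by apply: integrable_norm; apply: integrableS fi => // x /= h; apply: (sD i); apply: subset_itv h; rewrite bnd_simp.
  apply: eq_bigr => i _; congr fine.
  have fo : measurable_fun `]s i, t i[ (EFin \o (fun x => `|f x|)).
    apply/measurable_EFinP/measurableT_comp => //.
    by apply: measurable_funS mf => // x /= h; apply: (sD i); apply: subset_itv h; rewrite bnd_simp.
  by rewrite integral_itv_bndoo.
- exact: index_enum_uniq.
- by apply: sub_trivIset tr.
- apply/measurable_EFinP/measurableT_comp => //.
  exact: measurable_funS UD mf.
Qed.

Lemma measure_bigsetU_itvoo n (s t : 'I_n -> R) : (forall i, s i <= t i) ->
  trivIset [set: 'I_n] (fun i => `]s i, t i[%classic) ->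
  mu (\big[setU/set0]_(i < n) `]s i, t i[%classic) =
  (\sum_(i < n) (t i - s i))%:E.
Proof.
move=> st tr.
rewrite measure_bigsetU_ord// (eq_bigr (fun i => (t i - s i)%:E)) ?sumEFin//.
move=> i _; rewrite /= (lebesgue_measure_itv `]s i, t i[) /= lte_fin.
case: ltgtP (st i) => [? _|//|-> _]; first by rewrite EFinB.
by rewrite subrr.
Qed.

Lemma abs_continuous_integral c d (f : R -> R) : c <= d ->
  itg c d (EFin \o f) ->
  abs_continuous c d (fun x => \int[mu]_(t in `[c, x]) f t).
Proof.
move=> cd fi e e0.
have [dl dl0 h] := integral_absolute_continuity (measurable_itv _) fi e0.
exists dl => // n s t st tr lt.
have sub i : `[s i, t i]%classic `<=` `[c, d]%classic.
  by have [? [? ?]] := st i; apply: subset_itv; rewrite bnd_simp.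
have st' i : s i <= t i by have [_ []] := st i.
have E i : \int[mu]_(x in `[c, t i]) f x - \int[mu]_(x in `[c, s i]) f x =
    \int[mu]_(x in `[s i, t i]) f x.
  have [b1 [b2 b3]] := st i.
  rewrite (@Rint_cat c (s i) (t i)) ?b1 ?b2//; first by rewrite addrAC subrr add0r.
  by apply: integrableS fi => //; apply: subset_itv; rewrite bnd_simp.
apply: (@le_lt_trans _ _ (\sum_(i < n) \int[mu]_(x in `[s i, t i]) `|f x|)).
  apply: ler_sum => i _; rewrite E; apply: le_normr_Rintegral => //.
  by apply: integrableS fi => //; exact: sub.
rewrite (Rint_setU_ord _ fi)//.
apply: h => //.
- by apply: bigsetU_measurable.
- rewrite -bigcup_seq => x [i _] /= hx; apply: (sub i); apply: subset_itv hx; by rewrite bnd_simp.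
- by rewrite measure_bigsetU_itvoo// lte_fin.
Qed.

End AbsCont.

Section Ftc.
Context {R : realType}.
Local Notation mu := (@lebesgue_measure R).
Local Notation itg c d := (mu.-integrable `[c, d]).
Implicit Types (c d e : R) (u v F : R -> R).

Lemma is_derive_approx F (t a e : R) : is_derive t 1 F a -> 0 < e ->
  exists2 dl : R, 0 < dl &
    forall y, `|y - t| < dl -> `|F y - F t - a * (y - t)| <= e * `|y - t|.
Proof.
move=> dF e0.
have h : (fun h : R => h^-1 *: (F (h *: 1 + t) - F t)) @ 0^' --> a.
  by have [df <-] := dF; exact: df.
move/cvgrPdist_le : h => /(_ _ e0); rewrite near_withinE => -[dl /= dl0 hdl].
exists dl => // y yt.
have [->|yNt] := eqVneq y t; first by rewrite !subrr mulr0 subrr normr0 mulr0.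
have yt0 : y - t != 0 by rewrite subr_eq0.
have := hdl (y - t); rewrite /ball_/= sub0r normrN => /(_ yt yt0).
rewrite [_%:A]mulr1 subrK /GRing.scale/= => hh.
have -> : F y - F t - a * (y - t) = - (a - (y - t)^-1 * (F y - F t)) * (y - t).
  by field.
by rewrite normrM normrN ler_wpM2r.
Qed.

(** Given [e], cover the null set of bad points by an open set [U] of small
    measure. Walking from [c] to [d], each point lets one advance a little,
    either with small slope (good points) or inside [U] (bad points); the steps
    inside [U] are disjoint and of small total length, so that by absolute
    continuity the increments over them have a small sum. *)
Lemma abs_continuous_deriv0 c d F : c <= d -> abs_continuous c d F ->
  {ae mu, forall y, c < y < d -> is_derive y 1 F 0} -> F d = F c.
Proof.
move=> cd ac [N [mN N0 hN]].
apply/eqP; rewrite -subr_eq0 -normr_le0; apply/ler_addgt0Pr => e e0.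
rewrite add0r.
pose k := e / (2 * (d - c + 1)).
have dc0 : 0 < d - c + 1 by lra.
have k0 : 0 < k by rewrite divr_gt0// mulr_gt0.
have e2 : 0 < e / 2 by rewrite divr_gt0.
have [dl dl0 hdl] := ac _ e2.
pose N' := N `|` ([set c] `|` [set d]).
have mN' : measurable N' by apply: measurableU => //; exact: measurableU.
have N'0 : mu N' = 0%E.
  have neg : mu.-negligible N'.
    apply: negligibleU; first exact/negligibleP.
    apply: negligibleU; apply/negligibleP => //; exact: lebesgue_measure_set1.
  exact/negligibleP.
have N'y : (mu N' < +oo)%E by rewrite N'0.
have [U [oU NU mU]] := lebesgue_regularity_outer mN' N'y dl0.
have mU' : measurable U by exact: open_measurable.
have {}mU : (mu U < dl%:E)%E.
  rewrite (_ : U = N' `|` (U `\` N')); last by rewrite setDUK.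
  apply: le_lt_trans mU; apply: (le_trans (measureU2 _ _ _)) => //.
    exact: measurableD.
  by rewrite [X in (X + _)%E](_ : _ = 0%E) ?add0e//; exact: N'0.
pose P x := exists n (s t : nat -> R), [/\
  forall i, (i < n)%N -> [/\ c <= s i, s i <= t i, t i <= x &
    `[s i, t i]%classic `<=` U],
  forall i j, (i < j < n)%N -> t i <= s j &
  `|F x - F c| <= k * (x - c) + \sum_(i < n) `|F (t i) - F (s i)|].
suff [n [s [t [st dis]]]] : P d.
  suff : \sum_(i < n) `|F (t i) - F (s i)| < e / 2.
    have : k * (d - c) <= e / 2.
      have -> : e / 2 = k * (d - c + 1) by rewrite /k; field; lra.
      by rewrite ler_wpM2l; lra.
    by move=> *; lra.
  have tr : trivIset [set: 'I_n] (fun i : 'I_n => `]s i, t i[%classic).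
    move=> i j _ _ [z /= []]; rewrite !in_itv/= => /andP[z1 z2] /andP[z3 z4].
    apply: val_inj => /=; case: (ltngtP i j) => // ij; exfalso.
      by have := dis i j; rewrite ij ltn_ord => /(_ isT); lra.
    by have := dis j i; rewrite ij ltn_ord => /(_ isT); lra.
  apply: hdl => //; first by move=> i; have [] := st i (ltn_ord i).
  rewrite -lte_fin -measure_bigsetU_itvoo//; last first.
    by move=> i; have [] := st i (ltn_ord i).
  apply: le_lt_trans mU; apply: le_measure; rewrite ?inE//.
    exact: bigsetU_measurable.
  rewrite -bigcup_seq => x [i _] /= hx; have [_ _ _] := st i (ltn_ord i); apply.
  by apply: subset_itv hx; rewrite bnd_simp.
apply: (@interval_induction _ c d P) => //.
  by exists 0%N, (fun=> 0), (fun=> 0); split => //; rewrite big_ord0 !subrr normr0 mulr0 addr0.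
move=> t /andP[ct td]; have [tN|tN] := pselect (N' t).
  have [r /= r0 hr] : nbhs t U by apply: open_nbhs_nbhs; split => //; exact: NU.
  exists r => // x y /andP[cx xt] /andP[ty yd] tx yt [n [s1 [t1 [h1 h2 h3]]]].
  exists n.+1, (fun i => if (i < n)%N then s1 i else x),
    (fun i => if (i < n)%N then t1 i else y); split.
  - move=> i; rewrite ltnS leq_eqVlt => /orP[/eqP ->|ni].
      rewrite ltnn; split => //; first exact: le_trans ty.
      move=> z /=; rewrite in_itv/= => /andP[z1 z2]; apply: hr => /=.
      by rewrite ltr_distlC; between.
    by rewrite ni; have [? ? ? ?] := h1 i ni; split => //; lra.
  - move=> i j /andP[ij]; rewrite ltnS leq_eqVlt => /orP[/eqP jn|jn].
      rewrite jn ltnn -jn ij; rewrite jn in ij; by have [] := h1 i ij.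
    by rewrite jn (ltn_trans ij jn); apply: h2; rewrite ij jn.
  - rewrite big_ord_recr/= ltnn (eq_bigr (fun i : 'I_n => `|F (t1 i) - F (s1 i)|)); last first.
      by move=> i _; rewrite ltn_ord.
    have := ler_normD (F y - F x) (F x - F c); rewrite addrA subrK => hh.
    have : k * (x - c) <= k * (y - c) by rewrite ler_wpM2l; lra.
    by move=> *; lra.
have ctd : c < t < d.
  apply/andP; split.
    by rewrite lt_neqAle ct andbT; apply/eqP => E; apply: tN; right; left; rewrite /= E.
  by rewrite lt_neqAle td andbT; apply/eqP => E; apply: tN; right; right.
have dF : is_derive t 1 F 0.
  by apply: contrapT => h; apply: tN; left; apply: hN => /= /(_ ctd).
have [r r0 hr] := is_derive_approx dF k0.
exists r => // x y /andP[cx xt] /andP[ty yd] tx yt [n [s1 [t1 [h1 h2 h3]]]].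
exists n, s1, t1; split => //.
  by move=> i ni; have [? ? ? ?] := h1 i ni; split => //; lra.
have := hr x; rewrite ltr_distlC mul0r subr0 => /(_ ltac:(between)).
have := hr y; rewrite ltr_distlC mul0r subr0 => /(_ ltac:(between)).
rewrite (ger0_norm (_ : 0 <= y - t)) ?subr_ge0// (ler0_norm (_ : x - t <= 0)) ?subr_le0//.
have := ler_normD (F y - F t) (F t - F x); rewrite addrA subrK => hh.
have := ler_normD (F y - F x) (F x - F c); rewrite addrA subrK => hh'.
rewrite (distrC (F x) (F t)) => *; nra.
Qed.

(** This is Lebesgue's differentiation theorem, applied to the extension of [g]
    by 0. *)
Lemma integral_is_derive_ae c d (g : R -> R) : itg c d (EFin \o g) ->
  {ae mu, forall y, c < y < d ->
     is_derive y 1 (fun x => \int[mu]_(t in `[c, x]) g t) (g y)}.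
Proof.
move=> gi; pose G x := \int[mu]_(t in `[c, x]) g t.
have locg := integrable_locally (measurable_itv _) gi.
pose gd := g \_ `[c, d].
have gdi y : mu.-integrable [set` Interval (BLeft c) (BRight y)] (EFin \o gd).
  apply: integrableS (_ : mu.-integrable setT _) => //=.
  by rewrite -restrict_EFin; apply/integrable_restrict => //=; rewrite setTI.
have := FTC1 gdi locg.
apply: aeS.
move=> y hG /andP[cy yd].
have [|h1 h2] := hG; first by rewrite lte_fin.
have e : \forall z \near y, \int[mu]_(t in [set` `[c, z]]) gd t = G z.
  near=> z; apply: eq_Rintegral => t; rewrite inE/= in_itv/= => /andP[ct tz].
  rewrite /gd patchE ifT// inE/= in_itv/= ct/= (le_trans tz)//.
  near: z; exists (d - y) => /= [|z]; first by rewrite subr_gt0.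
  by rewrite /ball_/= ltr_distlC => /andP[_ ?]; lra.
have -> : g y = gd y by rewrite /gd patchE ifT// inE/= in_itv/= !ltW.
apply: near_eq_is_derive e _.
apply: DeriveDef; first exact: h1.
by rewrite -derive1E; exact: h2.
Unshelve. all: by end_near. Qed.

(** Both [F] and the indefinite integral of [g] are absolutely continuous, and
    by Lebesgue's differentiation theorem they have the same derivative almost
    everywhere. *)
Lemma abs_continuous_FTC c d F (g : R -> R) : c <= d -> abs_continuous c d F ->
  itg c d (EFin \o g) ->
  {ae mu, forall y, c < y < d -> is_derive y 1 F (g y)} ->
  F d - F c = \int[mu]_(t in `[c, d]) g t.
Proof.
move=> cd ac gi dF.
pose G x := \int[mu]_(t in `[c, x]) g t.
suff : F d - G d = F c - G c.
  by rewrite /G set_itv1 Rintegral_set1 => h; apply/eqP; rewrite subr_eq addrC -subr_eq h subr0.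
apply: (@abs_continuous_deriv0 c d (fun y => F y - G y)) => //.
  by apply: abs_continuousB => //; exact: abs_continuous_integral.
have := integral_is_derive_ae gi.
apply: aeS2 dF.
move=> y hF hG cyd; rewrite [X in is_derive _ _ _ X](_ : 0 = g y - g y); last by rewrite subrr.
by apply: is_deriveB; [exact: hF | exact: hG].
Qed.

End Ftc.

(** * Integrability on segments *)

Section Segments.
Context {R : realType}.
Local Notation mu := (@lebesgue_measure R).
Local Notation itg c d := (mu.-integrable `[c, d]).
Implicit Types (c d e : R) (u v f g h : R -> R) (D : set R).

Lemma abs_continuous_within c d u : abs_continuous c d u ->
  {within `[c, d], continuous u}.
Proof.
move=> ac; apply/subspace_continuousP => x /=; rewrite in_itv/= => /andP[cx xd].
apply/cvgrPdist_lt => e e0; have [dl dl0 h] := abs_continuous_osc ac e0.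
rewrite near_withinE; exists dl => //= y; rewrite /ball_/= ltr_distlC => /andP[y1 y2].
rewrite in_itv/= => /andP[cy yd]; have [xy|yx] := leP x y.
  by rewrite distrC; apply: h => //; lra.
by apply: h => //; [exact: ltW|lra].
Qed.

Lemma abs_continuous_measurable c d u : abs_continuous c d u ->
  measurable_fun `[c, d] u.
Proof.
move=> ac; apply: subspace_continuous_measurable_fun => //.
exact: abs_continuous_within.
Qed.

Lemma integrable_bounded D f (K : R) : measurable D -> (mu D < +oo)%E ->
  measurable_fun D f -> (forall y, D y -> `|f y| <= K) ->
  mu.-integrable D (EFin \o f).
Proof.
move=> mD Dy mf fK; apply: measurable_bounded_integrable => //.
exists K; split; first exact: num_real.
by move=> K' KK' y /= Dy'; rewrite (le_trans (fK _ Dy'))// ltW.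
Qed.

Lemma integrable_bddM D f h (K : R) : measurable D ->
  mu.-integrable D (EFin \o f) -> measurable_fun D h ->
  (forall y, D y -> `|h y| <= K) ->
  mu.-integrable D (EFin \o (fun y => h y * f y)).
Proof.
move=> mD fi mh hK.
apply: (@integrableMr _ _ _ mu D mD h (EFin \o f)) => //.
exists K; split; first exact: num_real.
by move=> K' KK' y /= Dy'; rewrite (le_trans (hK _ Dy'))// ltW.
Qed.

Lemma integrable_subitv c d c' d' f : c <= c' -> d' <= d ->
  itg c d (EFin \o f) -> itg c' d' (EFin \o f).
Proof.
by move=> cc dd fi; apply: integrableS fi => //; apply: subset_itv; rewrite bnd_simp.
Qed.

Lemma integrable_realD D f g : measurable D -> mu.-integrable D (EFin \o f) ->
  mu.-integrable D (EFin \o g) ->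
  mu.-integrable D (EFin \o (fun y => f y + g y)).
Proof. by move=> mD fi gi; apply: (@integrableD _ _ _ mu D mD (EFin \o f) (EFin \o g)). Qed.

Lemma integrable_realB D f g : measurable D -> mu.-integrable D (EFin \o f) ->
  mu.-integrable D (EFin \o g) ->
  mu.-integrable D (EFin \o (fun y => f y - g y)).
Proof. by move=> mD fi gi; apply: (@integrableB _ _ _ mu D mD (EFin \o f) (EFin \o g)). Qed.

Lemma integrable_realZ D f (k : R) : measurable D ->
  mu.-integrable D (EFin \o f) ->
  mu.-integrable D (EFin \o (fun y => k * f y)).
Proof. by move=> mD fi; apply: (@integrableZl _ _ _ mu D mD k (EFin \o f)). Qed.

Lemma abs_continuous_integrable c d u : c <= d -> abs_continuous c d u ->
  itg c d (EFin \o u).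
Proof.
move=> cd ac; have [K K0 hK] := abs_continuous_bounded cd ac.
apply: (@integrable_bounded _ _ K) => //.
- by rewrite /= lebesgue_measure_itv/=; case: ifP => _; rewrite ?ltry// -EFinB ltry.
- exact: abs_continuous_measurable.
Qed.

Lemma integrable_acM c d u f : c <= d -> abs_continuous c d u ->
  itg c d (EFin \o f) -> itg c d (EFin \o (fun y => u y * f y)).
Proof.
move=> cd ac fi; have [K K0 hK] := abs_continuous_bounded cd ac.
apply: (@integrable_bddM _ _ _ K) => //; exact: abs_continuous_measurable.
Qed.

Lemma Rint_norm_le D f : measurable D -> mu.-integrable D (EFin \o f) ->
  `|\int[mu]_(t in D) f t| <= \int[mu]_(t in D) `|f t|.
Proof. by move=> *; exact: le_normr_Rintegral. Qed.

Lemma Rint_subset D D' f : measurable D -> measurable D' -> D `<=` D' ->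
  mu.-integrable D' (EFin \o f) -> (forall y, D' y -> 0 <= f y) ->
  \int[mu]_(t in D) f t <= \int[mu]_(t in D') f t.
Proof.
move=> mD mD' DD fi f0.
have fi' : mu.-integrable D (EFin \o f) by apply: integrableS fi.
apply: fine_le; [exact: integrable_fin_num..|].
apply: ge0_subset_integral => //; first by case/integrableP: fi.
Qed.

Lemma Rint_norm_leM c d s t f g (K : R) : c <= s -> t <= d ->
  itg c d (EFin \o f) -> itg s t (EFin \o (fun y => g y * f y)) -> 0 <= K ->
  (forall y, s <= y <= t -> `|g y| <= K) ->
  `|\int[mu]_(y in `[s, t]) (g y * f y)| <= K * \int[mu]_(y in `[c, d]) `|f y|.
Proof.
move=> cs td fi gi K0 gK.
apply: (le_trans (Rint_norm_le _ gi)) => //.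
have fi' := integrable_subitv cs td fi.
apply: (@le_trans _ _ (\int[mu]_(y in `[s, t]) (K * `|f y|))).
  apply: le_Rintegral => //; first exact: integrable_norm.
    have := @integrableZl _ _ _ mu `[s, t]%classic (measurable_itv _) K _ (integrable_norm fi').
    by [].
  by move=> y /=; rewrite in_itv/= normrM => /gK ?; rewrite ler_wpM2r.
rewrite RintegralZl//; last exact: integrable_norm.
rewrite ler_wpM2l// Rint_subset//; last exact: integrable_norm.
by apply: subset_itv; rewrite bnd_simp.
Qed.

Lemma Rint_cst1 c d : c <= d -> \int[mu]_(y in `[c, d]) `|1| = d - c :> R.
Proof.
move=> cd; rewrite normr1 Rintegral_cst//= lebesgue_measure_itv/= lte_fin mul1r.
by case: ltgtP cd => //= ->; rewrite subrr.
Qed.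

Lemma integrable_cst c d (k : R) : itg c d (EFin \o (fun=> k)).
Proof.
apply: (@integrable_bounded _ _ `|k|) => //.
by rewrite /= lebesgue_measure_itv/=; case: ifP => _; rewrite ?ltry// -EFinB ltry.
Qed.

End Segments.

(** * Picard iteration on a short segment *)

Section Picard.
Context {R : realType}.
Local Notation mu := (@lebesgue_measure R).
Local Notation itg c d := (mu.-integrable `[c, d]).
Variables (c d y0 alpha beta : R) (q : R -> R).
Hypotheses (cy0 : c <= y0) (y0d : y0 <= d) (qi : itg c d (EFin \o q)).
Hypotheses (dc4 : d - c <= 4^-1) (q4 : \int[mu]_(t in `[c, d]) `|q t| <= 4^-1).

Let cd : c <= d. Proof. exact: le_trans y0d. Qed.

Let prim (f : R -> R) x := \int[mu]_(t in `[c, x]) f t - \int[mu]_(t in `[c, y0]) f t.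

Let prim_sub (f : R -> R) s t : itg c d (EFin \o f) -> c <= s -> s <= t -> t <= d ->
  prim f t - prim f s = \int[mu]_(y in `[s, t]) f y.
Proof.
move=> fi cs st td; rewrite /prim (@Rint_cat _ c s t) ?cs ?st//; first by ring.
exact: integrable_subitv fi.
Qed.

Let prim_y0 f : prim f y0 = 0.
Proof. by rewrite /prim subrr. Qed.

Let prim_ac (f : R -> R) : itg c d (EFin \o f) -> abs_continuous c d (prim f).
Proof.
move=> fi; apply: abs_continuousB => //; first exact: abs_continuous_integral.
exact: abs_continuous_cst.
Qed.

Let prim_le (f g : R -> R) (K : R) x : itg c d (EFin \o f) ->
  itg c d (EFin \o (fun y => g y * f y)) -> 0 <= K ->
  (forall y, c <= y <= d -> `|g y| <= K) ->
  \int[mu]_(t in `[c, d]) `|f t| <= 4^-1 -> c <= x <= d ->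
  `|prim (fun y => g y * f y) x| <= K / 4.
Proof.
move=> fi gi K0 gK f4 /andP[cx xd].
apply: (@le_trans _ _ (K * \int[mu]_(t in `[c, d]) `|f t|)); last by rewrite ler_wpM2l.
rewrite -[prim _ _]subr0 -(prim_y0 (fun y => g y * f y)).
have [xy|yx] := leP y0 x.
  rewrite prim_sub//; apply: Rint_norm_leM => //; first exact: integrable_subitv gi.
  by move=> y /andP[h1 h2]; apply: gK; rewrite (le_trans _ h1) ?(le_trans h2).
rewrite distrC prim_sub//; last exact: ltW.
apply: Rint_norm_leM => //; first exact: integrable_subitv gi.
by move=> y /andP[h1 h2]; apply: gK; rewrite (le_trans _ h1) ?(le_trans h2).
Qed.

(** Iterates for the system [u' = w], [w' = q u] as integral equations. The
    factor 1 gives both components the shape to which [prim_le] applies. *)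
Fixpoint picard n : (R -> R) * (R -> R) :=
  if n is m.+1 then
    (fun x => alpha + prim (fun y => (picard m).2 y * 1) x,
     fun x => beta + prim (fun y => (picard m).1 y * q y) x)
  else (fun=> alpha, fun=> beta).

Let picS1 n x : (picard n.+1).1 x = alpha + prim (fun y => (picard n).2 y * 1) x.
Proof. by []. Qed.
Let picS2 n x : (picard n.+1).2 x = beta + prim (fun y => (picard n).1 y * q y) x.
Proof. by []. Qed.

Let i1 : itg c d (EFin \o (fun=> 1 : R)). Proof. exact: integrable_cst. Qed.
Let i14 : \int[mu]_(t in `[c, d]) `|1| <= 4^-1 :> R.
Proof. by rewrite Rint_cst1. Qed.

Let picard_ac n : abs_continuous c d (picard n).1 /\ abs_continuous c d (picard n).2.
Proof.
elim: n => [|n [h1 h2]] /=; first by split; exact: abs_continuous_cst.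
by split; apply: abs_continuousD; (try exact: abs_continuous_cst);
  apply: prim_ac; exact: integrable_acM.
Qed.

Let K : R := `|alpha| + `|beta|.
Let K0 : 0 <= K. Proof. by rewrite addr_ge0. Qed.

Let prim_step (u v f : R -> R) : itg c d (EFin \o (fun y => u y * f y)) ->
  itg c d (EFin \o (fun y => v y * f y)) -> forall x, c <= x <= d ->
  prim (fun y => u y * f y) x - prim (fun y => v y * f y) x =
  prim (fun y => (u y - v y) * f y) x.
Proof.
move=> ui vi x /andP[cx xd].
have E t : c <= t <= d -> \int[mu]_(y in `[c, t]) ((u y - v y) * f y) =
   \int[mu]_(y in `[c, t]) (u y * f y) - \int[mu]_(y in `[c, t]) (v y * f y).
  move=> /andP[ct td]; rewrite -RintegralB//.
  - by apply: eq_Rintegral => y _; rewrite mulrBl.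
  - exact: (@integrable_subitv _ c d).
  - exact: (@integrable_subitv _ c d).
by rewrite /prim !E ?cx ?xd ?cy0 ?y0d//; ring.
Qed.

Let picard_step n x : c <= x <= d ->
  `|(picard n.+1).1 x - (picard n).1 x| <= K * 2^-1 ^+ n /\
  `|(picard n.+1).2 x - (picard n).2 x| <= K * 2^-1 ^+ n.
Proof.
elim: n x => [|n IH] x cxd.
  rewrite /= !(addrC _ (prim _ _)) !addrK expr0 (mulr1 K).
  have hK (k : R) : `|k| <= K -> `|k| / 4 <= K.
    by move=> h; have := normr_ge0 k; lra.
  have ac k : abs_continuous c d (fun=> k : R) by exact: abs_continuous_cst.
  have [hb ha] : `|beta| / 4 <= K /\ `|alpha| / 4 <= K.
    by split; apply: hK; rewrite ?lerDl ?lerDr.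
  split.
    by apply: le_trans hb; apply: prim_le => //; exact: (integrable_acM cd (ac beta)).
  by apply: le_trans ha; apply: prim_le => //; exact: (integrable_acM cd (ac alpha)).
have [[a1 a2] [b1 b2]] := (picard_ac n.+1, picard_ac n).
have e0 : 0 <= K * 2^-1 ^+ n by rewrite mulr_ge0// exprn_ge0.
have E : K * 2^-1 ^+ n / 4 <= K * 2^-1 ^+ n.+1 by rewrite exprS; lra.
have sub (k s t : R) : k + s - (k + t) = s - t by ring.
rewrite (picS1 n.+1) (picS1 n) (picS2 n.+1) (picS2 n) !sub.
have [j1 j2] := (integrable_acM cd a2 i1, integrable_acM cd b2 i1).
have [j3 j4] := (integrable_acM cd a1 qi, integrable_acM cd b1 qi).
rewrite (prim_step j1 j2 cxd) (prim_step j3 j4 cxd).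
split; apply: le_trans E; apply: prim_le => //.
- by apply: integrable_acM => //; exact: abs_continuousB.
- by move=> y /IH[].
- by apply: integrable_acM => //; exact: abs_continuousB.
- by move=> y /IH[].
Qed.

Let geo_cvg (f : nat -> R) : (forall n, `|f n.+1 - f n| <= K * 2^-1 ^+ n) ->
  exists2 l : R, f @ \oo --> l & forall n, `|l - f n| <= 2 * K * 2^-1 ^+ n.
Proof.
move=> hf.
have hd n m : `|f (n + m)%N - f n| <= 2 * K * 2^-1 ^+ n - 2 * K * 2^-1 ^+ (n + m).
  elim: m => [|m IH]; first by rewrite addn0 !subrr normr0.
  have := ler_normD (f (n + m.+1)%N - f (n + m)%N) (f (n + m)%N - f n).
  rewrite addrA subrK => h; apply: (le_trans h); have := hf (n + m)%N.
  by rewrite addnS exprS; lra.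
have p0 n : 0 <= 2 * K * 2^-1 ^+ n by rewrite !mulr_ge0// exprn_ge0.
have hd' n m : (n <= m)%N -> `|f m - f n| <= 2 * K * 2^-1 ^+ n.
  by move=> nm; have := hd n (m - n)%N; rewrite subnKC// => h; have := p0 m; lra.
have g0 : (fun n => 2 * K * 2^-1 ^+ n) @ \oo --> 0.
  rewrite -[X in _ --> X](mulr0 (2 * K)); apply: cvgMr.
  by apply: cvg_expr; rewrite ger0_norm; lra.
have cf : cvgn f.
  apply/cauchy_cvgP/cauchy_exP => e e0.
  have /cvgrPdist_lt/(_ e e0)[N _ hN] := g0; exists (f N).
  exists N => // m Nm; rewrite /ball/= distrC (le_lt_trans (hd' _ _ Nm))//.
  by have := hN N (leqnn N); rewrite sub0r normrN ger0_norm.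
exists (lim (f @ \oo)) => // n.
have : (fun m => `|f m - f n|) @ \oo --> `|lim (f @ \oo) - f n|.
  by apply: cvg_norm; apply: cvgB => //; exact: cvg_cst.
move=> h; apply: (cvgr_to_le h).
by near=> m; apply: hd'; near: m; exact: nbhs_infty_ge.
Unshelve. all: by end_near. Qed.

(** A fixed point of the iteration: the map contracts by 1/4 because the length
    of the segment and the integral of [|q|] are both at most 1/4. *)
Lemma picard_solution : exists u w : R -> R, [/\
  abs_continuous c d u /\ abs_continuous c d w, u y0 = alpha /\ w y0 = beta &
  forall x, c <= x <= d ->
    u x = alpha + prim w x /\ w x = beta + prim (fun y => u y * q y) x].
Proof.
have l1 x : exists l : R, c <= x <= d -> (fun n => (picard n).1 x) @ \oo --> l /\
    forall n, `|l - (picard n).1 x| <= 2 * K * 2^-1 ^+ n.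
  have [cxd|] := pselect (c <= x <= d); last by exists 0.
  have [l h1 h2] := @geo_cvg (fun n => (picard n).1 x) (fun n => (picard_step n cxd).1).
  by exists l.
have l2 x : exists l : R, c <= x <= d -> (fun n => (picard n).2 x) @ \oo --> l /\
    forall n, `|l - (picard n).2 x| <= 2 * K * 2^-1 ^+ n.
  have [cxd|] := pselect (c <= x <= d); last by exists 0.
  have [l h1 h2] := @geo_cvg (fun n => (picard n).2 x) (fun n => (picard_step n cxd).2).
  by exists l.
have [u hu] := choice l1; have [w hw] := choice l2.
have bnd (f : R -> R) g : (forall x, c <= x <= d -> `|f x - g x| <= 2 * K) ->
    abs_continuous c d g -> exists2 C : R, 0 < C & forall x, c <= x <= d -> `|f x| <= C.
  move=> h ac; have [C C0 hC] := abs_continuous_bounded cd ac.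
  exists (2 * K + C); first by rewrite ltr_wpDl// mulr_ge0.
  move=> x cxd; have := ler_normD (f x - g x) (g x); rewrite subrK => hh.
  by have := h x cxd; have := hC x cxd; lra.
have dcy : (mu `[c, d]%classic < +oo)%E.
  by rewrite /= lebesgue_measure_itv/=; case: ifP => _; rewrite ?ltry// -EFinB ltry.
have mu' : measurable_fun `[c, d] u.
  apply: (@measurable_fun_cvg _ _ _ _ (fun n => (picard n).1)).
    by move=> n; apply: abs_continuous_measurable; have [] := picard_ac n.
  by move=> x /=; rewrite in_itv/= => /hu[].
have mw : measurable_fun `[c, d] w.
  apply: (@measurable_fun_cvg _ _ _ _ (fun n => (picard n).2)).
    by move=> n; apply: abs_continuous_measurable; have [] := picard_ac n.
  by move=> x /=; rewrite in_itv/= => /hw[].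
have [Cu _ bu] : exists2 C : R, 0 < C & forall x, c <= x <= d -> `|u x| <= C.
  apply: (bnd u (picard 0).1); last by have [] := picard_ac 0.
  by move=> x /hu[_ /(_ 0%N)]; rewrite expr0 mulr1.
have [Cw _ bw] : exists2 C : R, 0 < C & forall x, c <= x <= d -> `|w x| <= C.
  apply: (bnd w (picard 0).2); last by have [] := picard_ac 0.
  by move=> x /hw[_ /(_ 0%N)]; rewrite expr0 mulr1.
have wi : itg c d (EFin \o (fun y => w y * 1)).
  by apply: (@integrable_bddM _ _ _ _ Cw) => // y /=; rewrite in_itv/= => /bw.
have ui : itg c d (EFin \o (fun y => u y * q y)).
  by apply: (@integrable_bddM _ _ _ _ Cu) => // y /=; rewrite in_itv/= => /bu.
have lim0 (r : R) : (forall n, `|r| <= 4 * K * 2^-1 ^+ n) -> r = 0.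
  move=> h; apply/eqP; rewrite -normr_le0.
  have g0 : (fun n => 4 * K * 2^-1 ^+ n) @ \oo --> 0.
    rewrite -[X in _ --> X](mulr0 (4 * K)); apply: cvgMr.
    by apply: cvg_expr; rewrite ger0_norm; lra.
  by apply: (cvgr_to_ge g0); near=> n; exact: h.
have step (f g h : R -> R) : itg c d (EFin \o f) ->
    \int[mu]_(t in `[c, d]) `|f t| <= 4^-1 ->
    itg c d (EFin \o (fun y => g y * f y)) -> abs_continuous c d h ->
    forall n x, (forall y, c <= y <= d -> `|g y - h y| <= 2 * K * 2^-1 ^+ n) ->
    c <= x <= d ->
    `|prim (fun y => g y * f y) x - prim (fun y => h y * f y) x| <= K * 2^-1 ^+ n.
  move=> fi f4 gi ac n x gh /andP[cx xd].
  have hi : itg c d (EFin \o (fun y => h y * f y)) by exact: integrable_acM.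
  rewrite (prim_step gi hi); last by rewrite cx xd.
  have p0 : 0 <= K * 2^-1 ^+ n by rewrite mulr_ge0// exprn_ge0.
  apply: (@le_trans _ _ (2 * K * 2^-1 ^+ n / 4)); last lra.
  apply: prim_le => //; last 2 first.
  - by rewrite -mulrA mulr_ge0.
  - by rewrite cx xd.
  rewrite (_ : (fun y => _) = fun y => g y * f y - h y * f y); last first.
    by apply/funext => y; rewrite mulrBl.
  exact: integrable_realB.
have p0 n : 0 <= K * 2^-1 ^+ n by rewrite mulr_ge0// exprn_ge0.
have Eu x : c <= x <= d -> u x = alpha + prim (fun y => w y * 1) x.
  move=> cxd; apply/eqP; rewrite -subr_eq0; apply/eqP/lim0 => n.
  have [_ /(_ n.+1)] := hu x cxd; rewrite picS1.
  have := step _ w (picard n).2 i1 i14 wi (picard_ac n).2 n x _ cxd.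
  move=> /(_ (fun y cyd => (hw y cyd).2 n)).
  set X := prim _ x; set Y := prim _ x => h1; rewrite exprS => h2.
  have := ler_normD (u x - (alpha + X)) (X - Y).
  have := ler_normD (u x - (alpha + Y)) (Y - X).
  rewrite (distrC Y X) (_ : u x - (alpha + Y) + (Y - X) = u x - (alpha + X)); last by ring.
  by have := p0 n; lra.
have Ew x : c <= x <= d -> w x = beta + prim (fun y => u y * q y) x.
  move=> cxd; apply/eqP; rewrite -subr_eq0; apply/eqP/lim0 => n.
  have [_ /(_ n.+1)] := hw x cxd; rewrite picS2.
  have := step _ u (picard n).1 qi q4 ui (picard_ac n).1 n x _ cxd.
  move=> /(_ (fun y cyd => (hu y cyd).2 n)).
  set X := prim _ x; set Y := prim _ x => h1; rewrite exprS => h2.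
  have := ler_normD (w x - (beta + Y)) (Y - X).
  rewrite (distrC Y X) (_ : w x - (beta + Y) + (Y - X) = w x - (beta + X)); last by ring.
  by have := p0 n; lra.
have w1 : (fun y => w y * 1) = w by apply/funext => y; rewrite mulr1.
rewrite w1 in wi Eu.
have cy0d : c <= y0 <= d by rewrite cy0 y0d.
exists u, w; split.
- split.
    apply: abs_continuous_eq (_ : abs_continuous c d (fun x => alpha + prim w x)).
      by move=> y /Eu.
    by apply: abs_continuousD; [exact: abs_continuous_cst|exact: prim_ac].
  apply: abs_continuous_eq (_ : abs_continuous c d (fun x => beta + prim (fun y => u y * q y) x)).
    by move=> y /Ew.
  by apply: abs_continuousD; [exact: abs_continuous_cst|exact: prim_ac].
- by rewrite Eu// Ew// !prim_y0 !addr0.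
- by move=> x cxd; split; [exact: Eu|exact: Ew].
Unshelve. all: by end_near. Qed.

Lemma linear_ode_exists : exists u w : R -> R, [/\
  abs_continuous c d u /\ abs_continuous c d w, u y0 = alpha /\ w y0 = beta,
  forall y, c < y < d -> is_derive y 1 u (w y) &
  {ae mu, forall y, c < y < d -> is_derive y 1 w (u y * q y)}].
Proof.
have [u [w [[acu acw] ini E]]] := picard_solution.
exists u, w; split => //.
- move=> y /andP[cy yd].
  have wi := abs_continuous_integrable cd acw.
  have cw : {for y, continuous w}.
    have /continuous_within_itvP := abs_continuous_within acw.
    by move=> /(_ (lt_trans cy yd))[+ _ _]; apply; rewrite in_itv/= cy yd.
  have [h1 h2] := continuous_FTC1_closed yd wi cy cw.
  have dF : is_derive y 1 (fun x => \int[mu]_(t in [set` `[c, x]]) w t) (w y).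
    by apply: DeriveDef; [exact: h1|rewrite -derive1E; exact: h2].
  have e : \forall z \near y,
      (alpha - \int[mu]_(t in `[c, y0]) w t) + \int[mu]_(t in `[c, z]) w t = u z.
    near=> z; rewrite (E z _).1 /prim; first by ring.
    apply/andP; split; apply: ltW; near: z; [exact: lt_nbhsr|exact: lt_nbhsl].
  apply: near_eq_is_derive e _; rewrite -[X in is_derive _ _ _ X]add0r.
  by apply: is_deriveD; exact: dF.
- have qui : itg c d (EFin \o (fun y => u y * q y)) by exact: integrable_acM.
  have := integral_is_derive_ae qui.
  apply: aeS.
  move=> y /[swap] /andP[cy yd]; rewrite cy yd => /(_ isT) dF.
  have e : \forall z \near y,
      (beta - \int[mu]_(t in `[c, y0]) (u t * q t)) + \int[mu]_(t in `[c, z]) (u t * q t) = w z.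
    near=> z; rewrite (E z _).2 /prim; first by ring.
    apply/andP; split; apply: ltW; near: z; [exact: lt_nbhsr|exact: lt_nbhsl].
  apply: near_eq_is_derive e _; rewrite -[X in is_derive _ _ _ X]add0r.
  by apply: is_deriveD; exact: dF.
Unshelve. all: by end_near. Qed.

End Picard.

(** * Real solutions of the interface problem *)

Section RealSolutionDefs.
Context {R : realType}.
Local Notation mu := (@lebesgue_measure R).

Definition regularR (D : set R) (u : R -> R) : Prop :=
  [/\ forall y, D y -> derivable u y 1,
      loc_abs_continuous D u,
      loc_abs_continuous D (derive1 u) &
      {ae mu, forall y, D y -> derivable (derive1 u) y 1}].

Definition rinterface (B : 'M[R]_2) (u : R -> R) (y : R) : Prop :=
  exists s s' t t' : R, [/\
    u @ y^'- --> s /\ derive1 u @ y^'- --> s',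
    u @ y^'+ --> t /\ derive1 u @ y^'+ --> t',
    t = B 0 0 * s + B 0 1 * s' & t' = B 1 0 * s + B 1 1 * s'].

(** Real solutions of [- u'' + V u = k], with interface conditions required at
    every point, the matrix being the identity off the interaction points. The
    source term [k] absorbs both [E * u] and the coupling between the real and
    imaginary parts of a solution for a non-real energy. *)
Definition rsol (V : R -> R) (M : set R) (B : R -> 'M[R]_2) (p q : \bar R)
    (k u : R -> R) : Prop :=
  [/\ regularR (oint p q `\` M) u,
      {ae mu, forall y, oint p q y -> derive1 (derive1 u) y = V y * u y - k y} &
      forall t, oint p q t -> rinterface (B t) u t].

Definition discrete_in (U M : set R) : Prop := forall t, U t ->
  exists2 e : R, 0 < e & forall y, `|y - t| < e -> y != t -> ~ M y.

Definition wr (u h : R -> R) y : R := u y * derive1 h y - derive1 u y * h y.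

Definition dsize (u : R -> R) y : R := `|u y| + `|derive1 u y|.

End RealSolutionDefs.

Section Intervals.
Context {R : realType}.
Local Notation mu := (@lebesgue_measure R).
Implicit Types (p q : \bar R) (D M U : set R) (u h : R -> R).

Lemma open_oint p q : open (oint p q).
Proof.
rewrite /oint (_ : [set y | _] = [set y | (p < y%:E)%E] `&` [set y | (y%:E < q)%E]).
  apply: openI.
    case: p => [r| |].
    - by rewrite (_ : [set y | _] = [set y | r < y]) //; exact: open_gt.
    - rewrite (_ : [set y | _] = set0); first exact: open0.
      by apply/seteqP; split => y.
    - rewrite (_ : [set y | _] = setT); first exact: openT.
      by apply/seteqP; split => y //= _; rewrite ltNyr.
  case: q => [r| |].
  - by rewrite (_ : [set y | _] = [set y | y < r]) //; exact: open_lt.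
  - rewrite (_ : [set y | _] = setT); first exact: openT.
    by apply/seteqP; split => y //= _; rewrite ltry.
  - rewrite (_ : [set y | _] = set0); first exact: open0.
    by apply/seteqP; split => y.
by apply/seteqP; split => y /= => [/andP[]|[-> ->]].
Qed.

Lemma oint_itvcc p q c d y : oint p q c -> oint p q d -> c <= y <= d -> oint p q y.
Proof.
move=> /andP[pc _] /andP[_ dq] /andP[cy yd]; apply/andP; split.
  by apply: lt_le_trans pc _; rewrite lee_fin.
by apply: le_lt_trans dq; rewrite lee_fin.
Qed.

Lemma ointE (c d y : R) : oint c%:E d%:E y = (c < y < d) :> Prop.
Proof. by rewrite /oint /= !lte_fin. Qed.

Lemma open_ball_ex U (t : R) : open U -> U t ->
  exists2 e : R, 0 < e & forall y, `|y - t| < e -> U y.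
Proof.
move=> oU Ut; have [e /= e0 he] : nbhs t U by exact: open_nbhs_nbhs.
by exists e => // y yt; apply: he; rewrite /ball_/= distrC.
Qed.

Lemma discrete_inS U U' M : U' `<=` U -> discrete_in U M -> discrete_in U' M.
Proof. by move=> UU hM t /UU /hM. Qed.

Lemma open_discrete_inD U M : open U -> discrete_in U M -> open (U `\` M).
Proof.
move=> oU hM; rewrite openE => t [Ut Mt].
have [e e0 he] := open_ball_ex oU Ut; have [r r0 hr] := hM t Ut.
exists (Num.min e r); first by rewrite /= lt_min e0 r0.
move=> y /=; rewrite distrC lt_min => /andP[ye yr]; split; first exact: he.
by have [->//|yt] := eqVneq y t; exact: hr.
Qed.

Lemma near_eq_ball u h (t e : R) : 0 < e ->
  (forall y, `|y - t| < e -> u y = h y) -> \near t, u t = h t.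
Proof.
by move=> e0 he; exists e => // y /=; rewrite distrC; exact: he.
Qed.

Lemma eq_on_open D u h : open D -> (forall y, D y -> u y = h y) ->
  forall y, D y -> (derivable u y 1 -> derivable h y 1) /\ derive1 u y = derive1 h y.
Proof.
move=> oD uh y Dy; have [e e0 he] := open_ball_ex oD Dy.
have e1 : \near y, u y = h y by apply: (near_eq_ball e0) => z /he /uh.
split; first exact: near_eq_derivable.
by rewrite !derive1E; exact: near_eq_derive.
Qed.

(** A property that propagates locally, in both directions, propagates along
    the whole interval. *)
Lemma chain_equiv p q (Q : R -> Prop) :
  (forall t, oint p q t -> exists2 e : R, 0 < e & forall s s',
     oint p q s -> oint p q s' -> `|s - t| < e -> `|s' - t| < e -> Q s -> Q s') ->
  forall y y', oint p q y -> oint p q y' -> Q y -> Q y'.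
Proof.
move=> step y y' py py' Qy; have [yy'|yy'] := leP y y'.
  apply: (interval_induction yy' Qy) => t tt.
  have [e e0 he] := step t (oint_itvcc py py' tt); exists e => // x z.
  move=> /andP[yx xt] /andP[tz zy'] h1 h2; case/andP: tt => ? ?; apply: he.
  - by apply: (oint_itvcc py py'); between.
  - by apply: (oint_itvcc py py'); between.
  - by rewrite ltr_distlC; between.
  - by rewrite ltr_distlC; between.
suff : Q y -> Q y' by apply.
apply: (@interval_induction _ y' y (fun s => Q s -> Q y')) => //; first exact: ltW.
move=> t tt.
have [e e0 he] := step t (oint_itvcc py' py tt); exists e => // x z.
move=> /andP[yx xt] /andP[tz zy'] h1 h2 h3 Qz; apply: h3; case/andP: tt => ? ?.
apply: he Qz.
- by apply: (oint_itvcc py' py); between.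
- by apply: (oint_itvcc py' py); between.
- by rewrite ltr_distlC; between.
- by rewrite ltr_distlC; between.
Qed.

(** Countably many intervals with rational endpoints suffice. *)
Lemma ae_local (U : set R) (P : R -> Prop) :
  (forall t, U t -> exists2 e : R, 0 < e &
     {ae mu, forall y, U y -> `|y - t| < e -> P y}) ->
  {ae mu, forall y, U y -> P y}.
Proof.
move=> loc.
pose N (rs : rat * rat) : set R := [set y | [/\ U y, ratr rs.1 < y < ratr rs.2 & ~ P y]].
pose F n : set R := [set y | exists rs, [/\ unpickle n = Some rs,
  mu.-negligible (N rs) & N rs y]].
have : mu.-negligible (\bigcup_n F n).
  apply: negligible_bigcup => n.
  have [[rs [E nN]]|h] :=
      pselect (exists rs, unpickle n = Some rs /\ mu.-negligible (N rs)).
    apply: negligibleS nN => y [rs' [E' _]].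
    by move: E'; rewrite E => -[<-].
  apply: negligibleS (negligible_set0 _) => y [rs [E nN _]].
  by apply: h; exists rs.
apply: negligibleS => y /= /not_implyP[Uy Py].
have [e e0 he] := loc y Uy.
have [r1] := @rat_in_itvoo R (y - e) y ltac:(lra).
rewrite in_itv/= => /andP[h1 h2].
have [r2] := @rat_in_itvoo R y (y + e) ltac:(lra).
rewrite in_itv/= => /andP[h3 h4].
exists (pickle (r1, r2)) => //; exists (r1, r2); split; first exact: pickleK.
  apply: negligibleS he => z [Uz /= /andP[z1 z2] Pz].
by move=> h; apply: Pz; apply: h => //; rewrite ltr_distlC; between.
by split => //=; rewrite h2 h3.
Qed.

End Intervals.

Section Solutions.
Context {R : realType}.
Local Notation mu := (@lebesgue_measure R).
Local Notation itg c d := (mu.-integrable `[c, d]).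
Variables (a b : \bar R) (V : R -> R) (M : set R) (B : R -> 'M[R]_2).
Hypothesis hV : locally_integrable (oint a b) V.
Hypothesis hM : discrete_in (oint a b) M.
Hypothesis cM : countable M.
Hypothesis Bdet : forall t, B t 0 0 * B t 1 1 - B t 0 1 * B t 1 0 = 1.
Local Notation sol := (rsol V M B).
Implicit Types (p q : \bar R) (u h k l : R -> R).

Lemma potential_integrable c d : oint a b c -> oint a b d -> itg c d (EFin \o V).
Proof.
move=> ac ad; have [mV _ hK] := hV.
have sub : `[c, d]%classic `<=` oint a b.
  by move=> y /=; rewrite in_itv/=; exact: oint_itvcc.
apply/integrableP; split.
  by apply/measurable_EFinP; apply: measurable_funS mV => //; apply: open_measurable; exact: open_oint.
by apply: le_lt_trans (hK _ sub (@segment_compact _ c d)).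
Qed.

Lemma rsolS p q p' q' k u : oint p' q' `<=` oint p q -> sol p q k u -> sol p' q' k u.
Proof.
move=> sub [[r1 r2 r3 r4] ae1 int]; split.
- have sub' : oint p' q' `\` M `<=` oint p q `\` M.
    by move=> y [? ?]; split => //; exact: sub.
  split.
  + by move=> y /sub'; exact: r1.
  + by move=> c d h; apply: r2; exact: subset_trans h sub'.
  + by move=> c d h; apply: r3; exact: subset_trans h sub'.
  + apply: aeS r4.
    by move=> y h /sub'.
- apply: aeS ae1.
  by move=> y h /sub.
- by move=> t /sub; exact: int.
Qed.

Lemma cvg_at_left_eq u h (t e l : R) : 0 < e -> (forall y, t - e < y < t -> u y = h y) ->
  u @ t^'- --> l -> h @ t^'- --> l.
Proof.
move=> e0 uh; apply: cvg_trans; apply: near_eq_cvg; near=> y; apply: uh.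
by apply/andP; split; near: y; [apply: nbhs_left_gt; lra | exact: nbhs_left_lt].
Unshelve. all: by end_near. Qed.

Lemma cvg_at_right_eq u h (t e l : R) : 0 < e -> (forall y, t < y < t + e -> u y = h y) ->
  u @ t^'+ --> l -> h @ t^'+ --> l.
Proof.
move=> e0 uh; apply: cvg_trans; apply: near_eq_cvg; near=> y; apply: uh.
by apply/andP; split; near: y; [exact: nbhs_right_gt | apply: nbhs_right_lt; lra].
Unshelve. all: by end_near. Qed.

Lemma punctured_ball p q t : oint p q `<=` oint a b -> oint p q t ->
  exists2 e : R, 0 < e & forall y, `|y - t| < e ->
    oint p q y /\ (y != t -> ~ M y).
Proof.
move=> sub pt; have [e e0 he] := open_ball_ex (@open_oint _ p q) pt.
have [r r0 hr] := hM (sub _ pt); exists (Num.min e r); first by rewrite lt_min e0.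
by move=> y; rewrite lt_min => /andP[ye yr]; split; [exact: he | exact: hr].
Qed.

Lemma punctured_sides p q t : oint p q `<=` oint a b -> oint p q t ->
  exists e : R, [/\ 0 < e, forall y, t - e < y < t -> (oint p q `\` M) y &
    forall y, t < y < t + e -> (oint p q `\` M) y].
Proof.
move=> sub pt; have [e e0 he] := punctured_ball sub pt.
exists e; split=> // y /andP[h1 h2].
  have [|h3 h4] := he y; first by rewrite ltr_distlC; between.
  by split=> //; apply: h4; rewrite lt_eqF.
have [|h3 h4] := he y; first by rewrite ltr_distlC; between.
by split=> //; apply: h4; rewrite gt_eqF.
Qed.

Lemma ball_sub (t e s : R) : `|s - t| < e ->
  exists2 r : R, 0 < r & forall x, `|x - s| < r -> `|x - t| < e.
Proof.
move=> h; exists (e - `|s - t|); first by rewrite subr_gt0.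
by move=> x xs; have := ler_normD (x - s) (s - t); rewrite addrA subrK; lra.
Qed.

Lemma close_point p q s r : oint p q `<=` oint a b -> oint p q s -> 0 < r ->
  exists x, [/\ `|x - s| < r, oint p q x & ~ M x].
Proof.
move=> sub ps r0; have [e [e0 _ he]] := punctured_sides sub ps.
have [m0 mr me] : [/\ 0 < Num.min r e, Num.min r e <= r & Num.min r e <= e].
  by rewrite lt_min r0 !ge_min !lexx orbT.
have [|px Mx] := he (s + Num.min r e / 2); first by between.
by exists (s + Num.min r e / 2); split => //; rewrite addrAC subrr add0r gtr0_norm; lra.
Qed.

(** Points off a discrete set are linked by chains of small balls, each of which
    contains further points off this set. *)
Lemma chain_off_discrete p q (P : R -> Prop) : oint p q `<=` oint a b ->
  (forall t, oint p q t -> exists2 e : R, 0 < e & forall x y,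
     `|x - t| < e -> `|y - t| < e -> oint p q x -> oint p q y -> ~ M x -> ~ M y ->
     P x -> P y) ->
  forall x y, oint p q x -> oint p q y -> ~ M x -> ~ M y -> P x -> P y.
Proof.
move=> sub loc x y px py Mx My Px.
pose Q s := exists2 r : R, 0 < r & forall z, `|z - s| < r -> oint p q z -> ~ M z -> P z.
suff [r r0] : Q y by apply=> //; rewrite subrr normr0.
apply: (@chain_equiv _ p q Q _ x) => // [t pt|].
  have [e e0 he] := loc t pt; exists e => // s s' ps ps' se s'e [r r0 hr].
  have [m m0 hm] := ball_sub se; have [m' m'0 hm'] := ball_sub s'e.
  have [|z [zs pz Mz]] := @close_point p q s (Num.min r m) sub ps.
    by rewrite lt_min r0.
  move: zs; rewrite lt_min => /andP[zr zm].
  by exists m' => // z' z's pz' Mz'; apply: (he z) => //; [exact: hm|exact: hm'|exact: hr].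
by have [e e0 he] := loc x px; exists e => // z zx pz Mz; apply: (he x) => //; rewrite subrr normr0.
Qed.

(** The values of a solution at the interaction points do not matter, which is
    what allows solutions to be defined piecewise. *)
Lemma rsol_eq p q k l u h : oint p q `<=` oint a b ->
  (forall y, oint p q y -> ~ M y -> u y = h y /\ k y = l y) ->
  sol p q k u -> sol p q l h.
Proof.
move=> sub uh [[r1 r2 r3 r4] ae1 int].
have oD : open (oint p q `\` M) by apply: open_discrete_inD; [exact: open_oint | exact: discrete_inS hM].
have uh' y : (oint p q `\` M) y -> u y = h y by move=> [? ?]; apply: (uh y _ _).1.
have duh y : (oint p q `\` M) y -> derive1 u y = derive1 h y.
  by move=> Dy; exact: (eq_on_open oD uh' Dy).2.
split.
- split.
  + by move=> y Dy; apply: (eq_on_open oD uh' Dy).1; exact: r1.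
  + move=> c d cd; apply: abs_continuous_eq (r2 c d cd) => y cyd.
    by apply: uh'; apply: cd; rewrite /= in_itv.
  + move=> c d cd; apply: abs_continuous_eq (r3 c d cd) => y cyd.
    by apply: duh; apply: cd; rewrite /= in_itv.
  + apply: aeS r4.
    by move=> y hy Dy; apply: (eq_on_open oD duh Dy).1; exact: hy.
- apply: aeS2 ae1 (ae_notin_countable cM).
  move=> y e1 nM py; have Dy : (oint p q `\` M) y by [].
  by rewrite -(eq_on_open oD duh Dy).2 e1// (uh' _ Dy) (uh y py nM).2.
- move=> t pt; have [e [e0 hl hr]] := punctured_sides sub pt.
  have [s [s' [v [v' [[c1 c2] [c3 c4] E1 E2]]]]] := int t pt.
  exists s, s', v, v'; split => //; split.
  + by apply: cvg_at_left_eq e0 _ c1 => y /hl; exact: uh'.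
  + by apply: cvg_at_left_eq e0 _ c2 => y /hl; exact: duh.
  + by apply: cvg_at_right_eq e0 _ c3 => y /hr; exact: uh'.
  + by apply: cvg_at_right_eq e0 _ c4 => y /hr; exact: duh.
Qed.

Lemma derivable_lin u h (c d y : R) : derivable u y 1 -> derivable h y 1 ->
  derivable (fun z => c * u z + d * h z) y 1 /\
  derive1 (fun z => c * u z + d * h z) y = c * derive1 u y + d * derive1 h y.
Proof.
move=> du dh.
have du' : is_derive y 1 u (derive1 u y) by apply: DeriveDef; rewrite ?derive1E.
have dh' : is_derive y 1 h (derive1 h y) by apply: DeriveDef; rewrite ?derive1E.
have D : is_derive y 1 (fun z => c * u z + d * h z) (c * derive1 u y + d * derive1 h y).
  have := is_deriveD (is_deriveZ c du') (is_deriveZ d dh'); exact.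
by split; [exact: ex_derive | rewrite derive1E; exact: derive_val].
Qed.

Lemma rsol_lin p q k l u h (c d : R) : oint p q `<=` oint a b ->
  sol p q k u -> sol p q l h ->
  sol p q (fun y => c * k y + d * l y) (fun y => c * u y + d * h y).
Proof.
move=> sub [[r1 r2 r3 r4] ae1 int] [[r1' r2' r3' r4'] ae1' int'].
have oD : open (oint p q `\` M) by apply: open_discrete_inD; [exact: open_oint | exact: discrete_inS hM].
set g := fun y => c * u y + d * h y.
have dg y : (oint p q `\` M) y -> c * derive1 u y + d * derive1 h y = derive1 g y.
  by move=> Dy; rewrite (derivable_lin _ _ (r1 y Dy) (r1' y Dy)).2.
have ac v w : loc_abs_continuous (oint p q `\` M) v -> loc_abs_continuous (oint p q `\` M) w ->
    loc_abs_continuous (oint p q `\` M) (fun y => c * v y + d * w y).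
  move=> h1 h2 x y xyD; have [xy|yx] := leP x y.
    by apply: abs_continuousD; apply: abs_continuousZ => //; [exact: h1|exact: h2].
  move=> e e0; exists 1 => // -[|n] s t st; first by rewrite !big_ord0.
  by have [? [? ?]] := st ord0; exfalso; lra.
split.
- split.
  + by move=> y Dy; apply: (derivable_lin _ _ (r1 y Dy) (r1' y Dy)).1.
  + exact: ac.
  + move=> x y xyD; apply: abs_continuous_eq (ac _ _ r3 r3' x y xyD) => z xyz.
    by apply: dg; apply: xyD; rewrite /= in_itv.
  + apply: aeS2 r4 r4'.
    move=> y h1 h2 Dy; apply: (eq_on_open oD dg Dy).1.
    exact: (derivable_lin _ _ (h1 Dy) (h2 Dy)).1.
- have r5 : {ae mu, forall y, (oint p q `\` M) y ->
      derivable (derive1 u) y 1 /\ derivable (derive1 h) y 1}.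
    by apply: aeS2 r4 r4' => y h1 h2 Dy; split; [exact: h1|exact: h2].
  have ae2 : {ae mu, forall y, oint p q y ->
      derive1 (derive1 u) y = V y * u y - k y /\ derive1 (derive1 h) y = V y * h y - l y}.
    by apply: aeS2 ae1 ae1' => y h1 h2 Dy; split; [exact: h1|exact: h2].
  apply: aeS3 ae2 (ae_notin_countable cM) r5.
  move=> y e1 nM d2 py; have Dy : (oint p q `\` M) y by [].
  have [e2 e3] := e1 py; have [d3 d4] := d2 Dy.
  by rewrite -(eq_on_open oD dg Dy).2 (derivable_lin _ _ d3 d4).2 e2 e3 /g; ring.
- move=> t pt; have [e [e0 hl hr]] := punctured_sides sub pt.
  have [s [s' [v [v' [[c1 c2] [c3 c4] E1 E2]]]]] := int t pt.
  have [z [z' [w [w' [[c1' c2'] [c3' c4'] E1' E2']]]]] := int' t pt.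
  have cl (F : set_system R) (FF : Filter F) (f g' : R -> R) (x y : R) : f @ F --> x -> g' @ F --> y ->
      (fun z => c * f z + d * g' z) @ F --> c * x + d * y.
    by move=> *; apply: cvgD; apply: cvgMr.
  exists (c * s + d * z), (c * s' + d * z'), (c * v + d * w), (c * v' + d * w').
  split; [split|split| |].
  + exact: cl.
  + by apply: cvg_at_left_eq e0 _ (cl _ _ _ _ _ _ c2 c2') => y /hl; exact: dg.
  + exact: cl.
  + by apply: cvg_at_right_eq e0 _ (cl _ _ _ _ _ _ c4 c4') => y /hr; exact: dg.
  + by rewrite E1 E1'; ring.
  + by rewrite E2 E2'; ring.
Qed.

Lemma derive1_is_derive u (y : R) : derivable u y 1 -> is_derive y 1 u (derive1 u y).
Proof. by move=> du; apply: DeriveDef; rewrite ?derive1E. Qed.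

Lemma rsol_second p q k u : sol p q k u -> {ae mu, forall y, (oint p q `\` M) y ->
  is_derive y 1 (derive1 u) (V y * u y - k y)}.
Proof.
move=> [[_ _ _ r4] ae1 _].
apply: aeS2 r4 ae1.
move=> y h1 h2 Dy; rewrite -(h2 Dy.1); exact/derive1_is_derive/h1.
Qed.

Lemma rsol_int p q k u c d : sol p q k u -> c <= d ->
  `[c, d]%classic `<=` oint p q `\` M ->
  itg c d (EFin \o (fun y => V y * u y - k y)) ->
  u d - u c = \int[mu]_(y in `[c, d]) derive1 u y /\
  derive1 u d - derive1 u c = \int[mu]_(y in `[c, d]) (V y * u y - k y).
Proof.
move=> su cd sub ki; have [[r1 r2 r3 r4] ae1 _] := su.
have inD y : c < y < d -> (oint p q `\` M) y.
  by move=> /andP[? ?]; apply: sub; rewrite /= in_itv/= !ltW.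
split; apply: abs_continuous_FTC => //.
- exact: r2.
- by apply: abs_continuous_integrable => //; exact: r3.
- by apply: aeW => y /inD Dy; exact/derive1_is_derive/r1.
- exact: r3.
- apply: aeS (rsol_second su).
  by move=> y h /inD; exact: h.
Qed.

(** Lagrange's identity: the potential cancels from the derivative of the
    Wronskian. *)
Lemma wr_int p q k l u h c d : sol p q k u -> sol p q l h -> c <= d ->
  `[c, d]%classic `<=` oint p q `\` M ->
  itg c d (EFin \o (fun y => k y * h y - l y * u y)) ->
  wr u h d - wr u h c = \int[mu]_(y in `[c, d]) (k y * h y - l y * u y).
Proof.
move=> su sh cd sub ki.
have [[r1 r2 r3 _] _ _] := su; have [[r1' r2' r3' _] _ _] := sh.
have inD y : c < y < d -> (oint p q `\` M) y.
  by move=> /andP[? ?]; apply: sub; rewrite /= in_itv/= !ltW.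
apply: abs_continuous_FTC => //.
  apply: abs_continuousB => //; apply: abs_continuousM => //;
    [exact: r2|exact: r3'|exact: r3|exact: r2'].
apply: aeS2 (rsol_second su) (rsol_second sh).
move=> y h1 h2 /inD Dy; have d1 := h1 Dy; have d2 := h2 Dy.
have d3 := derive1_is_derive (r1 y Dy); have d4 := derive1_is_derive (r1' y Dy).
have := is_deriveB (is_deriveM d3 d2) (is_deriveM d1 d4).
congr (is_derive _ _ _ _); rewrite /GRing.scale/=; ring.
Qed.

Variable E : R.
Local Notation eig p q u := (rsol V M B p q (fun y => E * u y) u).

Lemma shifted_integrable c d : oint a b c -> oint a b d ->
  itg c d (EFin \o (fun y => V y - E)).
Proof.
move=> ac ad; apply: integrable_realB => //; first exact: potential_integrable.
exact: integrable_cst.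
Qed.

(** Around any point, the length and the integral of [|V - E|] are small enough
    for the equation to be close to the trivial one. *)
Lemma small_segment t : oint a b t -> exists e : R,
  [/\ 0 < e, `[t - e, t + e]%classic `<=` oint a b,
    forall y, `|y - t| <= e -> y != t -> ~ M y,
    (t + e) - (t - e) <= 4^-1 &
    \int[mu]_(y in `[t - e, t + e]) `|V y - E| <= 4^-1].
Proof.
move=> at_; have [e [e0 hl hr]] := punctured_sides (@subset_refl _ _) at_.
have [e' e'0 he'] := open_ball_ex (@open_oint _ a b) at_.
pose r := Num.min e e' / 2.
have rr : [/\ 0 < r, r < e & r < e'].
  have m0 : 0 < Num.min e e' by rewrite lt_min e0 e'0.
  have : Num.min e e' <= e by rewrite ge_min lexx.
  have : Num.min e e' <= e' by rewrite ge_min lexx orbT.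
  by rewrite /r; split; lra.
case: rr => r0 re re'.
have ac : oint a b (t - r) by apply: he'; rewrite ltr_distlC; between.
have ad : oint a b (t + r) by apply: he'; rewrite ltr_distlC; between.
have p4 : 0 < 4^-1 :> R by rewrite invr_gt0.
have [dl dl0 hdl] :=
  integral_absolute_continuity (measurable_itv _) (shifted_integrable ac ad) p4.
pose s := Num.min (Num.min r (dl / 4)) 8^-1.
have [s0 sr sd s8] : [/\ 0 < s, s <= r, s <= dl / 4 & s <= 8^-1].
  rewrite /s; split.
  - by rewrite !lt_min r0/=; apply/andP; split; [apply: divr_gt0|].
  - by rewrite !ge_min lexx.
  - by rewrite !ge_min lexx !orbT.
  - by rewrite !ge_min lexx !orbT.
exists s; split => //.
- move=> y /=; rewrite in_itv/= => /andP[h1 h2]; apply: (oint_itvcc ac ad).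
  by between.
- move=> y; rewrite ler_distlC => /andP[h1 h2] yt.
  have [ty|yt'|ty] := ltgtP t y.
  + by have [] := hr y ltac:(between).
  + by have [] := hl y ltac:(between).
  + by rewrite ty eqxx in yt.
- lra.
- apply: ltW; apply: hdl => //.
    by apply: subset_itv; rewrite bnd_simp; lra.
  rewrite /= lebesgue_measure_itv/= lte_fin; case: ifP => _; last by rewrite lte_fin.
  by rewrite -EFinB lte_fin; lra.
Qed.

(** On a segment where the length and the integral of [|V - E|] are at most 1/4,
    the size of a solution varies at most by half of its maximum. *)
Lemma dsize_doubling p q u c d : oint p q `<=` oint a b -> eig p q u ->
  `[c, d]%classic `<=` oint p q `\` M -> d - c <= 4^-1 ->
  \int[mu]_(y in `[c, d]) `|V y - E| <= 4^-1 ->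
  forall x y, c <= x <= d -> c <= y <= d -> dsize u x <= 2 * dsize u y.
Proof.
move=> sub su cdD dc V4 x y cxd cyd.
have cd : c <= d by case/andP: cxd => /le_trans; apply.
have [[r1 r2 r3 _] _ _] := su.
have acu := r2 c d cdD; have acu' := r3 c d cdD.
have acN : {within `[c, d], continuous (dsize u)}.
  move=> z; apply: cvgD; apply: cvg_norm.
    exact: abs_continuous_within acu z.
  exact: abs_continuous_within acu' z.
have [m mcd hm] := EVT_max cd acN.
have ac : oint a b c by apply: sub; apply: (cdD c _).1; rewrite /= in_itv/= lexx.
have ad : oint a b d by apply: sub; apply: (cdD d _).1; rewrite /= in_itv/= lexx cd.
have Vi := shifted_integrable ac ad.
pose K := dsize u m.
have hK z : c <= z <= d -> `|u z| <= K /\ `|derive1 u z| <= K.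
  move=> czd; have := hm z; rewrite in_itv/= => /(_ czd); rewrite -/K /dsize => h.
  by have := normr_ge0 (u z); have := normr_ge0 (derive1 u z); split; lra.
have K0 : 0 <= K by rewrite /K /dsize addr_ge0.
have inc s t : c <= s -> s <= t -> t <= d ->
    `|u t - u s| <= K / 4 /\ `|derive1 u t - derive1 u s| <= K / 4.
  move=> cs st td.
  have stD : `[s, t]%classic `<=` oint p q `\` M.
    by apply: subset_trans cdD; apply: subset_itv; rewrite bnd_simp.
  have e1 : (fun z => V z * u z - E * u z) = fun z => u z * (V z - E).
    by apply/funext => z; ring.
  have ki : itg c d (EFin \o (fun z => u z * (V z - E))).
    exact: integrable_acM.
  have [] := rsol_int su st stD; rewrite e1; first exact: integrable_subitv ki.
  move=> -> ->; split.
    rewrite (_ : (fun z => _) = fun z => derive1 u z * 1); last by apply/funext => z; rewrite mulr1.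
    apply: (le_trans (Rint_norm_leM cs td (integrable_cst _ _ 1) _ K0 _)).
    - apply: integrable_subitv cs td _.
      by apply: (integrable_acM cd acu'); exact: integrable_cst.
    - by move=> z /andP[? ?]; apply: (hK z _).2; between.
    - by rewrite Rint_cst1// ler_wpM2l.
  apply: (le_trans (Rint_norm_leM cs td Vi _ K0 _)).
  - exact: integrable_subitv ki.
  - by move=> z /andP[? ?]; apply: (hK z _).1; between.
  - by rewrite ler_wpM2l.
have inc2 s t : c <= s <= d -> c <= t <= d -> dsize u s <= dsize u t + K / 2.
  move=> /andP[cs sd] /andP[ct td].
  have [i1 i2] : `|u s - u t| <= K / 4 /\ `|derive1 u s - derive1 u t| <= K / 4.
    have [st|ts] := leP s t; last exact: inc (ltW ts) _.
    by rewrite distrC (distrC (derive1 u s)); exact: inc.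
  have := ler_normD (u s - u t) (u t); have := ler_normD (derive1 u s - derive1 u t) (derive1 u t).
  by rewrite !subrK /dsize; lra.
rewrite in_itv/= in mcd.
have := inc2 m y mcd cyd; rewrite -/K => h1.
have := hm x; rewrite in_itv/= => /(_ cxd); rewrite -/K => h2.
lra.
Qed.

Lemma dsize_ge0 u y : 0 <= dsize u y.
Proof. by rewrite /dsize addr_ge0. Qed.

Lemma dsize_eq0 u y : dsize u y = 0 -> u y = 0 /\ derive1 u y = 0.
Proof.
rewrite /dsize => h; have := normr_ge0 (u y); have := normr_ge0 (derive1 u y).
by move=> h1 h2; split; apply/normr0_eq0; lra.
Qed.

Lemma lim_zero (F : set_system R) (FF : ProperFilter F) (f : R -> R) (s : R) :
  f @ F --> s -> (\forall y \near F, f y = 0) -> s = 0.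
Proof.
move=> fs f0; apply: (norm_cvg_unique fs).
apply: cvg_trans (cvg_cst 0 : (fun=> 0) @ F --> (0 : R)); apply: near_eq_cvg.
by near=> y; rewrite (near f0 y).
Unshelve. all: by end_near. Qed.

Lemma interface_inv t (s s' v v' : R) :
  v = B t 0 0 * s + B t 0 1 * s' -> v' = B t 1 0 * s + B t 1 1 * s' ->
  s = B t 1 1 * v - B t 0 1 * v' /\ s' = B t 0 0 * v' - B t 1 0 * v.
Proof.
have := Bdet t => d -> ->; split.
  by rewrite -[LHS]mul1r -d; ring.
by rewrite -[LHS]mul1r -d; ring.
Qed.

(** The doubling estimate carries zero data to the one-sided limits at [t] and
    away from them, and the invertible interface matrix carries them across. *)
Lemma zero_spreads_locally p q u t : oint p q `<=` oint a b -> eig p q u ->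
  oint p q t -> exists2 e : R, 0 < e &
    forall x y, `|x - t| < e -> `|y - t| < e -> ~ M x -> ~ M y ->
      dsize u x = 0 -> dsize u y = 0.
Proof.
move=> sub su pt; have [e1 [e10 eab eM e4 eV]] := small_segment (sub _ pt).
have [e2 e20 he2] := punctured_ball sub pt.
pose e := Num.min e1 e2; exists e; first by rewrite lt_min e10.
have ee1 : e <= e1 by rewrite ge_min lexx.
have hee y : `|y - t| < e -> oint p q y /\ (y != t -> ~ M y).
  by rewrite lt_min => /andP[_]; exact: he2.
have e0 : 0 < e by rewrite lt_min e10 e20.
(* the doubling estimate on each side, and across [t] off the interactions *)
have dbl x y : `|x - t| < e -> `|y - t| < e ->
    [\/ x < t /\ y < t, t < x /\ t < y | ~ M t] ->
    dsize u x <= 2 * dsize u y.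
  move=> xe ye side; pose c := Num.min x y; pose d := Num.max x y.
  have cx : c <= x <= d by rewrite ge_min le_max lexx.
  have cy : c <= y <= d by rewrite ge_min le_max lexx !orbT.
  move: xe ye; rewrite !ltr_distl => /andP[x1 x2] /andP[y1 y2].
  have [tc dt] : t - e < c /\ d < t + e by rewrite lt_min gt_max x1 x2 y1 y2.
  have cdD : `[c, d]%classic `<=` oint p q `\` M.
    move=> z /=; rewrite in_itv/= => /andP[cz zd]; have [|h1 h2] := hee z.
      by rewrite ltr_distlC; between.
    split => //; have [zt|] := eqVneq z t; last exact: h2.
    case: side => [[s1 s2]|[s1 s2]|]; last by rewrite zt.
      by have := le_lt_trans zd (_ : d < t); rewrite gt_max s1 s2 zt ltxx => /(_ isT).
    by have := lt_le_trans (_ : t < c) cz; rewrite lt_min s1 s2 zt ltxx => /(_ isT).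
  have cd : `[c, d]%classic `<=` `[t - e1, t + e1]%classic.
    by apply: subset_itv; rewrite bnd_simp; lra.
  apply: (dsize_doubling sub su cdD) => //; first lra.
  apply: le_trans eV; apply: Rint_subset => //.
  apply: integrable_norm; apply: shifted_integrable; apply: eab;
    by rewrite /= in_itv/=; between.
have [_ _ int] := su; have [s [s' [v [v' [[c1 c2] [c3 c4] E1 E2]]]]] := int t pt.
have dl : dsize u @ t^'- --> `|s| + `|s'| by apply: cvgD; apply: cvg_norm.
have dr : dsize u @ t^'+ --> `|v| + `|v'| by apply: cvgD; apply: cvg_norm.
have zl y : `|y - t| < e -> y < t -> dsize u y = 0 -> s = 0 /\ s' = 0.
  move=> ye yt u0; have h : `|s| + `|s'| = 0.
    apply: lim_zero dl _; near=> x.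
    apply/eqP; rewrite eq_le dsize_ge0 andbT.
    have xt : x < t by near: x; exact: nbhs_left_lt.
    have := dbl x y _ ye (Or31 _ _ (conj xt yt)); rewrite u0 mulr0; apply.
    rewrite ltr_distl; apply/andP; split; last lra.
    by near: x; apply: nbhs_left_gt; lra.
  by have := normr_ge0 s; have := normr_ge0 s' => *; split; apply/normr0_eq0; lra.
have zr y : `|y - t| < e -> t < y -> dsize u y = 0 -> v = 0 /\ v' = 0.
  move=> ye yt u0; have h : `|v| + `|v'| = 0.
    apply: lim_zero dr _; near=> x.
    apply/eqP; rewrite eq_le dsize_ge0 andbT.
    have xt : t < x by near: x; exact: nbhs_right_gt.
    have := dbl x y _ ye (Or32 _ _ (conj xt yt)); rewrite u0 mulr0; apply.
    rewrite ltr_distl; apply/andP; split; first lra.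
    by near: x; apply: nbhs_right_lt; lra.
  by have := normr_ge0 v; have := normr_ge0 v' => *; split; apply/normr0_eq0; lra.
have lz x : s = 0 -> s' = 0 -> `|x - t| < e -> x < t -> dsize u x = 0.
  move=> s0 s'0 xe xt; apply/eqP; rewrite eq_le dsize_ge0 andbT.
  rewrite s0 s'0 normr0 addr0 in dl.
  have dl2 : (fun y => 2 * dsize u y) @ t^'- --> (2 * 0 : R) by exact: cvgMr.
  rewrite -[leRHS](mulr0 2); apply: (cvgr_to_ge dl2); near=> y.
  have yt : y < t by near: y; exact: nbhs_left_lt.
  apply: dbl => //; last exact: Or31.
  rewrite ltr_distl; apply/andP; split; last lra.
  by near: y; apply: nbhs_left_gt; lra.
have rz x : v = 0 -> v' = 0 -> `|x - t| < e -> t < x -> dsize u x = 0.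
  move=> s0 s'0 xe xt; apply/eqP; rewrite eq_le dsize_ge0 andbT.
  rewrite s0 s'0 normr0 addr0 in dr.
  have dl2 : (fun y => 2 * dsize u y) @ t^'+ --> (2 * 0 : R) by exact: cvgMr.
  rewrite -[leRHS](mulr0 2); apply: (cvgr_to_ge dl2); near=> y.
  have yt : t < y by near: y; exact: nbhs_right_gt.
  apply: dbl => //; last exact: Or32.
  rewrite ltr_distl; apply/andP; split; first lra.
  by near: y; apply: nbhs_right_lt; lra.
have [F1 F2] := interface_inv E1 E2.
move=> x y xe ye Mx My u0; have [Mt|Mt] := pselect (M t); last first.
  apply/eqP; rewrite eq_le dsize_ge0 andbT -(mulr0 2) -u0.
  by apply: dbl => //; exact: Or33.
have xt : x != t by apply/eqP => xt; rewrite xt in Mx.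
have yt : y != t by apply/eqP => yt; rewrite yt in My.
have [[s0 s'0] [v0 v'0]] : (s = 0 /\ s' = 0) /\ (v = 0 /\ v' = 0).
  move: xt; rewrite neq_lt => /orP[xt|xt].
    by have [s0 s'0] := zl x xe xt u0; rewrite E1 E2 s0 s'0 !mulr0 addr0.
  by have [s0 s'0] := zr x xe xt u0; rewrite F1 F2 s0 s'0 !mulr0 subr0.
by move: yt; rewrite neq_lt => /orP[yt|yt]; [exact: lz|exact: rz].
Unshelve. all: by end_near. Qed.

Lemma eig_unique p q u y0 : oint p q `<=` oint a b -> eig p q u ->
  oint p q y0 -> ~ M y0 -> dsize u y0 = 0 ->
  forall y, oint p q y -> ~ M y -> dsize u y = 0.
Proof.
move=> sub su p0 M0 u0 y py My.
apply: (chain_off_discrete (P := fun z => dsize u z = 0) sub _ p0 py) => // t /(zero_spreads_locally sub su)[e e0 he].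
by exists e => // x z xe ze _ _; exact: he.
Qed.

End Solutions.

Section Existence.
Context {R : realType}.
Local Notation mu := (@lebesgue_measure R).
Local Notation itg c d := (mu.-integrable `[c, d]).
Variables (a b : \bar R) (V : R -> R) (M : set R) (B : R -> 'M[R]_2).
Hypothesis hV : locally_integrable (oint a b) V.
Hypothesis hM : discrete_in (oint a b) M.
Hypothesis cM : countable M.
Hypothesis B1 : forall t, ~ M t -> B t = 1%:M.
Hypothesis Bdet : forall t, B t 0 0 * B t 1 1 - B t 0 1 * B t 1 0 = 1.
Local Notation sol := (rsol V M B).
Implicit Types (p q : \bar R) (u h k l : R -> R).

Lemma abs_continuous_ge c d u : d <= c -> abs_continuous c d u.
Proof.
move=> dc e e0; exists 1 => // n s t st _ _.
rewrite big1// => i _; have [h1 [h2 h3]] := st i.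
have -> : s i = t i by apply/eqP; rewrite eq_le h2/=; lra.
by rewrite subrr normr0.
Qed.

Lemma rsol_join p q t k u : oint p q `<=` oint a b -> oint p q t -> M t ->
  sol p t%:E k u -> sol t%:E q k u -> rinterface (B t) u t -> sol p q k u.
Proof.
move=> sub pt Mt [[r1 r2 r3 r4] ae1 int] [[r1' r2' r3' r4'] ae1' int'] it.
have L y : oint p q y -> y < t -> oint p t%:E y.
  by move=> /andP[py _] yt; apply/andP; split => //; rewrite lte_fin.
have G y : oint p q y -> t < y -> oint t%:E q y.
  by move=> /andP[_ yq] ty; apply/andP; split => //; rewrite lte_fin.
have side y : (oint p q `\` M) y -> (oint p t%:E `\` M) y \/ (oint t%:E q `\` M) y.
  move=> [py My]; have [yt|ty|E] := ltgtP y t.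
  - by left; split => //; exact: L.
  - by right; split => //; exact: G.
  - by rewrite E in My.
have ac v : loc_abs_continuous (oint p t%:E `\` M) v ->
    loc_abs_continuous (oint t%:E q `\` M) v -> loc_abs_continuous (oint p q `\` M) v.
  move=> h1 h2 c d cdD; have [cd|dc] := leP c d; last by apply: abs_continuous_ge; exact: ltW.
  have [dt|td] := ltP d t.
    apply: h1 => y /= ycd; have [py My] := cdD y ycd; split => //; apply: L => //.
    by move: ycd; rewrite in_itv/= => /andP[_ /le_lt_trans]; apply.
  have [tc|ct] := ltP t c.
    apply: h2 => y /= ycd; have [py My] := cdD y ycd; split => //; apply: G => //.
    by move: ycd; rewrite in_itv/= => /andP[+ _]; exact: lt_le_trans.
  by have [_ []] := cdD t ltac:(by rewrite /= in_itv/= ct td).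
split.
- split; [by move=> y /side[]; [exact: r1|exact: r1']|exact: ac|exact: ac|].
  apply: aeS2 r4 r4'.
  by move=> y h1 h2 /side[]; [exact: h1|exact: h2].
- apply: aeS3 ae1 ae1' (ae_notin_countable cM).
  move=> y h1 h2 My py; have [] := side y; first by [].
    by case=> /h1.
  by case=> /h2.
- move=> y py; have [yt|ty|->//] := ltgtP y t.
    by apply: int; exact: L.
  by apply: int'; exact: G.
Qed.

Lemma rsol_local p q k u : oint p q `<=` oint a b ->
  (forall t, oint p q t -> exists2 e : R, 0 < e & sol (t - e)%:E (t + e)%:E k u) ->
  sol p q k u.
Proof.
move=> sub loc.
have inb (t e y : R) : `|y - t| < e -> oint (t - e)%:E (t + e)%:E y.
  by rewrite ltr_distl ointE.
have ac v : (forall t, oint p q t -> exists2 e : R, 0 < e &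
    loc_abs_continuous (oint (t - e)%:E (t + e)%:E `\` M) v) ->
    loc_abs_continuous (oint p q `\` M) v.
  move=> hl c d cdD; have [cd|dc] := leP c d; last by apply: abs_continuous_ge; exact: ltW.
  apply: (@interval_induction _ c d (fun x => abs_continuous c x v)) => //.
    exact: abs_continuous_ge.
  move=> t tcd; have [pt _] := cdD t ltac:(by rewrite /= in_itv).
  have [e e0 he] := hl t pt; exists e => // x y /andP[cx xt] /andP[ty yd] tx yt acx.
  apply: abs_continuous_cat acx _ => //; first exact: le_trans ty.
  apply: he => z /=; rewrite in_itv/= => /andP[xz zy]; split.
    by rewrite ointE; between.
  by have [] := cdD z ltac:(by rewrite /= in_itv/=; between).
split.
- split.
  + move=> y [py My]; have [e e0 [[r1 _ _ _] _ _]] := loc y py; apply: r1; split => //.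
    by apply: inb; rewrite subrr normr0.
  + by apply: ac => t /loc[e e0 [[_ r2 _ _] _ _]]; exists e.
  + by apply: ac => t /loc[e e0 [[_ _ r3 _] _ _]]; exists e.
  + apply: ae_local => t [pt _]; have [e e0 [[_ _ _ r4] _ _]] := loc t pt.
    exists e => //; apply: aeS r4.
    by move=> y h [py My] yt; apply: h; split => //; exact: inb.
- apply: ae_local => t pt; have [e e0 [_ ae1 _]] := loc t pt.
  exists e => //; apply: aeS ae1.
  by move=> y h py yt; apply: h; exact: inb.
- move=> t pt; have [e e0 [_ _ int]] := loc t pt; apply: int.
  by apply: inb; rewrite subrr normr0.
Qed.

Variable E : R.
Local Notation eig p q u := (rsol V M B p q (fun y => E * u y) u).

Lemma eig_eq p q u h y0 : oint p q `<=` oint a b -> eig p q u -> eig p q h ->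
  oint p q y0 -> ~ M y0 -> u y0 = h y0 -> derive1 u y0 = derive1 h y0 ->
  forall y, oint p q y -> ~ M y -> u y = h y.
Proof.
move=> sub su sh p0 M0 e1 e2 y py My.
have [[r1 _ _ _] _ _] := su; have [[r1' _ _ _] _ _] := sh.
have := rsol_lin hM cM 1 (-1) sub su sh.
rewrite (_ : (fun y => 1 * (E * u y) + _) = fun y => E * (1 * u y + (-1) * h y)); last first.
  by apply/funext => z; ring.
move=> sg; have z0 : dsize (fun z => 1 * u z + (-1) * h z) y0 = 0.
  rewrite /dsize (derivable_lin _ _ (r1 y0 _) (r1' y0 _)).2// e1 e2.
  by rewrite !mul1r !mulN1r !subrr normr0 addr0.
have [+ _] := dsize_eq0 (eig_unique hV hM Bdet sub sg p0 M0 z0 py My).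
by rewrite mul1r mulN1r => /eqP; rewrite subr_eq0 => /eqP.
Qed.

Lemma abs_continuous_continuous c d u t : abs_continuous c d u -> c < t < d ->
  {for t, continuous u}.
Proof.
move=> ac ctd; have /andP[ct td] := ctd.
have /continuous_within_itvP := abs_continuous_within ac.
by move=> /(_ (lt_trans ct td))[+ _ _]; apply; rewrite in_itv.
Qed.

Lemma regular_continuous p q u t : oint p q `<=` oint a b ->
  regularR (oint p q `\` M) u -> oint p q t -> ~ M t ->
  {for t, continuous u} /\ {for t, continuous (derive1 u)}.
Proof.
move=> sub [_ r2 r3 _] pt Mt; have [e e0 he] := punctured_ball hM sub pt.
have D : `[t - e / 2, t + e / 2]%classic `<=` oint p q `\` M.
  move=> y /=; rewrite in_itv/= => /andP[y1 y2].
  have [|h1 h2] := he y; first by rewrite ltr_distl; between.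
  by split => //; have [->//|] := eqVneq y t.
have tin : t - e / 2 < t < t + e / 2 by between.
by split; [exact: abs_continuous_continuous (r2 _ _ D) tin
          |exact: abs_continuous_continuous (r3 _ _ D) tin].
Qed.

(** Without interaction points, the solution of the linear system is a solution
    of the interface problem: the interface conditions only say that [u] and its
    derivative are continuous. *)
Lemma ode_eig c d y0 (al be : R) : c <= y0 <= d -> `[c, d]%classic `<=` oint a b ->
  d - c <= 4^-1 -> \int[mu]_(y in `[c, d]) `|V y - E| <= 4^-1 ->
  exists u w : R -> R, [/\ abs_continuous c d u /\ abs_continuous c d w,
    u y0 = al /\ w y0 = be, forall y, c < y < d -> derive1 u y = w y &
    forall c' d' : R, c <= c' -> d' <= d -> (forall y, c' < y < d' -> ~ M y) ->
      eig c'%:E d'%:E u].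
Proof.
move=> /andP[cy yd] sub dc4 V4.
have cd := le_trans cy yd.
have Vi : itg c d (EFin \o (fun y => V y - E)).
  by apply: (shifted_integrable hV); apply: sub; rewrite /= in_itv/= lexx ?cd ?andbT.
have [u [w [[acu acw] [ua wb] du dw]]] := linear_ode_exists al be cy yd Vi dc4 V4.
have du' y : c < y < d -> derive1 u y = w y.
  by move=> h; have [_ dv] := du y h; rewrite derive1E.
exists u, w; split => // c' d' cc dd nM.
have in1 y : oint c'%:E d'%:E y -> c < y < d.
  by rewrite ointE => /andP[? ?]; between.
have ntr y : oint c'%:E d'%:E y -> \near y, derive1 u y = w y.
  move=> py; have [e e0 he] := open_ball_ex (@open_oint _ _ _) py.
  by apply: (near_eq_ball e0) => z /he/in1; exact: du'.
have inc x y : `[x, y]%classic `<=` oint c'%:E d'%:E `\` M -> x <= y ->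
    [/\ c <= x, y <= d & forall z, x <= z <= y -> c < z < d].
  move=> h xy; have hz z : x <= z <= y -> c < z < d.
    by move=> xzy; apply: in1; apply: (h z _).1; rewrite /= in_itv.
  have /andP[? ?] := hz x ltac:(by rewrite lexx xy).
  by have /andP[? ?] := hz y ltac:(by rewrite lexx xy); split => //; exact: ltW.
split.
- split.
  + by move=> y [/in1 /du dy _]; exact: ex_derive.
  + move=> x y h; have [xy|yx] := leP x y; last by apply: abs_continuous_ge; exact: ltW.
    by have [? ? _] := inc x y h xy; exact: abs_continuousS acu.
  + move=> x y h; have [xy|yx] := leP x y; last by apply: abs_continuous_ge; exact: ltW.
    have [? ? hz] := inc x y h xy; apply: (@abs_continuous_eq _ _ _ w).
      by move=> z /hz/du'.
    exact: abs_continuousS acw.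
  + apply: aeS dw.
    move=> y h [py _]; have dy := h (in1 y py).
    have e : \near y, w y = derive1 u y by near=> z; rewrite (near (ntr y py) z).
    by apply: near_eq_derivable e _; exact: ex_derive.
- apply: aeS dw.
  move=> y h py; have dy := h (in1 y py).
  rewrite derive1E (near_eq_derive _ (ntr y py)) derive_val; ring.
- move=> t pt; have ctd := in1 t pt; rewrite (B1 (nM t _)); last by rewrite ointE in pt.
  have cu := abs_continuous_continuous acu ctd.
  have cw := abs_continuous_continuous acw ctd.
  exists (u t), (w t), (u t), (w t).
  have cu' : derive1 u @ t --> derive1 u t.
    rewrite (du' t ctd); apply: cvg_trans cw; apply: near_eq_cvg.
    by near=> z; rewrite (near (ntr t pt) z).
  have cul := cvg_at_left_filter cu'; have cur := cvg_at_right_filter cu'.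
  rewrite (du' t ctd) in cul cur.
  split.
  + by split => //; exact: cvg_at_left_filter.
  + by split => //; exact: cvg_at_right_filter.
  + by rewrite !mxE/=; ring.
  + by rewrite !mxE/=; ring.
Unshelve. all: by end_near. Qed.

Lemma eig_local_exists t : oint a b t -> exists e : R, [/\ 0 < e,
  `[t - e, t + e]%classic `<=` oint a b,
  forall y, `|y - t| <= e -> y != t -> ~ M y &
  forall y1 (al be : R), `|y1 - t| < e -> ~ M y1 ->
    exists u, [/\ eig (t - e)%:E (t + e)%:E u, u y1 = al & derive1 u y1 = be]].
Proof.
move=> at_; have [e [e0 eab eM e4 eV]] := small_segment hV hM E at_.
exists e; split => // y1 al be y1e My1.
move: (y1e); rewrite ltr_distl => /andP[y1l y1r].
have y1c : t - e <= y1 <= t + e by rewrite !ltW.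
have tin : t - e <= t <= t + e by between.
have tin' : t - e < t < t + e by between.
have nMl y : t - e < y < t -> ~ M y.
  by move=> /andP[? ?]; apply: eM; [rewrite ler_distl; between|rewrite lt_eqF].
have nMr y : t < y < t + e -> ~ M y.
  by move=> /andP[? ?]; apply: eM; [rewrite ler_distl; between|rewrite gt_eqF].
have [Mt|Mt] := pselect (M t); last first.
  have [u [w [_ [ua wb] du hu]]] := ode_eig al be y1c eab e4 eV.
  exists u; split => //; last by rewrite du ?y1l.
  apply: hu => // y /andP[y2 y3]; have [->//|yt] := eqVneq y t.
  by apply: eM => //; rewrite ler_distl; between.
(* glue a solution on either side of [t], crossing the interface at [t] *)
have glue u w h z : abs_continuous (t - e) (t + e) u -> abs_continuous (t - e) (t + e) w ->
    abs_continuous (t - e) (t + e) h -> abs_continuous (t - e) (t + e) z ->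
    (forall y, t - e < y < t + e -> derive1 u y = w y) ->
    (forall y, t - e < y < t + e -> derive1 h y = z y) ->
    eig (t - e)%:E t%:E u -> eig t%:E (t + e)%:E h ->
    h t = B t 0 0 * u t + B t 0 1 * w t -> z t = B t 1 0 * u t + B t 1 1 * w t ->
    let g := fun y => if y < t then u y else h y in
    [/\ eig (t - e)%:E (t + e)%:E g,
      (forall y, t - e < y < t -> g y = u y /\ derive1 g y = w y) &
      (forall y, t < y < t + e -> g y = h y /\ derive1 g y = z y)].
  move=> acu acw ach acz du dh su sh E1 E2 g.
  have gl y : oint (t - e)%:E t%:E y -> u y = g y.
    by rewrite ointE /g => /andP[_ ->].
  have gr y : oint t%:E (t + e)%:E y -> h y = g y.
    by rewrite ointE /g => /andP[ty _]; rewrite ltNge (ltW ty).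
  have gl' y : t - e < y < t -> derive1 g y = w y.
    move=> yt; rewrite -(eq_on_open (@open_oint _ _ _) gl _).2 ?ointE// du//.
    by case/andP: yt => ? ?; between.
  have gr' y : t < y < t + e -> derive1 g y = z y.
    move=> yt; rewrite -(eq_on_open (@open_oint _ _ _) gr _).2 ?ointE// dh//.
    by case/andP: yt => ? ?; between.
  split.
  - have sub : oint (t - e)%:E (t + e)%:E `<=` oint a b.
      by move=> y; rewrite ointE => /andP[? ?]; apply: eab; rewrite /= in_itv/= !ltW.
    have pt : oint (t - e)%:E (t + e)%:E t by rewrite ointE.
    apply: (rsol_join sub pt Mt).
    + apply: (rsol_eq hM cM) su => //.
        by move=> y py; apply: sub; move: py; rewrite !ointE => /andP[? ?]; between.
      by move=> y py _; rewrite (gl y py).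
    + apply: (rsol_eq hM cM) sh => //.
        by move=> y py; apply: sub; move: py; rewrite !ointE => /andP[? ?]; between.
      by move=> y py _; rewrite (gr y py).
    + exists (u t), (w t), (h t), (z t); split => //; split.
      * apply: (cvg_at_left_eq e0) (cvg_at_left_filter (abs_continuous_continuous acu tin')).
        by move=> y yt; apply: gl; rewrite ointE.
      * apply: (cvg_at_left_eq e0) (cvg_at_left_filter (abs_continuous_continuous acw tin')).
        by move=> y yt; rewrite gl'.
      * apply: (cvg_at_right_eq e0) (cvg_at_right_filter (abs_continuous_continuous ach tin')).
        by move=> y yt; apply: gr; rewrite ointE.
      * apply: (cvg_at_right_eq e0) (cvg_at_right_filter (abs_continuous_continuous acz tin')).
        by move=> y yt; rewrite gr'.
  - by move=> y yt; rewrite gl'// gl// ointE.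
  - by move=> y yt; rewrite gr'// gr// ointE.
have [y1t|ty1|y1t] := ltgtP y1 t; last by rewrite y1t in My1.
- have [u [w [[acu acw] [ua wb] du hu]]] := ode_eig al be y1c eab e4 eV.
  have [h [z [[ach acz] [ha zb] dh hh]]] :=
    ode_eig (B t 0 0 * u t + B t 0 1 * w t) (B t 1 0 * u t + B t 1 1 * w t) tin eab e4 eV.
  have [||sg gl gr] := glue u w h z acu acw ach acz du dh _ _ ha zb.
  + by apply: hu => //; lra.
  + by apply: hh => //; lra.
  exists (fun y => if y < t then u y else h y); split => //.
    by rewrite y1t.
  by rewrite (gl y1 _).2 ?y1l ?y1t.
- have [h [z [[ach acz] [ha zb] dh hh]]] := ode_eig al be y1c eab e4 eV.
  have [u [w [[acu acw] [ua wb] du hu]]] :=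
    ode_eig (B t 1 1 * h t - B t 0 1 * z t) (B t 0 0 * z t - B t 1 0 * h t) tin eab e4 eV.
  have E1 : h t = B t 0 0 * u t + B t 0 1 * w t.
    by rewrite ua wb -[LHS]mul1r -(Bdet t); ring.
  have E2 : z t = B t 1 0 * u t + B t 1 1 * w t.
    by rewrite ua wb -[LHS]mul1r -(Bdet t); ring.
  have [||sg gl gr] := glue u w h z acu acw ach acz du dh _ _ E1 E2.
  + by apply: hu => //; lra.
  + by apply: hh => //; lra.
  exists (fun y => if y < t then u y else h y); split => //.
    by rewrite ltNge (ltW ty1).
  by rewrite (gr y1 _).2 ?y1r ?ty1.
Qed.

(** Solutions of the initial value problem extend to the whole interval: the
    solutions on two overlapping intervals agree on the overlap by uniqueness. *)
Lemma eig_exists y0 (al be : R) : oint a b y0 -> ~ M y0 ->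
  exists u, [/\ eig a b u, u y0 = al & derive1 u y0 = be].
Proof.
move=> p0 M0.
pose Q1 c d u := [/\ oint a b c, oint a b d, c < y0 < d, eig c%:E d%:E u &
  u y0 = al /\ derive1 u y0 = be].
pose Q y := exists c d u, Q1 c d u /\ c < y < d.
have sub c d : oint a b c -> oint a b d -> oint c%:E d%:E `<=` oint a b.
  by move=> ac ad y; rewrite ointE => /andP[? ?]; apply: (oint_itvcc ac ad); rewrite !ltW.
have agree c d u c' d' u' y : Q1 c d u -> Q1 c' d' u' -> c < y < d -> c' < y < d' ->
    ~ M y -> u y = u' y.
  move=> [ac ad /andP[c0 d0] su [ua ub]] [ac' ad' /andP[c0' d0'] su' [ua' ub']].
  move=> /andP[cy yd] /andP[cy' yd'] My.
  pose m := Num.max c c'; pose n := Num.min d d'.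
  have mn z : oint m%:E n%:E z = [/\ c < z, c' < z, z < d & z < d'] :> Prop.
    rewrite ointE gt_max lt_min; apply/propext; split.
      by move=> /andP[/andP[? ?] /andP[? ?]].
    by move=> [-> -> -> ->].
  have s1 : oint m%:E n%:E `<=` oint c%:E d%:E.
    by move=> z; rewrite mn ointE => -[-> _ -> _].
  have s2 : oint m%:E n%:E `<=` oint c'%:E d'%:E.
    by move=> z; rewrite mn ointE => -[_ -> _ ->].
  apply: (@eig_eq m%:E n%:E u u' y0) => //.
  - exact: subset_trans s1 (sub _ _ ac ad).
  - exact: rsolS s1 su.
  - exact: rsolS s2 su'.
  - by rewrite mn.
  - by rewrite ua ua'.
  - by rewrite ub ub'.
  - by rewrite mn.
have step t : oint a b t -> exists2 e : R, 0 < e & forall s s',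
    oint a b s -> oint a b s' -> `|s - t| < e -> `|s' - t| < e -> Q s -> Q s'.
  move=> at_; have [e [e0 eab eM hloc]] := eig_local_exists at_.
  exists e => // s s' _ _ se s'e [c [d [u [[ac ad c0d su [ua ub]] csd]]]].
  have al1 : oint a b (t - e) by apply: eab; rewrite /= in_itv/=; between.
  have al2 : oint a b (t + e) by apply: eab; rewrite /= in_itv/=; between.
  have [y1 [y1c y1d y1e My1]] : exists y1, [/\ c < y1, y1 < d, `|y1 - t| < e & ~ M y1].
    have [r' r'0 hr'] := ball_sub se; have ps : oint c%:E d%:E s by rewrite ointE.
    have [y1 [y1s py1 My1]] := close_point hM (sub c d ac ad) ps r'0.
    by exists y1; move: py1; rewrite ointE => /andP[? ?]; split => //; exact: hr'.
  have [h [sh ha hb]] := hloc y1 (u y1) (derive1 u y1) y1e My1.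
  move: y1e s'e; rewrite !ltr_distl => /andP[y1l y1r] /andP[s'l s'r].
  pose c' := Num.min c (t - e); pose d' := Num.max d (t + e).
  have c'c : c' <= c by rewrite ge_min lexx.
  have c't : c' <= t - e by rewrite ge_min lexx orbT.
  have d'd : d <= d' by rewrite le_max lexx.
  have d't : t + e <= d' by rewrite le_max lexx orbT.
  have ac' : oint a b c' by rewrite /c'; case: leP.
  have ad' : oint a b d' by rewrite /d'; case: leP.
  have ov y : c < y < d -> t - e < y < t + e -> ~ M y -> u y = h y.
    move=> /andP[cy yd] /andP[cy' yd'] My.
    pose m := Num.max c (t - e); pose n := Num.min d (t + e).
    have mn z : oint m%:E n%:E z = [/\ c < z, t - e < z, z < d & z < t + e] :> Prop.
      rewrite ointE gt_max lt_min; apply/propext; split.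
        by move=> /andP[/andP[? ?] /andP[? ?]].
      by move=> [-> -> -> ->].
    have s1 : oint m%:E n%:E `<=` oint c%:E d%:E.
      by move=> z; rewrite mn ointE => -[-> _ -> _].
    have s2 : oint m%:E n%:E `<=` oint (t - e)%:E (t + e)%:E.
      by move=> z; rewrite mn ointE => -[_ -> _ ->].
    apply: (@eig_eq m%:E n%:E u h y1) => //.
    - exact: subset_trans s1 (sub _ _ ac ad).
    - exact: rsolS s1 su.
    - exact: rsolS s2 sh.
    - by rewrite mn.
    - by rewrite mn.
  pose g y := if (c < y) && (y < d) then u y else h y.
  exists c', d', g; split; last by between.
  have /andP[c0 d0] := c0d.
  split => //.
  - by between.
  - apply: rsol_local; first exact: sub.
    move=> z; rewrite ointE => /andP[cz zd].
    have [zin|zin] : (c < z < d) \/ (t - e < z < t + e).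
      have [zc|cz'] := leP z c.
        right; apply/andP; split; last lra.
        by move: cz; rewrite /c' gt_min => /orP[|//]; lra.
      have [dz|zd'] := leP d z; last by left; apply/andP.
      right; apply/andP; split; first lra.
      by move: zd; rewrite /d' lt_max => /orP[|//]; lra.
    + have pz : oint c%:E d%:E z by rewrite ointE.
      have [r r0 hr] := open_ball_ex (@open_oint _ c%:E d%:E) pz.
      exists r => //; have hsub : oint (z - r)%:E (z + r)%:E `<=` oint c%:E d%:E.
          by move=> y; rewrite ointE => yz; apply: hr; rewrite ltr_distl.
        apply: (rsol_eq hM cM) (rsolS hsub su); first exact: subset_trans hsub (sub _ _ ac ad).
        by move=> y /hsub; rewrite ointE /g => ->.
    + have pz : oint (t - e)%:E (t + e)%:E z by rewrite ointE.
      have [r r0 hr] := open_ball_ex (@open_oint _ (t - e)%:E (t + e)%:E) pz.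
      exists r => //; have hsub : oint (z - r)%:E (z + r)%:E `<=` oint (t - e)%:E (t + e)%:E.
          by move=> y; rewrite ointE => yz; apply: hr; rewrite ltr_distl.
        apply: (rsol_eq hM cM) (rsolS hsub sh); first exact: subset_trans hsub (sub _ _ al1 al2).
        move=> y /hsub; rewrite ointE /g => yt My; case: ifP => // cyd.
        by rewrite (ov y cyd yt My).
  - split; first by rewrite /g c0d.
    rewrite -ub; apply/esym.
    have hg y : oint c%:E d%:E y -> u y = g y by rewrite ointE /g => ->.
    by apply: (eq_on_open (@open_oint _ _ _) hg _).2; rewrite ointE.
have Q0 : Q y0.
  have [e [e0 eab eM hloc]] := eig_local_exists p0.
  have [|u [su ua ub]] := hloc y0 al be _ M0; first by rewrite subrr normr0.
  exists (y0 - e), (y0 + e), u; split; last by between.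
  split => //; last by between.
  - by apply: eab; rewrite /= in_itv/=; between.
  - by apply: eab; rewrite /= in_itv/=; between.
have all y : exists cdu : R * R * (R -> R), oint a b y ->
    Q1 cdu.1.1 cdu.1.2 cdu.2 /\ cdu.1.1 < y < cdu.1.2.
  have [py|] := pselect (oint a b y); last by exists (0, 0, fun=> 0).
  by have [c [d [u h]]] := chain_equiv step p0 py Q0; exists (c, d, u).
have [F hF] := choice all.
pose f y := (F y).2 y.
have fE y z : oint a b y -> (F y).1.1 < z < (F y).1.2 -> ~ M z -> (F y).2 z = f z.
  move=> py zy Mz; have [q1 _] := hF y py.
  have pz : oint a b z.
    by have [ac ad _ _ _] := q1; case/andP: zy => ? ?; apply: (oint_itvcc ac ad); rewrite !ltW.
  by have [q2 zz] := hF z pz; exact: (agree _ _ _ _ _ _ _ q1 q2).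
exists f; split.
- apply: rsol_local => // t pt; have [[ac ad _ su _] tcd] := hF t pt.
  have pt' : oint (F t).1.1%:E (F t).1.2%:E t by rewrite ointE.
  have [r r0 hr] := open_ball_ex (@open_oint _ _ _) pt'.
  exists r => //.
  have hsub : oint (t - r)%:E (t + r)%:E `<=` oint (F t).1.1%:E (F t).1.2%:E.
    by move=> y; rewrite ointE => yz; apply: hr; rewrite ltr_distl.
  apply: (rsol_eq hM cM) (rsolS hsub su); first exact: subset_trans hsub (sub _ _ ac ad).
  by move=> y /hsub; rewrite ointE => yt My; rewrite fE.
- by rewrite /f; have [[_ _ _ _ []]] := hF y0 p0.
- have [[ac ad _ su [_ <-]] tcd] := hF y0 p0; apply/esym.
  have hg y : (oint (F y0).1.1%:E (F y0).1.2%:E `\` M) y -> (F y0).2 y = f y.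
    by case; rewrite ointE => yt My; exact: fE.
  apply: (eq_on_open _ hg _).2; last by split; rewrite ?ointE.
  by apply: open_discrete_inD; [exact: open_oint|apply: discrete_inS hM; exact: sub].
Qed.

End Existence.

(** * Square integrability *)

Section SquareIntegrable.
Context {R : realType}.
Local Notation mu := (@lebesgue_measure R).
Local Notation itg c d := (mu.-integrable `[c, d]).
Implicit Types (p q : \bar R) (D : set R) (f g : R -> R).

Lemma square_integrable_mul D f g : measurable D -> measurable_fun D f ->
  measurable_fun D g ->
  mu.-integrable D (EFin \o (fun y => f y ^+ 2)) ->
  mu.-integrable D (EFin \o (fun y => g y ^+ 2)) ->
  mu.-integrable D (EFin \o (fun y => f y * g y)).
Proof.
move=> mD mf mg fi gi.
apply: (@le_integrable _ _ _ mu D mD _ (EFin \o (fun y => f y ^+ 2 + g y ^+ 2))).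
- by apply/measurable_EFinP; exact: measurable_funM.
- move=> y _ /=; rewrite lee_fin [leRHS]ger0_norm ?addr_ge0 ?sqr_ge0// normrM.
  rewrite -(real_normK (num_real (f y))) -(real_normK (num_real (g y))).
  by have := normr_ge0 (f y); have := normr_ge0 (g y); nra.
- exact: integrable_realD.
Qed.

Lemma Cauchy_Schwarz D f g : measurable D -> measurable_fun D f ->
  measurable_fun D g ->
  mu.-integrable D (EFin \o (fun y => f y ^+ 2)) ->
  mu.-integrable D (EFin \o (fun y => g y ^+ 2)) ->
  (\int[mu]_(y in D) (f y * g y)) ^+ 2 <=
  (\int[mu]_(y in D) (f y ^+ 2)) * \int[mu]_(y in D) (g y ^+ 2).
Proof.
move=> mD mf mg fi gi; have fgi := square_integrable_mul mD mf mg fi gi.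
set F := \int[mu]_(y in D) (f y ^+ 2); set G := \int[mu]_(y in D) (g y ^+ 2).
set X := \int[mu]_(y in D) (f y * g y).
have F0 : 0 <= F by apply: Rintegral_ge0 => y _; rewrite sqr_ge0.
have G0 : 0 <= G by apply: Rintegral_ge0 => y _; rewrite sqr_ge0.
have quad (s : R) : 0 <= F - (2 * s) * X + s ^+ 2 * G.
  have : 0 <= \int[mu]_(y in D) (f y ^+ 2 - (2 * s) * (f y * g y) + s ^+ 2 * (g y ^+ 2)).
    apply: Rintegral_ge0 => y _.
    have -> : f y ^+ 2 - (2 * s) * (f y * g y) + s ^+ 2 * (g y ^+ 2) = (f y - s * g y) ^+ 2 by ring.
    by rewrite sqr_ge0.
  have i1 := integrable_realZ (2 * s) mD fgi.
  have i2 := integrable_realZ (s ^+ 2) mD gi.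
  by rewrite RintegralD// ?RintegralB// ?RintegralZl//; exact: integrable_realB.
have [G00|Gn0] := eqVneq G 0.
  rewrite G00 mulr0; have [->|Xn0] := eqVneq X 0; first by rewrite expr0n.
  exfalso; have := quad ((F + 1) / (2 * X)).
  rewrite G00 mulr0 addr0.
  have -> : 2 * ((F + 1) / (2 * X)) * X = F + 1 by field.
  lra.
have Gp : 0 < G by rewrite lt_neqAle eq_sym Gn0.
have := quad (X / G).
have -> : F - 2 * (X / G) * X + (X / G) ^+ 2 * G = F - X ^+ 2 / G by field.
by rewrite subr_ge0 ler_pdivrMr.
Qed.

Lemma oint_exhaustion p q y0 : oint p q y0 -> exists c d : nat -> R, [/\
  forall n, (p < (c n)%:E)%E /\ ((d n)%:E < q)%E,
  forall n m, (n <= m)%N -> c m <= c n /\ d n <= d m &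
  forall y, oint p q y -> exists n, c n <= y <= d n].
Proof.
move=> /andP[py qy].
have inv n m : (n <= m)%N -> m.+1%:R^-1 <= n.+1%:R^-1 :> R.
  by move=> nm; rewrite lef_pV2 ?posrE ?ltr0n// ler_nat ltnS.
have ex (e : R) : 0 < e -> exists n : nat, n.+1%:R^-1 < e.
  move=> e0; have [N _ hN] := near_infty_natSinv_lt (PosNum e0).
  by exists N; apply: hN => /=.
have [c [c1 c2 c3]] : exists c : nat -> R, [/\ forall n, (p < (c n)%:E)%E,
    forall n m, (n <= m)%N -> c m <= c n & forall y, (p < y%:E)%E -> exists n, c n <= y].
  case: p py => [r _| //|_].
  - exists (fun n => r + n.+1%:R^-1); split.
    + by move=> n; rewrite lte_fin ltrDl invr_gt0 ltr0n.
    + by move=> n m nm; rewrite lerD2l inv.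
    + move=> y; rewrite lte_fin => ry; have [|n hn] := ex (y - r); first by rewrite subr_gt0.
      by exists n; rewrite -lerBrDl ltW.
  - exists (fun n => - n%:R); split => //.
    + by move=> n; rewrite ltNyr.
    + by move=> n m nm; rewrite lerN2 ler_nat.
    + move=> y _; exists (Num.bound `|y|).
      by have := archi_boundP (normr_ge0 y); have := ler_norm (- y); rewrite normrN; lra.
have [d [d1 d2 d3]] : exists d : nat -> R, [/\ forall n, ((d n)%:E < q)%E,
    forall n m, (n <= m)%N -> d n <= d m & forall y, (y%:E < q)%E -> exists n, y <= d n].
  case: q qy => [r _|_ //|//].
  - exists (fun n => r - n.+1%:R^-1); split.
    + by move=> n; rewrite lte_fin ltrBlDr ltrDl invr_gt0 ltr0n.
    + by move=> n m nm; rewrite lerD2l lerN2 inv.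
    + move=> y; rewrite lte_fin => ry; have [|n hn] := ex (r - y); first by rewrite subr_gt0.
      by exists n; rewrite lerBrDl -lerBrDr ltW.
  - exists (fun n => n%:R); split => //.
    + by move=> n; rewrite ltry.
    + by move=> n m nm; rewrite ler_nat.
    + move=> y _; exists (Num.bound `|y|).
      by have := archi_boundP (normr_ge0 y); have := ler_norm y; lra.
exists c, d; split.
- by move=> n; split.
- by move=> n m nm; split; [exact: c2|exact: d2].
- move=> y /andP[/c3[n hn] /d3[m hm]]; exists (maxn n m).
  by rewrite (le_trans (c2 _ _ (leq_maxl n m)) hn) (le_trans hm (d2 _ _ (leq_maxr n m))).
Qed.

Lemma oint_measurable p q : measurable (oint p q).
Proof. by apply: open_measurable; exact: open_oint. Qed.

Lemma oint_exhaust_cvg p q y0 f : oint p q y0 -> measurable_fun (oint p q) f ->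
  (forall y, oint p q y -> 0 <= f y) ->
  exists c d : nat -> R, [/\ forall n, (p < (c n)%:E)%E /\ ((d n)%:E < q)%E,
    exists N, forall n, (N <= n)%N -> c n <= y0 <= d n &
    (\int[mu]_(y in `[c n, d n]) (f y)%:E)%E @[n --> \oo] -->
    (\int[mu]_(y in oint p q) (f y)%:E)%E].
Proof.
move=> py mf f0; have [c [d [h1 h2 h3]]] := oint_exhaustion py.
exists c, d; split => //.
  have [N /andP[h4 h5]] := h3 y0 py; exists N => n Nn; have [h6 h7] := h2 N n Nn.
  by rewrite (le_trans h6 h4) (le_trans h5 h7).
have sub n : `[c n, d n]%classic `<=` oint p q.
  move=> y /=; rewrite in_itv/= => /andP[cy yd]; apply/andP; split.
    by apply: lt_le_trans (h1 n).1 _; rewrite lee_fin.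
  by apply: le_lt_trans (h1 n).2; rewrite lee_fin.
have U : oint p q = \bigcup_n `[c n, d n]%classic.
  apply/seteqP; split => y; last by move=> [n _]; exact: sub.
  by move=> /h3[n hn]; exists n => //; rewrite /= in_itv.
rewrite [X in _ --> (\int[mu]_(y in X) _)%E]U.
apply: (@ge0_nondecreasing_set_cvg_integral _ (measurableTypeR R) R
  (fun n => `[c n, d n]%classic) (fun y => (f y)%:E) (@lebesgue_measure R)) => //.
- move=> n m nm; apply/subsetPset; have [h6 h7] := h2 n m nm.
  by apply: subset_itv; rewrite bnd_simp.
- by move=> n; apply/measurable_EFinP; exact: measurable_funS (oint_measurable p q) (sub n) mf.
- by move=> n y /sub/f0; rewrite lee_fin.
Qed.

Lemma integrable_exhaust p q y0 f (K : R) : oint p q y0 ->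
  measurable_fun (oint p q) f -> (forall y, oint p q y -> 0 <= f y) ->
  (forall c d, oint p q c -> oint p q d -> c <= y0 <= d ->
     itg c d (EFin \o f) /\ \int[mu]_(y in `[c, d]) f y <= K) ->
  mu.-integrable (oint p q) (EFin \o f).
Proof.
move=> py mf f0 bnd; have [c [d [h1 [N hN] cv]]] := oint_exhaust_cvg py mf f0.
apply/integrableP; split; first exact/measurable_EFinP.
rewrite (@eq_integral _ _ _ mu _ (fun y => (f y)%:E)); last first.
  by move=> y; rewrite inE => /f0 fy; rewrite /= ger0_norm.
apply: (@le_lt_trans _ _ K%:E); last exact: ltry.
rewrite -(cvg_lim _ cv)//; apply: lime_le; first by apply/cvg_ex; eexists; exact: cv.
near=> n.
have cyd : c n <= y0 <= d n by apply: hN; near: n; exact: nbhs_infty_ge.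
have /andP[cy yd] := cyd.
have [||fi le] := bnd (c n) (d n) _ _ cyd.
- by apply/andP; split; [exact: (h1 n).1|apply: le_lt_trans (h1 n).2; rewrite lee_fin (le_trans cy)].
- by apply/andP; split; [apply: lt_le_trans (h1 n).1 _; rewrite lee_fin (le_trans cy)|exact: (h1 n).2].
rewrite -lee_fin in le; apply: le_trans le; rewrite /Rintegral fineK//.
exact: integrable_fin_num.
Unshelve. all: by end_near. Qed.

Lemma integrable_tails p q y0 f (e : R) : oint p q y0 -> 0 < e ->
  mu.-integrable (oint p q) (EFin \o f) -> (forall y, oint p q y -> 0 <= f y) ->
  exists c d : R, [/\ oint p q c, oint p q d, c <= y0 <= d,
    \int[mu]_(y in oint p c%:E) f y < e & \int[mu]_(y in oint d%:E q) f y < e].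
Proof.
move=> py e0 fi f0.
have mf : measurable_fun (oint p q) f by case/integrableP: fi => /measurable_EFinP.
have [c [d [h1 [N hN] cv]]] := oint_exhaust_cvg py mf f0.
have fin : (\int[mu]_(y in oint p q) (f y)%:E)%E \is a fin_num.
  by apply: integrable_fin_num => //; exact: oint_measurable.
have [n [cyd cl]] : exists n, c n <= y0 <= d n /\
    \int[mu]_(y in oint p q) f y - e < \int[mu]_(y in `[c n, d n]) f y.
  have cv' : (fun n => \int[mu]_(y in `[c n, d n]) f y) @ \oo -->
      \int[mu]_(y in oint p q) f y by apply: fine_cvg; rewrite fineK.
  move/cvgrPdist_lt : cv' => /(_ _ e0) [N' _ hN'].
  exists (maxn N N'); split; first by apply: hN; exact: leq_maxl.
  have := hN' (maxn N N') (leq_maxr _ _); rewrite /= ltr_distlC => /andP[? ?]; lra.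
have /andP[cy yd] := cyd.
have pc : oint p q (c n).
  apply/andP; split; first exact: (h1 n).1.
  by apply: le_lt_trans (h1 n).2; rewrite lee_fin (le_trans cy).
have pd : oint p q (d n).
  apply/andP; split; last exact: (h1 n).2.
  by apply: lt_le_trans (h1 n).1 _; rewrite lee_fin (le_trans cy).
have ccd : `[c n, d n]%classic `<=` oint p q.
  by move=> y /=; rewrite in_itv/=; exact: oint_itvcc.
have tail D : measurable D -> D `<=` oint p q -> [disjoint D & `[c n, d n]%classic] ->
    \int[mu]_(y in D) f y < e.
  move=> mD sD dis.
  have mU : measurable (D `|` `[c n, d n]%classic) by exact: measurableU.
  have sU : D `|` `[c n, d n]%classic `<=` oint p q by rewrite subUset.
  have iU : mu.-integrable (D `|` `[c n, d n]%classic) (EFin \o f).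
    by apply: integrableS fi => //; exact: oint_measurable.
  have : \int[mu]_(y in D) f y + \int[mu]_(y in `[c n, d n]) f y <= \int[mu]_(y in oint p q) f y.
    rewrite -Rintegral_setU//; apply: Rint_subset => //; exact: oint_measurable.
  rewrite -lerBrDr => /le_lt_trans; apply.
  by rewrite ltrBlDr addrC -ltrBlDr.
exists (c n), (d n); split => //; apply: tail.
- exact: oint_measurable.
- move=> y /andP[py1 yc]; apply/andP; split => //.
  by apply: lt_trans yc _; case/andP: pc.
- apply/disj_set2P; rewrite -subset0 => y /= [/andP[_ yc]]; rewrite in_itv/= => /andP[cy' _].
  by move: yc; rewrite lte_fin ltNge cy'.
- exact: oint_measurable.
- move=> y /andP[dy yq]; apply/andP; split => //.
  by apply: lt_trans dy; case/andP: pd.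
- apply/disj_set2P; rewrite -subset0 => y /= [/andP[dy _]]; rewrite in_itv/= => /andP[_ yd'].
  by move: dy; rewrite lte_fin ltNge yd'.
Qed.

End SquareIntegrable.

(** * The Wronskian across interaction points, and Weyl's alternative *)

Section Weyl.
Context {R : realType}.
Local Notation mu := (@lebesgue_measure R).
Local Notation itg c d := (mu.-integrable `[c, d]).
Variables (a b : \bar R) (V : R -> R) (M : set R) (B : R -> 'M[R]_2).
Hypothesis hM : discrete_in (oint a b) M.
Hypothesis cM : countable M.
Hypothesis Bdet : forall t, B t 0 0 * B t 1 1 - B t 0 1 * B t 1 0 = 1.
Local Notation sol := (rsol V M B).
Implicit Types (p q : \bar R) (u h k l : R -> R).

Lemma rsol_bounded p q k u c d : oint p q `<=` oint a b -> sol p q k u ->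
  oint p q c -> oint p q d -> exists K : R, forall y, c <= y <= d -> `|u y| <= K.
Proof.
move=> sub [_ _ int] pc pd.
have [cd|dc] := leP c d; last by exists 0 => y /andP[? ?]; exfalso; lra.
apply: (@interval_induction _ c d
  (fun x => exists K : R, forall y, c <= y <= x -> `|u y| <= K)) => //.
  exists `|u c| => y cyc; have -> : y = c by apply/eqP; rewrite eq_le andbC.
  by [].
move=> t tcd; have pt := oint_itvcc pc pd tcd.
have [s [s' [v [v' [[c1 _] [c3 _] _ _]]]]] := int t pt.
have [e1 /= e10 he1] : \forall y \near t^'-, `|u y| <= `|s| + 1.
  by apply: cvgr_norm_le c1 _ _; rewrite ltrDl.
have [e2 /= e20 he2] : \forall y \near t^'+, `|u y| <= `|v| + 1.
  by apply: cvgr_norm_le c3 _ _; rewrite ltrDl.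
exists (Num.min e1 e2); first by rewrite lt_min e10.
move=> x y /andP[cx xt] /andP[ty yd] tx yt [K hK].
exists (`|K| + (`|s| + 1) + (`|v| + 1) + `|u t|) => z /andP[cz zy].
have [e1m e2m] : Num.min e1 e2 <= e1 /\ Num.min e1 e2 <= e2 by rewrite !ge_min !lexx orbT.
have [sp vp up Kp] : [/\ 0 <= `|s|, 0 <= `|v|, 0 <= `|u t| & 0 <= `|K|] by split.
have [zx|xz] := leP z x.
  by have := hK z; rewrite cz zx => /(_ isT); have := ler_norm K; lra.
have [zt|tz|->] := ltgtP z t; last lra.
- have : `|u z| <= `|s| + 1.
    by apply: he1 => //=; rewrite ltr_distlC; between.
  lra.
- have : `|u z| <= `|v| + 1.
    by apply: he2 => //=; rewrite ltr_distlC; between.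
  lra.
Qed.

Lemma rsol_measurable p q k u : oint p q `<=` oint a b -> sol p q k u ->
  measurable_fun (oint p q) u.
Proof.
move=> sub [[r1 _ _ _] _ _].
have oD : open (oint p q `\` M).
  by apply: open_discrete_inD; [exact: open_oint|exact: discrete_inS hM].
rewrite -(setUIDK (oint p q) M).
have cI : countable (oint p q `&` M) by apply: sub_countable cM; apply: subset_card_le; exact: subIsetr.
apply/measurable_funU.
- exact: countable_measurable.
- exact: open_measurable.
split; last first.
  apply: open_continuous_measurable_fun => // y; rewrite inE => Dy.
  by apply: differentiable_continuous; apply/derivable1_diffP; exact: r1.
move=> _ Y _; apply: countable_measurable => //.
by apply: sub_countable cI; apply: subset_card_le; exact: subIsetl.
Qed.

(** The interface matrices have determinant 1, so the Wronskian does not jump at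
    an interaction point: its difference with the indefinite integral is locally
    constant off the interaction points, and has equal one-sided limits there. *)
Lemma wr_global p q k l u h c d : oint p q `<=` oint a b -> sol p q k u ->
  sol p q l h -> oint p q c -> oint p q d -> c <= d -> ~ M c -> ~ M d ->
  itg c d (EFin \o (fun y => k y * h y - l y * u y)) ->
  wr u h d - wr u h c = \int[mu]_(y in `[c, d]) (k y * h y - l y * u y).
Proof.
move=> sub su sh pc pd cd Mc Md ki; pose ka y := k y * h y - l y * u y.
pose F z := \int[mu]_(y in `[c, z]) ka y.
pose N z := wr u h z - F z.
have segin x y : c <= x -> y <= d -> `[x, y]%classic `<=` oint p q.
  move=> cx yd z /=; rewrite in_itv/= => /andP[xz zy]; apply: (oint_itvcc pc pd).
  by between.
have base x y : c <= x -> x <= y -> y <= d -> (forall z, x <= z <= y -> ~ M z) ->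
    N x = N y.
  move=> cx xy yd nM.
  have sD : `[x, y]%classic `<=` oint p q `\` M.
    move=> z /= xzy; split; first by apply: (segin x y).
    by apply: nM; move: xzy; rewrite in_itv.
  have := wr_int su sh xy sD (integrable_subitv cx yd ki).
  have -> : \int[mu]_(y in `[x, y]) (k y * h y - l y * u y) = F y - F x.
    rewrite /F (@Rint_cat _ c x y) ?cx//; last exact: integrable_subitv ki.
    by rewrite addrAC subrr add0r.
  by rewrite /N => E1; apply/eqP; rewrite -subr_eq0; apply/eqP; lra.
have cross x y t : c <= x -> x < t -> t < y -> y <= d ->
    (forall z, x <= z <= y -> z != t -> ~ M z) -> N x = N y.
  move=> cx xt ty yd nM.
  have pt : oint p q t by apply: (oint_itvcc pc pd); between.
  have [_ _ int] := su; have [_ _ int'] := sh.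
  have [s [s' [v [v' [[c1 c2] [c3 c4] E1 E2]]]]] := int t pt.
  have [z [z' [w [w' [[c1' c2'] [c3' c4'] E1' E2']]]]] := int' t pt.
  have Fc : {for t, continuous F}.
    apply: (@abs_continuous_continuous _ c d); last by between.
    exact: abs_continuous_integral.
  have Nl : N @ t^'- --> s * z' - s' * z - F t.
    by apply: cvgB; [apply: cvgB; exact: cvgM|exact: cvg_at_left_filter].
  have Nr : N @ t^'+ --> v * w' - v' * w - F t.
    by apply: cvgB; [apply: cvgB; exact: cvgM|exact: cvg_at_right_filter].
  have EW : v * w' - v' * w = s * z' - s' * z.
    by rewrite E1 E2 E1' E2' -[RHS]mul1r -(Bdet t); ring.
  have Nx : N x = s * z' - s' * z - F t.
    apply/eqP; rewrite -subr_eq0; apply/eqP.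
    have Nl' : (fun r => N x - N r) @ t^'- --> N x - (s * z' - s' * z - F t).
      by apply: cvgB => //; exact: cvg_cst.
    apply: lim_zero Nl' _; near=> x'.
    have x't : x' < t by near: x'; exact: nbhs_left_lt.
    have xx' : x < x' by near: x'; exact: nbhs_left_gt.
    apply/eqP; rewrite subr_eq0; apply/eqP; apply: base => //; [exact: ltW|lra|].
    move=> r /andP[r1 r2]; apply: nM; first by between.
    by rewrite lt_eqF//; lra.
  have Ny : N y = v * w' - v' * w - F t.
    apply/eqP; rewrite -subr_eq0; apply/eqP.
    have Nr' : (fun r => N y - N r) @ t^'+ --> N y - (v * w' - v' * w - F t).
      by apply: cvgB => //; exact: cvg_cst.
    apply: lim_zero Nr' _; near=> x'.
    have x't : t < x' by near: x'; exact: nbhs_right_gt.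
    have xx' : x' < y by near: x'; exact: nbhs_right_lt.
    apply/eqP; rewrite subr_eq0; apply/eqP/esym; apply: base => //; [lra|exact: ltW|].
    move=> r /andP[r1 r2]; apply: nM; first by between.
    by rewrite gt_eqF//; lra.
  by rewrite Nx Ny EW.
have sub' : oint c%:E d%:E `<=` oint a b.
  by move=> y; rewrite ointE => /andP[? ?]; apply/sub/(oint_itvcc pc pd); rewrite !ltW.
have inner x y : c < x < d -> c < y < d -> ~ M x -> ~ M y -> N x = N y.
  rewrite -!ointE => cx cy Mx My.
  apply: (chain_off_discrete (P := fun z => N x = N z) hM sub' _ cx cy) => // t pt.
  have [e e0 he] := punctured_ball hM sub' pt; exists e => //.
  have le z z' : z <= z' -> c < z -> z' < d -> `|z - t| < e -> `|z' - t| < e ->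
      ~ M z -> ~ M z' -> N z = N z'.
    move=> zz' cz zd; rewrite !ltr_distl => /andP[z1 z2] /andP[z3 z4] Mz Mz'.
    have nt z'' : z <= z'' <= z' -> z'' != t -> ~ M z''.
      move=> /andP[? ?] zt; have [|_ h1] := he z''; last exact: h1.
      by rewrite ltr_distl; between.
    have [tin|tin] := pselect (M t /\ z < t < z').
      by case: tin => _ /andP[? ?]; apply: (cross z z' t) => //; exact: ltW.
    apply: base => //; [exact: ltW|exact: ltW|] => w wzz.
    have [wt|] := eqVneq w t; last exact: nt.
    rewrite wt => Mt; apply: tin; rewrite -wt; split; first by rewrite wt.
    case/andP: wzz => zw wz'; rewrite !lt_neqAle zw wz' !andbT.
    by apply/andP; split; apply/eqP => E; [apply: Mz; rewrite E wt|apply: Mz'; rewrite -E wt].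
  move=> z z' ze ze'; rewrite !ointE => /andP[? ?] /andP[? ?] Mz Mz' ->.
  by have [|/ltW] := leP z z' => zz'; [apply: le|apply/esym/le].
have all : N d = N c.
  have [cd'|dc] := ltP c d; last by congr N; apply/eqP; rewrite eq_le dc cd.
  have [e1 [e10 _ he1]] := punctured_sides hM sub pc.
  have [e2 [e20 he2 _]] := punctured_sides hM sub pd.
  pose m := Num.min (Num.min e1 e2) (d - c) / 2.
  have [m0 m1 m2 m3] : [/\ 0 < m, m < e1, m < e2 & m < d - c].
    have x0 : 0 < Num.min (Num.min e1 e2) (d - c) by rewrite !lt_min e10 e20 subr_gt0.
    have : Num.min (Num.min e1 e2) (d - c) <= e1 by rewrite !ge_min lexx.
    have : Num.min (Num.min e1 e2) (d - c) <= e2 by rewrite !ge_min lexx orbT.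
    have : Num.min (Num.min e1 e2) (d - c) <= d - c by rewrite ge_min lexx orbT.
    by rewrite /m; split; lra.
  have nl z : c <= z <= c + m -> ~ M z.
    rewrite le_eqVlt => /andP[/orP[/eqP <-//|cz] zm].
    by have [] := he1 z ltac:(between).
  have nr z : d - m <= z <= d -> ~ M z.
    move=> /andP[zm]; rewrite le_eqVlt => /orP[/eqP ->//|zd].
    by have [] := he2 z ltac:(between).
  have -> : N c = N (c + m) by apply: base => //; lra.
  have -> : N d = N (d - m) by apply/esym; apply: base => //; lra.
  apply: inner; [between|between| |].
    by apply: nr; between.
  by apply: nl; between.
have := all; rewrite /N /F set_itv1 Rintegral_set1 subr0.
by rewrite /ka => <-; ring.
Unshelve. all: by end_near. Qed.

Variable E : R.
Local Notation eig p q u := (rsol V M B p q (fun y => E * u y) u).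

Lemma wr_eig_const p q u1 u2 x y : oint p q `<=` oint a b -> eig p q u1 ->
  eig p q u2 -> oint p q x -> oint p q y -> ~ M x -> ~ M y ->
  wr u1 u2 x = wr u1 u2 y.
Proof.
move=> sub s1 s2.
have le x' y' : x' <= y' -> oint p q x' -> oint p q y' -> ~ M x' -> ~ M y' ->
    wr u1 u2 x' = wr u1 u2 y'.
  move=> xy px py Mx My.
  have k0 : (fun z => E * u1 z * u2 z - E * u2 z * u1 z) = fun=> 0.
    by apply/funext => z; ring.
  have := wr_global sub s1 s2 px py xy Mx My.
  rewrite k0 => /(_ (integrable_cst _ _ _)) h; apply/eqP.
  by rewrite eq_sym -subr_eq0 h; apply/eqP; rewrite Rintegral_cst// mul0r.
move=> px py Mx My; have [xy|yx] := leP x y; first exact: le.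
by apply/esym; apply: le => //; exact: ltW.
Qed.

Lemma wr_increment p q k h u c d x y : oint p q `<=` oint a b -> sol p q k h ->
  eig p q u -> oint p q c -> oint p q d -> c <= x <= d -> c <= y <= d ->
  ~ M x -> ~ M y -> itg c d (EFin \o (fun z => (k z - E * h z) * u z)) ->
  `|wr h u y - wr h u x| <= \int[mu]_(z in `[c, d]) `|(k z - E * h z) * u z|.
Proof.
move=> sub sh su pc pd.
have e1 : (fun z => k z * u z - E * u z * h z) = fun z => (k z - E * h z) * u z.
  by apply/funext => z; ring.
have le x' y' : x' <= y' -> c <= x' -> y' <= d -> ~ M x' -> ~ M y' ->
    itg c d (EFin \o (fun z => (k z - E * h z) * u z)) ->
    `|wr h u y' - wr h u x'| <= \int[mu]_(z in `[c, d]) `|(k z - E * h z) * u z|.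
  move=> xy cx yd Mx My ki.
  have px : oint p q x' by apply: (oint_itvcc pc pd); between.
  have py : oint p q y' by apply: (oint_itvcc pc pd); between.
  have := wr_global sub sh su px py xy Mx My; rewrite e1 => ->; last first.
    exact: integrable_subitv ki.
  apply: (le_trans (Rint_norm_le _ (integrable_subitv cx yd ki))) => //.
  apply: Rint_subset => //; last exact: integrable_norm.
  by apply: subset_itv; rewrite bnd_simp.
move=> /andP[cx xd] /andP[cy yd] Mx My ki; have [xy|yx] := leP x y; first exact: le.
by rewrite distrC; apply: le => //; exact: ltW.
Qed.

End Weyl.

Section BoundedMeasurable.
Context {R : realType}.
Local Notation mu := (@lebesgue_measure R).
Implicit Types (D : set R) (f g : R -> R).

Definition bounded_measurable D f :=
  measurable_fun D f /\ exists K : R, forall y, D y -> `|f y| <= K.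

Lemma bounded_measurableD D f g : bounded_measurable D f ->
  bounded_measurable D g -> bounded_measurable D (fun y => f y + g y).
Proof.
move=> [mf [K hK]] [mg [L hL]]; split; first exact: measurable_funD.
by exists (K + L) => y Dy; rewrite (le_trans (ler_normD _ _))// lerD ?hK ?hL.
Qed.

Lemma bounded_measurableM D f g : bounded_measurable D f ->
  bounded_measurable D g -> bounded_measurable D (fun y => f y * g y).
Proof.
move=> [mf [K hK]] [mg [L hL]]; split; first exact: measurable_funM.
by exists (K * L) => y Dy; rewrite normrM ler_pM ?hK ?hL.
Qed.

Lemma bounded_measurable_norm D f : bounded_measurable D f ->
  bounded_measurable D (fun y => `|f y|).
Proof.
move=> [mf [K hK]]; split; first exact: measurableT_comp.
by exists K => y Dy; rewrite normr_id hK.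
Qed.

Lemma bounded_measurable_cst D (k : R) : bounded_measurable D (fun=> k).
Proof. by split; [exact: measurable_cst|exists `|k|]. Qed.

Lemma bounded_measurable_integrable c d f : bounded_measurable `[c, d]%classic f ->
  mu.-integrable `[c, d] (EFin \o f).
Proof.
move=> [mf [K hK]]; apply: (@integrable_bounded _ _ _ K) => //.
by rewrite /= lebesgue_measure_itv/=; case: ifP => _; rewrite ?ltry// -EFinB ltry.
Qed.

Lemma ae_le_Rintegral D f g : measurable D -> mu.-integrable D (EFin \o f) ->
  mu.-integrable D (EFin \o g) -> (forall y, D y -> 0 <= f y) ->
  (forall y, D y -> 0 <= g y) -> {ae mu, forall y, D y -> f y <= g y} ->
  \int[mu]_(y in D) f y <= \int[mu]_(y in D) g y.
Proof.
move=> mD fi gi f0 g0 fg; apply: fine_le; [exact: integrable_fin_num..|].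
apply: ae_ge0_le_integral => //.
- by case/integrableP: fi.
- by case/integrableP: gi.
Qed.

End BoundedMeasurable.

(** With [X^2 <= P * GD], the part of the bound that comes from [B * X] is at
    most [P / 2], and is absorbed by the left-hand side. *)
Lemma absorption (R : realType) (P A B X G GD : R) : 0 <= P -> 0 <= A -> 0 <= B ->
  0 <= X -> 0 <= GD <= G -> X ^+ 2 <= P * GD -> 4 * (B * G) ^+ 2 <= 1 ->
  P <= (A + B * X) ^+ 2 * GD -> P <= 4 * G * A ^+ 2.
Proof.
move=> P0 A0 B0 X0 /andP[GD0 GG] cs small.
have Y2 : (A + B * X) ^+ 2 <= 2 * A ^+ 2 + 2 * (B * X) ^+ 2.
  by have := sqr_ge0 (A - B * X); lra.
have XX : (B * X) ^+ 2 <= B ^+ 2 * (P * GD) by rewrite exprMn ler_wpM2l// sqr_ge0.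
have i1 : (A + B * X) ^+ 2 * GD <= (2 * A ^+ 2 + 2 * (B ^+ 2 * (P * GD))) * GD.
  by rewrite ler_wpM2r//; lra.
have i2 : A ^+ 2 * GD <= A ^+ 2 * G by rewrite ler_wpM2l// sqr_ge0.
have i3 : B ^+ 2 * (P * GD) * GD <= P * (B * G) ^+ 2.
  have -> : B ^+ 2 * (P * GD) * GD = P * (B * GD) ^+ 2 by ring.
  have G0 := le_trans GD0 GG.
  by rewrite ler_wpM2l// lerXn2r// ?nnegrE ?mulr_ge0// ler_wpM2l.
have i4 : P * (B * G) ^+ 2 <= P * 4^-1 by rewrite ler_wpM2l//; lra.
lra.
Qed.

Section WeylEstimates.
Context {R : realType}.
Local Notation mu := (@lebesgue_measure R).
Local Notation itg c d := (mu.-integrable `[c, d]).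
Variables (a b : \bar R) (V : R -> R) (M : set R) (B : R -> 'M[R]_2).
Hypothesis hM : discrete_in (oint a b) M.
Hypothesis cM : countable M.
Hypothesis Bdet : forall t, B t 0 0 * B t 1 1 - B t 0 1 * B t 1 0 = 1.
Local Notation sol := (rsol V M B).
Variable E : R.
Local Notation eig p q u := (rsol V M B p q (fun y => E * u y) u).

Variables (p q : \bar R) (u1 u2 h1 h2 k1 k2 : R -> R) (K : R) (y0 : R).
Hypothesis sub : oint p q `<=` oint a b.
Hypotheses (su1 : eig p q u1) (su2 : eig p q u2).
Hypotheses (sh1 : sol p q k1 h1) (sh2 : sol p q k2 h2).
Hypotheses (mk1 : measurable_fun (oint p q) k1) (mk2 : measurable_fun (oint p q) k2).
Hypothesis kh : forall y, oint p q y ->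
  `|k1 y| <= K * (`|h1 y| + `|h2 y|) /\ `|k2 y| <= K * (`|h1 y| + `|h2 y|).
Hypotheses (py0 : oint p q y0) (My0 : ~ M y0).
Let w0 := wr u1 u2 y0.
Hypothesis w00 : w0 != 0.

Let g y := `|u1 y| + `|u2 y|.
Let phi y := `|h1 y| + `|h2 y|.
Let L := `|K| + `|E|.

Let bm (k u : R -> R) c d : sol p q k u -> oint p q c -> oint p q d ->
  bounded_measurable `[c, d]%classic u.
Proof.
move=> su pc pd; split.
  apply: measurable_funS (rsol_measurable hM cM sub su); first exact: oint_measurable.
  by move=> y /=; rewrite in_itv/=; exact: oint_itvcc.
by have [C hC] := rsol_bounded sub su pc pd; exists C => y /=; rewrite in_itv/=; exact: hC.
Qed.

Let bmg c d : oint p q c -> oint p q d -> bounded_measurable `[c, d]%classic g.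
Proof.
by move=> pc pd; apply: bounded_measurableD; apply: bounded_measurable_norm;
  [exact: bm su1 pc pd|exact: bm su2 pc pd].
Qed.

Let bmphi c d : oint p q c -> oint p q d -> bounded_measurable `[c, d]%classic phi.
Proof.
by move=> pc pd; apply: bounded_measurableD; apply: bounded_measurable_norm;
  [exact: bm sh1 pc pd|exact: bm sh2 pc pd].
Qed.

Let bmk (k : R -> R) c d : measurable_fun (oint p q) k ->
  (forall y, oint p q y -> `|k y| <= K * phi y) -> oint p q c -> oint p q d ->
  bounded_measurable `[c, d]%classic k.
Proof.
move=> mk hk pc pd.
have cdp : `[c, d]%classic `<=` oint p q.
  by move=> y /=; rewrite in_itv/=; exact: oint_itvcc.
split; first by apply: measurable_funS cdp mk; exact: oint_measurable.
have [_ [C hC]] := bmphi pc pd; exists (`|K| * C) => y cdy.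
apply: (le_trans (hk y (cdp y cdy))).
rewrite (le_trans (ler_norm _))// normrM ler_wpM2l// hC//.
Qed.

Let g0 y : 0 <= g y. Proof. by rewrite addr_ge0. Qed.
Let phi0 y : 0 <= phi y. Proof. by rewrite addr_ge0. Qed.
Let L0 : 0 <= L. Proof. by rewrite addr_ge0. Qed.

Let bmphig c d : oint p q c -> oint p q d ->
  itg c d (EFin \o (fun z => phi z * g z)).
Proof.
move=> pc pd; apply: bounded_measurable_integrable.
by apply: bounded_measurableM; [exact: bmphi|exact: bmg].
Qed.

Let wr_growth (k h u : R -> R) (c d x y C0 : R) : sol p q k h -> eig p q u ->
  measurable_fun (oint p q) k -> (forall z, oint p q z -> `|k z| <= K * phi z) ->
  (forall z, `|h z| <= phi z) -> (forall z, `|u z| <= g z) ->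
  oint p q c -> oint p q d -> c <= x <= d -> c <= y <= d -> ~ M x -> ~ M y ->
  `|wr h u x| <= C0 ->
  `|wr h u y| <= C0 + L * \int[mu]_(z in `[c, d]) (phi z * g z).
Proof.
move=> sh su mk hk hphi ug pc pd cxd cyd Mx My wx.
have bki : bounded_measurable `[c, d]%classic (fun z => (k z - E * h z) * u z).
  apply: bounded_measurableM; last exact: bm su pc pd.
  rewrite (_ : (fun z => _) = (fun z => k z + (- E) * h z)); last first.
    by apply/funext => z; rewrite mulNr.
  apply: bounded_measurableD; first exact: bmk.
  by apply: bounded_measurableM; [exact: bounded_measurable_cst|exact: bm sh pc pd].
have ki := bounded_measurable_integrable bki.
have := wr_increment hM Bdet sub sh su pc pd cxd cyd Mx My ki.
have : \int[mu]_(z in `[c, d]) `|(k z - E * h z) * u z| <=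
    L * \int[mu]_(z in `[c, d]) (phi z * g z).
  rewrite -RintegralZl//; last exact: bmphig.
  apply: le_Rintegral => //.
  - exact: integrable_norm.
  - by apply: integrable_realZ => //; exact: bmphig.
  - move=> z /=; rewrite in_itv/= => czd; rewrite normrM mulrA.
    apply: ler_pM => //.
    apply: (le_trans (ler_normB _ _)); rewrite normrM /L mulrDl lerD//.
      apply: (le_trans (hk z (oint_itvcc pc pd czd))).
      by rewrite ler_wpM2r// ler_norm.
    by rewrite ler_wpM2l.
have := ler_normD (wr h u y - wr h u x) (wr h u x); rewrite subrK; lra.
Qed.

(** By Cramer's rule the pair of Wronskians with [u1] and [u2] determines a
    function, and by Lagrange's identity these Wronskians vary by at most the
    integral of [phi * g]. *)
Lemma weyl_pointwise (c d x y C0 : R) : oint p q c -> oint p q d ->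
  c <= x <= d -> c <= y <= d -> ~ M x -> ~ M y ->
  `|wr h1 u1 x| <= C0 -> `|wr h1 u2 x| <= C0 ->
  `|wr h2 u1 x| <= C0 -> `|wr h2 u2 x| <= C0 ->
  `|w0| * phi y <= 2 * (C0 + L * \int[mu]_(z in `[c, d]) (phi z * g z)) * g y.
Proof.
move=> pc pd cxd cyd Mx My c11 c12 c21 c22.
set X := C0 + _.
have hp1 z : `|h1 z| <= phi z by rewrite lerDl.
have hp2 z : `|h2 z| <= phi z by rewrite lerDr.
have ug1 z : `|u1 z| <= g z by rewrite lerDl.
have ug2 z : `|u2 z| <= g z by rewrite lerDr.
have kk1 z (pz : oint p q z) := (kh pz).1.
have kk2 z (pz : oint p q z) := (kh pz).2.
have d11 := wr_growth sh1 su1 mk1 kk1 hp1 ug1 pc pd cxd cyd Mx My c11.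
have d12 := wr_growth sh1 su2 mk1 kk1 hp1 ug2 pc pd cxd cyd Mx My c12.
have d21 := wr_growth sh2 su1 mk2 kk2 hp2 ug1 pc pd cxd cyd Mx My c21.
have d22 := wr_growth sh2 su2 mk2 kk2 hp2 ug2 pc pd cxd cyd Mx My c22.
rewrite -/X in d11 d12 d21 d22.
have wy : w0 = wr u1 u2 y.
  rewrite /w0; apply: (wr_eig_const hM Bdet sub su1 su2) => //.
  exact: (oint_itvcc pc pd).
have cramer h : `|wr h u1 y| <= X -> `|wr h u2 y| <= X -> `|w0| * `|h y| <= X * g y.
  move=> e1 e2; rewrite -normrM.
  have -> : w0 * h y = wr h u2 y * u1 y - wr h u1 y * u2 y by rewrite wy /wr; ring.
  rewrite (le_trans (ler_normB _ _))// !normrM /g mulrDr lerD// ler_wpM2r//.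
have i1 := cramer h1 d11 d12; have i2 := cramer h2 d21 d22.
by rewrite /phi mulrDr (le_trans (lerD i1 i2))// -mulrA mulr_natl mulr2n.
Qed.


Let Bc : R := 2 * L / `|w0|.
Let G : R := \int[mu]_(z in oint p q) (g z ^+ 2).
Hypothesis gi : mu.-integrable (oint p q) (EFin \o (fun z => g z ^+ 2)).
Hypothesis small : 4 * (Bc * G) ^+ 2 <= 1.

Let mg : measurable_fun (oint p q) g.
Proof.
by apply: measurable_funD; apply: measurableT_comp => //;
  [exact: (rsol_measurable hM cM sub su1)|exact: (rsol_measurable hM cM sub su2)].
Qed.
Let mphi : measurable_fun (oint p q) phi.
Proof.
by apply: measurable_funD; apply: measurableT_comp => //;
  [exact: (rsol_measurable hM cM sub sh1)|exact: (rsol_measurable hM cM sub sh2)].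
Qed.
Let w0p : 0 < `|w0|. Proof. by rewrite normr_gt0. Qed.
Let Bc0 : 0 <= Bc. Proof. by rewrite /Bc !mulr_ge0// invr_ge0 ltW. Qed.
Let G0 : 0 <= G. Proof. by apply: Rintegral_ge0 => y _; exact: sqr_ge0. Qed.

(** Squaring the pointwise estimate and integrating gives, by Cauchy and
    Schwarz, an inequality for the norm of [phi] in which the term to be
    absorbed has a coefficient smaller than 1. *)
Let energy (D : set R) (A X : R) : measurable D -> D `<=` oint p q -> 0 <= A -> 0 <= X ->
  X = \int[mu]_(z in D) (phi z * g z) ->
  mu.-integrable D (EFin \o (fun z => phi z ^+ 2)) ->
  (forall y, D y -> ~ M y -> phi y <= (A + Bc * X) * g y) ->
  \int[mu]_(z in D) (phi z ^+ 2) <= 4 * G * A ^+ 2.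
Proof.
move=> mD sD A0 X0 XE phii le.
have gD : mu.-integrable D (EFin \o (fun z => g z ^+ 2)).
  by apply: integrableS gi => //; exact: oint_measurable.
have mgD : measurable_fun D g by apply: measurable_funS mg => //; exact: oint_measurable.
have mpD : measurable_fun D phi by apply: measurable_funS mphi => //; exact: oint_measurable.
set P := \int[mu]_(z in D) (phi z ^+ 2).
set Y := A + Bc * X in le.
pose GD := \int[mu]_(z in D) (g z ^+ 2).
have GG : GD <= G.
  by apply: Rint_subset => //; [exact: oint_measurable|move=> y _; exact: sqr_ge0].
have GD0 : 0 <= GD by apply: Rintegral_ge0 => y _; exact: sqr_ge0.
have P0 : 0 <= P by apply: Rintegral_ge0 => y _; exact: sqr_ge0.
have cs : X ^+ 2 <= P * GD by rewrite XE; exact: Cauchy_Schwarz.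
suff : P <= Y ^+ 2 * GD.
  by apply: (@absorption _ P A Bc X G GD) => //; rewrite GD0.
rewrite /P /GD -RintegralZl//; apply: ae_le_Rintegral => //.
- exact: integrable_realZ.
- by move=> y _; exact: sqr_ge0.
- by move=> y _; rewrite mulr_ge0// sqr_ge0.
- apply: aeS (ae_notin_countable cM).
  move=> y My Dy; rewrite -exprMn lerXn2r// ?nnegrE ?phi0//; last exact: le.
  by rewrite mulr_ge0// /Y addr_ge0// mulr_ge0.
Qed.

Let norm_sum_le (x y z : R) : `|w0| * x <= y * z -> x <= y / `|w0| * z.
Proof. by move=> h; rewrite mulrAC ler_pdivlMr// mulrC. Qed.

(** Weyl's alternative: near an endpoint at which all solutions for one energy
    are square integrable, so are those for any other energy. *)
Lemma weyl_square_integrable :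
  mu.-integrable (oint p q) (EFin \o (fun z => phi z ^+ 2)).
Proof.
pose C0 := `|wr h1 u1 y0| + `|wr h1 u2 y0| + `|wr h2 u1 y0| + `|wr h2 u2 y0|.
have [c1 c2 c3 c4] : [/\ `|wr h1 u1 y0| <= C0, `|wr h1 u2 y0| <= C0,
    `|wr h2 u1 y0| <= C0 & `|wr h2 u2 y0| <= C0].
  have := normr_ge0 (wr h1 u1 y0); have := normr_ge0 (wr h1 u2 y0).
  have := normr_ge0 (wr h2 u1 y0); have := normr_ge0 (wr h2 u2 y0).
  by rewrite /C0; split; lra.
have C00 : 0 <= C0 by apply: le_trans c1.
pose A := 2 * C0 / `|w0|.
have A0 : 0 <= A by rewrite /A !mulr_ge0// invr_ge0 ltW.
apply: (@integrable_exhaust _ p q y0 _ (4 * G * A ^+ 2)) => //.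
- exact: measurable_funX.
- by move=> y _; exact: sqr_ge0.
move=> c d pc pd cyd.
have bp := bmphi pc pd.
have ip : itg c d (EFin \o (fun z => phi z ^+ 2)).
  apply: bounded_measurable_integrable.
  rewrite (_ : (fun z => _) = fun z => phi z * phi z); last by apply/funext => z; rewrite expr2.
  exact: bounded_measurableM.
split => //.
pose X := \int[mu]_(z in `[c, d]) (phi z * g z).
have X0 : 0 <= X by apply: Rintegral_ge0 => y _; rewrite mulr_ge0.
have cdp : `[c, d]%classic `<=` oint p q.
  by move=> y /=; rewrite in_itv/=; exact: oint_itvcc.
apply: (@energy _ A X) => // y /=; rewrite in_itv/= => ycd My.
have := weyl_pointwise pc pd cyd ycd My0 My c1 c2 c3 c4.
move=> /norm_sum_le h; apply: (le_trans h); rewrite le_eqVlt; apply/orP; left; apply/eqP.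
by rewrite /A /Bc -/X; field; rewrite normr_eq0.
Qed.

(** Wronskians that become arbitrarily small remove the constant from the
    pointwise estimate, and the inequality for the norm of [phi] becomes
    homogeneous. *)
Lemma weyl_vanish : (forall e : R, 0 < e -> exists x, [/\ oint p q x, ~ M x,
    `|wr h1 u1 x| < e /\ `|wr h1 u2 x| < e & `|wr h2 u1 x| < e /\ `|wr h2 u2 x| < e]) ->
  forall y, oint p q y -> ~ M y -> h1 y = 0.
Proof.
move=> lim; have phii := weyl_square_integrable.
have md : measurable (oint p q) by exact: oint_measurable.
pose X := \int[mu]_(z in oint p q) (phi z * g z).
have pgi : mu.-integrable (oint p q) (EFin \o (fun z => phi z * g z)).
  exact: square_integrable_mul.
have X0 : 0 <= X by apply: Rintegral_ge0 => y _; rewrite mulr_ge0.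
have le y : oint p q y -> ~ M y -> phi y <= (0 + Bc * X) * g y.
  move=> py My.
  have : `|w0| * phi y <= 2 * (L * X) * g y.
    apply/ler_addgt0Pr => e e0.
    have e'0 : 0 < e / (2 * g y + 1) by rewrite divr_gt0// ltr_wpDl// mulr_ge0.
    have [x [px Mx [e1 e2] [e3 e4]]] := lim _ e'0.
    pose c := Num.min x y; pose d := Num.max x y.
    have pc : oint p q c by rewrite /c; case: leP.
    have pd : oint p q d by rewrite /d; case: leP.
    have cx : c <= x <= d by rewrite ge_min le_max lexx.
    have cy : c <= y <= d by rewrite ge_min le_max lexx !orbT.
    have := weyl_pointwise pc pd cx cy Mx My (ltW e1) (ltW e2) (ltW e3) (ltW e4).
    set Xcd := \int[mu]_(z in _) _.
    have XX : Xcd <= X.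
      apply: Rint_subset => //; last by move=> z _; rewrite mulr_ge0.
      by move=> z /=; rewrite in_itv/=; exact: oint_itvcc.
    move=> h; apply: (le_trans h).
    have h1' : 2 * (e / (2 * g y + 1) + L * Xcd) * g y <= 2 * (e / (2 * g y + 1) + L * X) * g y.
      by rewrite ler_wpM2r// ler_wpM2l// lerD2l ler_wpM2l.
    apply: (le_trans h1').
    have -> : 2 * (e / (2 * g y + 1) + L * X) * g y =
      2 * (L * X) * g y + e / (2 * g y + 1) * (2 * g y) by ring.
    rewrite lerD2l -[leRHS](@divfK _ (2 * g y + 1)); last by rewrite gt_eqF// ltr_wpDl// mulr_ge0.
    by apply: ler_wpM2l; [exact: ltW|rewrite lerDl].
  move=> /norm_sum_le h; apply: (le_trans h); rewrite add0r le_eqVlt; apply/orP; left; apply/eqP.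
  by rewrite /Bc; field; rewrite normr_eq0.
have P0 : \int[mu]_(z in oint p q) (phi z ^+ 2) <= 0.
  by have := energy md (@subset_refl _ _) (lexx 0) X0 erefl phii le; rewrite expr0n mulr0.
have X00 : X = 0.
  have := Cauchy_Schwarz md mphi mg phii gi; rewrite -/X => h.
  have : X ^+ 2 <= 0 by apply: (le_trans h); rewrite -/G mulr_le0_ge0.
  by move=> h'; apply/eqP; rewrite -sqrf_eq0 eq_le h' sqr_ge0.
move=> y py My; have := le y py My; rewrite X00 mulr0 addr0 mul0r.
by have := normr_ge0 (h1 y); have := normr_ge0 (h2 y); rewrite /phi => *; apply/normr0_eq0; lra.
Qed.

End WeylEstimates.

(** * Complex solutions and their real and imaginary parts *)

Section Bridge.
Context {R : realType}.
Local Notation mu := (@lebesgue_measure R).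
Variables (a b : \bar R) (V : R -> R) (I : set int) (x : int -> R).
Hypothesis hx : interaction_points a b I x.
Let M := x @` I.

Lemma interaction_countable : countable M.
Proof. by apply: sub_countable (card_image_le _ _) _; exact: countableP. Qed.

Lemma interaction_discrete : discrete_in (oint a b) M.
Proof.
move=> t at_; have [_ _ /(_ t at_) nl] := hx.
have [W [nW hW]] : exists W, nbhs t W /\ forall y, y != t -> M y -> ~ W y.
  apply: contrapT => h; apply: nl => W nW; apply: contrapT => h'; apply: h.
  by exists W; split => // y yt My Wy; apply: h'; exists y; split.
have [e /= e0 he] := nW; exists e => // y ye yt My; apply: (hW y yt My).
by apply: he; rewrite /= distrC.
Qed.

(** The identity off the interaction points, so that an interface condition can
    be imposed at every point. *)
Definition matrix_at (A : int -> 'M[R]_2) (t : R) : 'M[R]_2 :=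
  if pselect (exists n, I n /\ x n = t) is left h then A (sval (cid h)) else 1%:M.

Lemma matrix_at_point A n : I n -> matrix_at A (x n) = A n.
Proof.
move=> In; rewrite /matrix_at; case: pselect => [h|[]]; last by exists n.
case: cid => m [/= Im xm]; congr A; have [inj _ _] := hx.
by apply: inj; rewrite ?inE.
Qed.

Lemma matrix_at_off A t : ~ M t -> matrix_at A t = 1%:M.
Proof.
move=> Mt; rewrite /matrix_at; case: pselect => // -[n [In xn]].
by exfalso; apply: Mt; exists n.
Qed.

Lemma matrix_at_eq A A' t : (forall n, I n -> x n = t -> A n = A' n) ->
  matrix_at A t = matrix_at A' t.
Proof.
move=> h; rewrite /matrix_at; case: pselect => // -[n [In xn]] /=.
by case: cid => m [Im xm] /=; exact: h.
Qed.

Definition unimodular (A : 'M[R]_2) := A 0 0 * A 1 1 - A 0 1 * A 1 0 = 1.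

Lemma matrix_at_unimodular A : (forall n, I n -> unimodular (A n)) ->
  forall t, unimodular (matrix_at A t).
Proof.
move=> h t; rewrite /matrix_at; case: pselect => [k|_]; last first.
  by rewrite /unimodular !mxE /= mulr0 subr0 mulr1.
by case: cid => m [Im xm] /=; exact: h.
Qed.

Lemma interface_mxE (al r th : R) : [/\
  interface_mx al r th 0 0 = r * cos th + al / r * sin th,
  interface_mx al r th 0 1 = - r * sin th + al / r * cos th,
  interface_mx al r th 1 0 = r^-1 * sin th &
  interface_mx al r th 1 1 = r^-1 * cos th].
Proof.
rewrite /interface_mx /mx2; split; rewrite !mxE !big_ord_recl !big_ord0 !mxE
  !big_ord_recl !big_ord0 !mxE /=; ring.
Qed.

Lemma interface_mx_unimodular (al r th : R) : 0 < r -> unimodular (interface_mx al r th).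
Proof.
move=> r0; rewrite /unimodular; have [-> -> -> ->] := interface_mxE al r th.
rewrite -[RHS](cos2Dsin2 th); field; exact: lt0r_neq0.
Qed.

Lemma regularF_real D (f : R -> R[i]) :
  regularF D f <-> regularR D (reF f) /\ regularR D (imF f).
Proof.
split.
  move=> [d [ac1 ac2] [bc1 bc2] dd]; split; split => //.
  - by move=> y /d[].
  - by apply: aeS dd => y h Dy; exact: (h Dy).1.
  - by move=> y /d[].
  - by apply: aeS dd => y h Dy; exact: (h Dy).2.
move=> [[d1 ac1 bc1 dd1] [d2 ac2 bc2 dd2]]; split => //.
- by move=> y Dy; split; [exact: d1|exact: d2].
- by apply: aeS2 dd1 dd2 => y h1 h2 Dy; split; [exact: h1|exact: h2].
Qed.

Lemma reF_derF (f : R -> R[i]) : reF (derF f) = derive1 (reF f).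
Proof. by apply/funext. Qed.

Lemma imF_derF (f : R -> R[i]) : imF (derF f) = derive1 (imF f).
Proof. by apply/funext. Qed.

Lemma reF_realF (u : R -> R) : reF (realF u) = u.
Proof. by apply/funext. Qed.

Lemma imF_realF (u : R -> R) : imF (realF u) = fun=> 0.
Proof. by apply/funext. Qed.

Lemma interface_real (A : 'M[R]_2) (f : R -> R[i]) y :
  interface A f y <-> rinterface A (reF f) y /\ rinterface A (imF f) y.
Proof.
split.
  move=> [[c1 c2] [c3 c4] [c5 c6] [c7 c8] /matrixP E].
  have := E 0 0; have := E 1 0; rewrite !mxE /= !big_ord_recl !big_ord0 !mxE /=.
  have l1 : lift ord0 ord0 = 1 :> 'I_2 by exact: val_inj.
  have l0 : ord0 = 0 :> 'I_2 by exact: val_inj.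
  rewrite /limF !l1 !l0 !addr0 => e2 e1.
  have e1r := congr1 (@complex.Re R) e1; have e1i := congr1 (@complex.Im R) e1.
  have e2r := congr1 (@complex.Re R) e2; have e2i := congr1 (@complex.Im R) e2.
  rewrite /= !mul0r !subr0 in e1r e2r; rewrite /= !mul0r !addr0 in e1i e2i.
  rewrite !reF_derF in c3 c7 e1r e2r; rewrite !imF_derF in c4 c8 e1i e2i.
  split.
    exists (lim (reF f @ y^'-)), (lim (derive1 (reF f) @ y^'-)),
      (lim (reF f @ y^'+)), (lim (derive1 (reF f) @ y^'+)).
    by split; [split; [exact: c5|exact: c7]|split; [exact: c1|exact: c3]|exact: e1r|exact: e2r].
  exists (lim (imF f @ y^'-)), (lim (derive1 (imF f) @ y^'-)),
    (lim (imF f @ y^'+)), (lim (derive1 (imF f) @ y^'+)).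
  by split; [split; [exact: c6|exact: c8]|split; [exact: c2|exact: c4]|exact: e1i|exact: e2i].
move=> [[s [s' [t [t' [[c1 c2] [c3 c4] E1 E2]]]]]].
move=> [z [z' [w [w' [[d1 d2] [d3 d4] F1 F2]]]]].
rewrite -!reF_derF in c2 c4; rewrite -!imF_derF in d2 d4.
split.
- by split; apply/cvg_ex; [exists t; exact: c3|exists w; exact: d3].
- by split; apply/cvg_ex; [exists t'; exact: c4|exists w'; exact: d4].
- by split; apply/cvg_ex; [exists s; exact: c1|exists z; exact: d1].
- by split; apply/cvg_ex; [exists s'; exact: c2|exists z'; exact: d2].
have L1 : limF y^'+ f = t +i* w by rewrite /limF (cvg_lim _ c3)// (cvg_lim _ d3).
have L2 : limF y^'+ (derF f) = t' +i* w' by rewrite /limF (cvg_lim _ c4)// (cvg_lim _ d4).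
have L3 : limF y^'- f = s +i* z by rewrite /limF (cvg_lim _ c1)// (cvg_lim _ d1).
have L4 : limF y^'- (derF f) = s' +i* z' by rewrite /limF (cvg_lim _ c2)// (cvg_lim _ d2).
have l1 : lift ord0 ord0 = 1 :> 'I_2 by exact: val_inj.
have l0 : ord0 = 0 :> 'I_2 by exact: val_inj.
rewrite L1 L2 L3 L4; apply/matrixP => i j; rewrite !mxE !big_ord_recl !big_ord0 !mxE /= l1 l0 addr0.
have [->|->] : i = 0 \/ i = 1.
- by case: i => -[|[|//]] hi; [left|right]; exact: val_inj.
- rewrite /= E1 F1; apply/eqP; rewrite eq_complex /= !mul0r !subr0 !addr0.
  by rewrite !eqxx.
- rewrite /= E2 F2; apply/eqP; rewrite eq_complex /= !mul0r !subr0 !addr0.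
  by rewrite !eqxx.
Qed.

Lemma rinterface_regular p q (u : R -> R) t : oint p q `<=` oint a b ->
  regularR (oint p q `\` M) u -> oint p q t -> ~ M t -> rinterface 1%:M u t.
Proof.
move=> sub ru pt Mt.
have [cu cw] := regular_continuous interaction_discrete sub ru pt Mt.
exists (u t), (derive1 u t), (u t), (derive1 u t); split.
- by split; exact: cvg_at_left_filter.
- by split; exact: cvg_at_right_filter.
- by rewrite !mxE/=; ring.
- by rewrite !mxE/=; ring.
Qed.

Local Notation sol A := (rsol V M (matrix_at A)).

Lemma rsol_regular_interface A p q k u : oint p q `<=` oint a b ->
  regularR (oint p q `\` M) u ->
  {ae mu, forall y, oint p q y -> derive1 (derive1 u) y = V y * u y - k y} ->
  (forall n, I n -> oint p q (x n) -> rinterface (A n) u (x n)) ->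
  sol A p q k u.
Proof.
move=> sub ru ae1 int; split => // t pt.
have [[n In xn]|Mt] := pselect (M t).
  by rewrite -xn matrix_at_point//; apply: int => //; rewrite xn.
by rewrite matrix_at_off//; exact: (rinterface_regular sub ru).
Qed.

Lemma solution_real A p q (z : R[i]) f : oint p q `<=` oint a b ->
  solution_on V I x A p q z f ->
  sol A p q (fun y => complex.Re z * reF f y - complex.Im z * imF f y) (reF f) /\
  sol A p q (fun y => complex.Re z * imF f y + complex.Im z * reF f y) (imF f).
Proof.
move=> sub [/regularF_real[r1 r2] ae1 int]; split.
- apply: (rsol_regular_interface sub r1); last first.
    by move=> n In pn; exact: ((interface_real _ _ _).1 (int n In pn)).1.
  apply: aeS ae1.
  move=> y h py; have := congr1 (@complex.Re R) (h py).
  rewrite /tau -reF_derF -reF_derF /reF /imF; case: (derF (derF f) y) => dr di.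
  by case: (f y) => fr fi; case: z {h} => zr zi /=; lra.
- apply: (rsol_regular_interface sub r2); last first.
    by move=> n In pn; exact: ((interface_real _ _ _).1 (int n In pn)).2.
  apply: aeS ae1.
  move=> y h py; have := congr1 (@complex.Im R) (h py).
  rewrite /tau -imF_derF -imF_derF /reF /imF; case: (derF (derF f) y) => dr di.
  by case: (f y) => fr fi; case: z {h} => zr zi /=; lra.
Qed.

Lemma derive1_cst0 : derive1 (fun=> 0 : R) = fun=> 0 :> R.
Proof. by apply/funext => y; rewrite derive1_cst. Qed.

Lemma derF_realF (u : R -> R) : derF (realF u) = realF (derive1 u).
Proof.
by apply/funext => y; rewrite /derF imF_realF reF_realF derive1_cst0.
Qed.

Lemma regularR0 D : regularR D (fun=> 0 : R).
Proof.
split.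
- by move=> y _; exact: derivable_cst.
- by move=> c d _; exact: abs_continuous_cst.
- by move=> c d _; rewrite derive1_cst0; exact: abs_continuous_cst.
- by apply: aeW => y _; rewrite derive1_cst0; exact: derivable_cst.
Qed.

Lemma rinterface0 B y : rinterface B (fun=> 0 : R) y.
Proof.
exists 0, 0, 0, 0; rewrite derive1_cst0; split.
- by split; exact: cvg_cst.
- by split; exact: cvg_cst.
- by rewrite !mulr0 addr0.
- by rewrite !mulr0 addr0.
Qed.

Lemma real_solution A p q (e : R) u : oint p q `<=` oint a b ->
  sol A p q (fun y => e * u y) u -> solution_on V I x A p q (e%:C) (realF u).
Proof.
move=> sub [ru ae1 int]; split.
- apply/regularF_real; rewrite reF_realF imF_realF.
  by split; [exact: ru|exact: regularR0].
- apply: aeS ae1.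
  move=> y h py; rewrite /tau !derF_realF /realF h//; apply/eqP; rewrite eq_complex /=.
  by apply/andP; split; apply/eqP; ring.
- move=> n In pn; apply/interface_real; rewrite reF_realF imF_realF.
  split; last exact: rinterface0.
  by rewrite -(matrix_at_point A In); exact: int.
Qed.

End Bridge.

(** * One-sided neighbourhoods of the end-points *)

Section Tails.
Context {R : realType}.
Variables a b : \bar R.
Implicit Types (sd : bool) (c y : R) (P : R -> Prop).

Definition tl sd c : \bar R := if sd then a else c%:E.
Definition tr sd c : \bar R := if sd then c%:E else b.

(** The part of the interval between [c] and its left end ([sd = true]) or
    its right end ([sd = false]); both ends are treated by the same proofs. *)
Definition tail sd c : set R := oint (tl sd c) (tr sd c).

Definition endF sd : set_system R := if sd then lend a else rend b.

Lemma tail_sub sd c : oint a b c -> tail sd c `<=` oint a b.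
Proof.
move=> /andP[ac cb] y; rewrite /tail /tl /tr; case: sd => /andP[h1 h2]; apply/andP; split => //.
  exact: lt_trans cb.
exact: lt_trans h1.
Qed.

Lemma tail_trans sd c y : tail sd c y -> tail sd y `<=` tail sd c.
Proof.
rewrite /tail /tl /tr; case: sd => /andP[h1 h2] z /andP[h3 h4]; apply/andP; split => //.
  exact: lt_trans h2.
exact: lt_trans h3.
Qed.

Lemma tail_meet sd c c' : oint a b c -> oint a b c' ->
  exists2 d, oint a b d & tail sd d `<=` tail sd c /\ tail sd d `<=` tail sd c'.
Proof.
move=> pc pc'; have pm : oint a b (Num.min c c') /\ oint a b (Num.max c c').
  by rewrite minEle maxEle; case: ifP.
exists (if sd then Num.min c c' else Num.max c c'); first by case: sd; case: pm.
rewrite /tail /tl /tr; case: sd; split => y /andP[h1 h2]; apply/andP; split => //.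
- by apply: lt_le_trans h2 _; rewrite lee_fin ge_min lexx.
- by apply: lt_le_trans h2 _; rewrite lee_fin ge_min lexx orbT.
- by apply: le_lt_trans h1; rewrite lee_fin le_max lexx.
- by apply: le_lt_trans h1; rewrite lee_fin le_max lexx orbT.
Qed.

Lemma tail_nonempty sd c : oint a b c -> exists y, tail sd c y.
Proof.
rewrite /tail /tl /tr => /andP[]; case: sd.
- case: a => [r|//|] h _; rewrite ?lte_fin in h.
    by exists ((r + c) / 2); rewrite /oint /= !lte_fin; between.
  by exists (c - 1); rewrite /oint /= ltNyr lte_fin /=; lra.
- case: b => [r| |//] _ h; rewrite ?lte_fin in h.
    by exists ((r + c) / 2); rewrite /oint /= !lte_fin; between.
  by exists (c + 1); rewrite /oint /= ltry lte_fin andbT; lra.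
Qed.

Lemma tail_point M sd c : discrete_in (oint a b) M -> oint a b c ->
  exists y, tail sd c y /\ ~ M y.
Proof.
move=> hM pc; have [y ty] := tail_nonempty sd pc.
have [e [e0 _ he]] := punctured_sides hM (tail_sub pc) ty.
by exists (y + e / 2); apply: he; between.
Qed.

Lemma endF_basis sd P c : oint a b c -> (\forall y \near endF sd, P y) ->
  exists2 d, oint a b d & forall y, tail sd d y -> P y.
Proof.
rewrite /tail /tl /tr /endF => /andP[]; case: sd.
- case: a => [r|//|] h1 h2; rewrite ?lte_fin in h1.
    move=> [e /= e0 he]; exists (Num.min c (r + e / 2)).
      apply/andP; split; first by rewrite lte_fin lt_min h1/=; lra.
      by apply: le_lt_trans h2; rewrite lee_fin ge_min lexx.
    move=> y /andP[]; rewrite !lte_fin lt_min => ry /andP[_ yr]; apply: he => //=.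
    by rewrite distrC ltr_distl; between.
  move=> [m [_ hm]]; exists (Num.min c m).
    apply/andP; split; first by rewrite ltNyr.
    by apply: le_lt_trans h2; rewrite lee_fin ge_min lexx.
  by move=> y /andP[_]; rewrite !lte_fin lt_min => /andP[_ ym]; apply: hm.
- case: b => [r| |//] h1 h2; rewrite ?lte_fin in h2.
    move=> [e /= e0 he]; exists (Num.max c (r - e / 2)).
      apply/andP; split; last by rewrite lte_fin gt_max h2/=; lra.
      by apply: (lt_le_trans h1); rewrite lee_fin le_max lexx.
    move=> y /andP[]; rewrite !lte_fin gt_max => /andP[_ yr] ry; apply: he => //=.
    by rewrite distrC ltr_distl; between.
  move=> [m [_ hm]]; exists (Num.max c m).
    apply/andP; split; last by rewrite ltry.
    by apply: (lt_le_trans h1); rewrite lee_fin le_max lexx.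
  by move=> y /andP[+ _]; rewrite !lte_fin gt_max => /andP[_ ym]; apply: hm.
Qed.

Lemma endF_tail sd c : oint a b c -> \forall y \near endF sd, tail sd c y.
Proof.
rewrite /tail /tl /tr /endF => /andP[]; case: sd.
- case: a => [r|//|] h1 h2; rewrite ?lte_fin in h1.
    exists (c - r) => /=; first by rewrite subr_gt0.
    move=> y /=; rewrite distrC ltr_distl => /andP[_ h3] h4.
    by apply/andP; rewrite !lte_fin; split; lra.
  exists c; split; first exact: num_real.
  by move=> y yc; apply/andP; rewrite ltNyr lte_fin.
- case: b => [r| |//] h1 h2; rewrite ?lte_fin in h2.
    exists (r - c) => /=; first by rewrite subr_gt0.
    move=> y /=; rewrite distrC ltr_distl => /andP[h3 _] h4.
    by apply/andP; rewrite !lte_fin; split; lra.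
  exists c; split; first exact: num_real.
  by move=> y yc; apply/andP; rewrite ltry lte_fin.
Qed.

Lemma endF_proper sd : ProperFilter (endF sd).
Proof.
by rewrite /endF; case: sd; [case: a => [r| |]|case: b => [r| |]] => /=; apply: _.
Qed.

End Tails.

(** * Square integrable real and imaginary parts *)

Section SquareIntegrable.
Context {R : realType}.
Local Notation mu := (@lebesgue_measure R).
Implicit Types (D : set R) (u h : R -> R) (f : R -> R[i]).

Lemma integrable_sqr_le D u h K : measurable D -> measurable_fun D u ->
  mu.-integrable D (EFin \o (fun y => h y ^+ 2)) ->
  (forall y, D y -> u y ^+ 2 <= K * h y ^+ 2) ->
  mu.-integrable D (EFin \o (fun y => u y ^+ 2)).
Proof.
move=> mD mu' ih le.
have := integrable_realZ K mD ih.
apply: le_integrable => //.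
  by apply/measurable_EFinP; exact: measurable_funX.
move=> y Dy /=; rewrite lee_fin ger0_norm ?sqr_ge0//.
by apply: le_trans (ler_norm _); exact: le.
Qed.

Lemma integrable_abs_sum_sqr D u h : measurable D -> measurable_fun D u ->
  measurable_fun D h ->
  mu.-integrable D (EFin \o (fun y => u y ^+ 2)) ->
  mu.-integrable D (EFin \o (fun y => h y ^+ 2)) ->
  mu.-integrable D (EFin \o (fun y => (`|u y| + `|h y|) ^+ 2)).
Proof.
move=> mD m1 m2 i1 i2.
have := integrable_realZ 2 mD (integrable_realD mD i1 i2).
apply: le_integrable => //.
  apply/measurable_EFinP; apply: measurable_funX; apply: measurable_funD;
  exact: measurableT_comp.
move=> y Dy /=; rewrite lee_fin ger0_norm ?sqr_ge0//.
apply: le_trans (ler_norm _).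
have <- := real_normK (num_real (u y)); have <- := real_normK (num_real (h y)).
by have := sqr_ge0 (`|u y| - `|h y|); nra.
Qed.

Lemma integrable_sqr_abs_sum D u h : measurable D -> measurable_fun D u ->
  mu.-integrable D (EFin \o (fun y => (`|u y| + `|h y|) ^+ 2)) ->
  mu.-integrable D (EFin \o (fun y => u y ^+ 2)).
Proof.
move=> mD m1 i1; apply: (@integrable_sqr_le _ _ _ 1 mD m1 i1) => y _.
rewrite mul1r -(real_normK (num_real (u y))).
by have := normr_ge0 (u y); have := normr_ge0 (h y); nra.
Qed.

Lemma L2_parts D f : measurable D -> measurable_fun D (reF f) ->
  measurable_fun D (imF f) -> L2 D f ->
  mu.-integrable D (EFin \o (fun y => reF f y ^+ 2)) /\
  mu.-integrable D (EFin \o (fun y => imF f y ^+ 2)).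
Proof.
move=> mD m1 m2 [g [g1 g2 ig ae]].
have part (p q : R -> R) : measurable_fun D p -> measurable_fun D q ->
    (forall y, D y -> q y ^+ 2 <= reF g y ^+ 2 + imF g y ^+ 2) ->
    {ae mu, forall y, D y -> p y = q y} ->
    mu.-integrable D (EFin \o (fun y => p y ^+ 2)).
  move=> mp mq le pq.
  have iq : mu.-integrable D (EFin \o (fun y => q y ^+ 2)).
    move: ig; apply: le_integrable => //.
      by apply/measurable_EFinP; exact: measurable_funX.
    move=> y Dy /=; rewrite lee_fin ger0_norm ?sqr_ge0// ger0_norm; first exact: le.
    by rewrite addr_ge0 ?sqr_ge0.
  have mp2 : measurable_fun D (EFin \o (fun y => p y ^+ 2)).
    by apply/measurable_EFinP; exact: measurable_funX.
  have mq2 : measurable_fun D (EFin \o (fun y => q y ^+ 2)).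
    by apply/measurable_EFinP; exact: measurable_funX.
  apply/integrableP; split => //; move/integrableP : iq => [_].
  rewrite (@ae_eq_integral _ _ _ mu D (abse \o (EFin \o (fun y => p y ^+ 2)))
     (abse \o (EFin \o (fun y => q y ^+ 2)))) //.
  - exact: measurableT_comp.
  - exact: measurableT_comp.
  - apply: aeS pq.
    by move=> y h Dy /=; rewrite h.
split; [apply: (part _ (reF g))|apply: (part _ (imF g))] => //.
- by move=> y _; rewrite lerDl sqr_ge0.
- apply: aeS ae.
  by move=> y h Dy; rewrite /reF h.
- by move=> y _; rewrite lerDr sqr_ge0.
- apply: aeS ae.
  by move=> y h Dy; rewrite /imF h.
Qed.

Lemma parts_L2 D f : measurable D -> measurable_fun D (reF f) ->
  measurable_fun D (imF f) ->
  mu.-integrable D (EFin \o (fun y => reF f y ^+ 2)) ->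
  mu.-integrable D (EFin \o (fun y => imF f y ^+ 2)) -> L2 D f.
Proof.
move=> mD m1 m2 i1 i2; exists f; split => //; first exact: integrable_realD.
by apply: aeW.
Qed.

Lemma realF_L2 D u : measurable D -> measurable_fun D u ->
  mu.-integrable D (EFin \o (fun y => u y ^+ 2)) -> L2 D (realF u).
Proof.
move=> mD m1 i1; apply: parts_L2 => //; rewrite ?imF_realF ?reF_realF//.
apply: (@integrable_sqr_le _ _ _ 0 mD _ i1) => // y _.
by rewrite mul0r expr0n.
Qed.

End SquareIntegrable.

(** * The limit circle case does not depend on one interaction *)

Section RightLimits.
Context {R : realType}.

Lemma rsol_matrix (V : R -> R) M (B B' : R -> 'M[R]_2) p q k u :
  (forall t, oint p q t -> B t = B' t) -> rsol V M B p q k u -> rsol V M B' p q k u.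
Proof. by move=> BB [r e i]; split => // t pt; rewrite -BB//; exact: i. Qed.

Lemma rsol_right_continuous (a b : \bar R) (V : R -> R) M B p q k u t :
  discrete_in (oint a b) M -> oint p q `<=` oint a b ->
  rsol V M B p q k u -> oint p q t -> ~ M t ->
  u @ t^'+ --> u t /\ derive1 u @ t^'+ --> derive1 u t.
Proof.
move=> hM sub [ru _ _] pt Mt; have [cu cw] := regular_continuous hM sub ru pt Mt.
by split; exact: cvg_at_right_filter.
Qed.

End RightLimits.

Section LimitCircle.
Context {R : realType}.
Local Notation mu := (@lebesgue_measure R).
Variables (a b : \bar R) (V : R -> R) (I : set int) (x : int -> R).
Hypothesis hV : locally_integrable (oint a b) V.
Hypothesis hx : interaction_points a b I x.
Let M := x @` I.
Let cM : countable M := interaction_countable I x.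
Let hM : discrete_in (oint a b) M := interaction_discrete hx.
Local Notation sol A := (rsol V M (matrix_at I x A)).
Local Notation "'tail'" := (tail a b).
Local Notation "'tl'" := (tl a).
Local Notation "'tr'" := (tr b).
Implicit Types (A : int -> 'M[R]_2) (sd : bool) (u h : R -> R).
Let uM A (uA : forall n, I n -> unimodular (A n)) :=
  @matrix_at_unimodular R I x A uA.

Definition lcc sd A : Prop :=
  if sd then lcc_left a b V I x A else lcc_right a b V I x A.

Lemma lccP sd A : lcc sd A <-> forall z f, solution_on V I x A a b z f ->
  exists2 c, oint a b c & L2 (tail sd c) f.
Proof. by case: sd. Qed.

Lemma tail_measurable sd c : measurable (tail sd c).
Proof. exact: oint_measurable. Qed.

(** Near the end-point the smallness hypothesis of [weyl_square_integrable]
    can always be met, since the tails of a convergent integral vanish. *)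
Lemma weyl_tail A sd s (E K : R) u1 u2 c0 c3 y1 :
  (forall n, I n -> unimodular (A n)) -> oint a b s -> oint a b c0 -> oint a b c3 ->
  sol A (tl sd s) (tr sd s) (fun y => E * u1 y) u1 ->
  sol A (tl sd s) (tr sd s) (fun y => E * u2 y) u2 ->
  mu.-integrable (tail sd c0) (EFin \o (fun y => (`|u1 y| + `|u2 y|) ^+ 2)) ->
  tail sd s y1 -> ~ M y1 -> wr u1 u2 y1 != 0 ->
  exists c y, [/\ oint a b c, tail sd c `<=` tail sd s `&` tail sd c3,
    [/\ tail sd c y, ~ M y & wr u1 u2 y != 0],
    mu.-integrable (tail sd c) (EFin \o (fun y => (`|u1 y| + `|u2 y|) ^+ 2)) &
    4 * (2 * (`|K| + `|E|) / `|wr u1 u2 y| *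
      \int[mu]_(z in tail sd c) (`|u1 z| + `|u2 z|) ^+ 2) ^+ 2 <= 1].
Proof.
move=> uA ps pc0 pc3 s1 s2 ig ty1 My1 w0.
have [c1 pc1 [t10 t13]] := tail_meet sd pc0 pc3.
have [c2 pc2 [t2s t21]] := tail_meet sd ps pc1.
have [y2 ty2] := tail_nonempty sd pc2.
pose X := 2 * (`|K| + `|E|) / `|wr u1 u2 y1|.
have X0 : 0 <= X by rewrite /X divr_ge0// mulr_ge0// addr_ge0.
(* the choice of the bound makes [X * J <= 1 / 2] for the integral [J] below *)
have e0 : 0 < (2 * X + 1)^-1 by rewrite invr_gt0; lra.
have ig2 : mu.-integrable (tail sd c2) (EFin \o (fun y => (`|u1 y| + `|u2 y|) ^+ 2)).
  apply: integrableS ig; [exact: tail_measurable|exact: tail_measurable|].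
  by move=> y /t21 /t10.
have g0 y : 0 <= (`|u1 y| + `|u2 y|) ^+ 2 by exact: sqr_ge0.
have [c [d [pc pd _ ic id]]] := integrable_tails ty2 e0 ig2 (fun y _ => g0 y).
have [c' tc' ic'] : exists2 c', tail sd c2 c' &
    \int[mu]_(z in tail sd c') (`|u1 z| + `|u2 z|) ^+ 2 < (2 * X + 1)^-1.
  move: (pc) (pd) (ic) (id); rewrite /tail /tl /tr; case: (sd) => pc' pd' ic' id'.
    by exists c.
  by exists d.
have pc' : oint a b c' by exact: (tail_sub pc2 tc').
have t'2 := tail_trans tc'.
have [y [ty My]] := tail_point sd hM pc'.
have tsy : tail sd s y by exact/t2s/t'2.
have wE : wr u1 u2 y = wr u1 u2 y1.
  exact: (wr_eig_const hM (uM uA) (@tail_sub _ _ _ sd s ps) s1 s2 tsy ty1 My My1).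
exists c', y; split => //.
- by move=> z /t'2 tz; split; [exact: t2s|exact/t13/t21].
- by rewrite wE.
- apply: integrableS ig2; [exact: tail_measurable|exact: tail_measurable|exact: t'2].
- rewrite wE -/X; set J := \int[mu]_(z in _) _ in ic' *.
  have J0 : 0 <= J by apply: Rintegral_ge0 => z _; exact: g0.
  have hJ : J * (2 * X + 1) <= 1.
    by rewrite -ler_pdivlMr ?mul1r ?div1r; [exact: ltW|lra].
  have : 0 <= X * J by rewrite mulr_ge0.
  have : X * J <= 1 / 2 by nra.
  by move: (X * J) => Y; nra.
Qed.

(** Weyl's estimate applies to the real and imaginary parts of a solution for
    any [z], as each source term is bounded by [|Re z| + |Im z|] times the sum of
    the sizes of the two parts. *)
Lemma weyl_lcc A sd s (E : R) u1 u2 c0 y1 :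
  (forall n, I n -> unimodular (A n)) -> oint a b s -> oint a b c0 ->
  sol A (tl sd s) (tr sd s) (fun y => E * u1 y) u1 ->
  sol A (tl sd s) (tr sd s) (fun y => E * u2 y) u2 ->
  mu.-integrable (tail sd c0) (EFin \o (fun y => (`|u1 y| + `|u2 y|) ^+ 2)) ->
  tail sd s y1 -> ~ M y1 -> wr u1 u2 y1 != 0 -> lcc sd A.
Proof.
move=> uA ps pc0 s1 s2 ig ty1 My1 w0; apply/lccP => z f sf.
have [h1 h2] := solution_real hx (@subset_refl _ (oint a b)) sf.
pose K := `|complex.Re z| + `|complex.Im z|.
have [c [y [pc tss [ty My wy] igc sm]]] :=
  weyl_tail K uA ps pc0 ps s1 s2 ig ty1 My1 w0.
have ts : tail sd c `<=` tail sd s by move=> t /tss[].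
have sub := @tail_sub _ _ _ sd c pc.
have h1c := rsolS sub h1; have h2c := rsolS sub h2.
have m1 := rsol_measurable hM cM sub h1c.
have m2 := rsol_measurable hM cM sub h2c.
have mZ (r : R) (g : R -> R) : measurable_fun (tail sd c) g ->
    measurable_fun (tail sd c) (fun y => r * g y).
  by move=> mg; apply: measurable_funM => //; exact: measurable_cst.
have bd (p q h h' : R) : `|p * h| + `|q * h'| <= (`|p| + `|q|) * (`|h| + `|h'|).
  by rewrite !normrM mulrDl; apply: lerD; rewrite ler_wpM2l// ?lerDl ?lerDr.
have := weyl_square_integrable hM cM (uM uA) (K := K) sub
  (rsolS ts s1) (rsolS ts s2) h1c h2c _ _ _ ty My wy igc sm.
move=> H; exists c => //.
have {H} ih : mu.-integrable (tail sd c)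
    (EFin \o (fun y => (`|reF f y| + `|imF f y|) ^+ 2)).
  apply: H.
  - by apply: measurable_funB; exact: mZ.
  - by apply: measurable_funD; exact: mZ.
  - move=> y' _; split.
      apply: le_trans (ler_normB _ _) _; exact: bd.
    apply: le_trans (ler_normD _ _) _; rewrite [`|reF f y'| + _]addrC.
    exact: bd.
apply: (parts_L2 _ m1 m2); first exact: tail_measurable.
  by apply: (@integrable_sqr_abs_sum _ _ _ (imF f)); first exact: tail_measurable.
apply: (@integrable_sqr_abs_sum _ _ _ (reF f)) => //; first exact: tail_measurable.
rewrite (_ : (fun y => _) = (fun y => (`|reF f y| + `|imF f y|) ^+ 2))//.
by apply/funext => t; rewrite addrC.
Qed.

Lemma real_solution_L2 A sd (E : R) u : lcc sd A -> sol A a b (fun y => E * u y) u ->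
  exists2 c, oint a b c & mu.-integrable (tail sd c) (EFin \o (fun y => u y ^+ 2)).
Proof.
move=> /lccP l su.
have [c pc L] := l _ _ (real_solution hx (@subset_refl _ (oint a b)) su).
exists c => //.
have mt := @tail_measurable sd c.
have m : measurable_fun (tail sd c) u.
  exact: (rsol_measurable hM cM (@tail_sub _ _ _ sd c pc) (rsolS (@tail_sub _ _ _ sd c pc) su)).
have [] := L2_parts mt _ _ L; rewrite ?reF_realF ?imF_realF//.
Qed.

Section OneInteraction.
Variable n0 : int.
Hypothesis hn0 : I n0.
Let s := x n0.

Lemma interaction_in : oint a b s.
Proof. by have [_ h _] := hx; apply: h; exists n0. Qed.

Definition agree_off A1 A2 := forall n, I n -> n != n0 -> A1 n = A2 n.

Lemma agree_offC A1 A2 : agree_off A1 A2 -> agree_off A2 A1.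
Proof. by move=> h n In nn; rewrite h. Qed.

Lemma agree_matrix A1 A2 t : agree_off A1 A2 -> t != s ->
  matrix_at I x A1 t = matrix_at I x A2 t.
Proof.
move=> h ts; apply: matrix_at_eq => n In xn; apply: h => //.
by apply: contraNneq ts => n_n0; rewrite -xn n_n0.
Qed.

Lemma tail_neq sd y : tail sd s y -> y != s.
Proof.
rewrite /tail /tl /tr; case: sd => /andP[h1 h2]; rewrite ?lte_fin in h1 h2.
  by rewrite lt_eqF.
by rewrite gt_eqF.
Qed.

Lemma agree_rsol A1 A2 sd k u : agree_off A1 A2 ->
  sol A1 (tl sd s) (tr sd s) k u -> sol A2 (tl sd s) (tr sd s) k u.
Proof.
by move=> h; apply: rsol_matrix => t /tail_neq ts; exact: agree_matrix.
Qed.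

(** The limit circle case is read off the solutions of one real equation near
    the end-point, where the two families coincide. *)
Lemma lcc_transfer A1 A2 sd : agree_off A1 A2 ->
  (forall n, I n -> unimodular (A1 n)) -> (forall n, I n -> unimodular (A2 n)) ->
  lcc sd A1 -> lcc sd A2.
Proof.
move=> ag uA1 uA2 l; have ps := interaction_in.
have sub := @tail_sub _ _ _ sd s ps.
have [y0 [ty0 My0]] := tail_point sd hM ps.
have ex := eig_exists hV hM cM (@matrix_at_off _ I x A1) (uM uA1) 0 _ _ (sub _ ty0) My0.
have [u1 [s1 u1y u1'y]] := ex 1 0; have [u2 [s2 u2y u2'y]] := ex 0 1.
have [c1 pc1 i1] := real_solution_L2 l s1; have [c2 pc2 i2] := real_solution_L2 l s2.
have [c pc [t1 t2]] := tail_meet sd pc1 pc2.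
have subc := @tail_sub _ _ _ sd c pc.
have mt := @tail_measurable sd c.
apply: (weyl_lcc (E := 0) (u1 := u1) (u2 := u2) uA2 ps pc _ _ _ ty0 My0).
- by apply: (agree_rsol ag); exact: rsolS sub s1.
- by apply: (agree_rsol ag); exact: rsolS sub s2.
- apply: integrable_abs_sum_sqr => //.
  + exact: (rsol_measurable hM cM subc (rsolS subc s1)).
  + exact: (rsol_measurable hM cM subc (rsolS subc s2)).
  + by apply: integrableS i1; [exact: tail_measurable| |].
  + by apply: integrableS i2; [exact: tail_measurable| |].
- by rewrite /wr u1y u1'y u2y u2'y mul1r mul0r subr0 oner_eq0.
Qed.

End OneInteraction.
End LimitCircle.

(** * Real eigenfunctions *)

Section RealEigenfunctions.
Context {R : realType}.
Local Notation mu := (@lebesgue_measure R).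

(** Nonempty open sets have positive measure. *)
Lemma ae_meets_open (O : set R) (P : R -> Prop) y : open O -> O y ->
  {ae mu, forall z, P z} -> exists2 z, O z & P z.
Proof.
move=> oO Oy aeP; apply: contrapT => no.
have [e e0 he] := open_ball_ex oO Oy.
have [N [mN N0 PN]] := aeP.
have sub : `]y - e, y + e[%classic `<=` N.
  move=> z /=; rewrite in_itv/= -ltr_distl => /he Oz; apply: PN => Pz.
  by apply: no; exists z.
pose J : set R := `]y - e, y + e[%classic.
have : (mu J <= mu N)%E by apply: le_measure; rewrite ?inE//; exact: measurable_itv.
rewrite N0 /J lebesgue_measure_itv/= lte_fin ifT; last lra.
by rewrite -EFinD lee_fin; lra.
Qed.

(** The Lagrange bracket of real functions, as a one-sided Wronskian. *)
Definition rbracket (v u : R -> R) (y : R) : R :=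
  lim (v @ y^'+) * lim (derive1 u @ y^'+) - lim (derive1 v @ y^'+) * lim (u @ y^'+).

Lemma complex_bracket (p q k l m n : R) :
  (p +i* 0)^* * (k +i* l) - (q +i* 0)^* * (m +i* n) =
  (p * k - q * m) +i* (p * l - q * n).
Proof. by apply/eqP; rewrite eq_complex /=; apply/andP; split; apply/eqP; ring. Qed.

Lemma bracket_realF v (f : R -> R[i]) y :
  bracket (realF v) f y = rbracket v (reF f) y +i* rbracket v (imF f) y.
Proof.
rewrite /bracket /limF derF_realF !reF_realF !imF_realF reF_derF imF_derF.
rewrite /rbracket; have -> : lim ((fun=> 0 : R) @ y^'+) = 0.
  by apply: cvg_lim => //; exact: cvg_cst.
exact: complex_bracket.
Qed.

Lemma cvgF_bracket v (f : R -> R[i]) (F : set_system R) :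
  cvgF F (bracket (realF v) f) 0 <->
  rbracket v (reF f) @ F --> (0 : R) /\ rbracket v (imF f) @ F --> (0 : R).
Proof.
rewrite /cvgF (_ : reF _ = rbracket v (reF f)); last first.
  by apply/funext => y; rewrite /reF bracket_realF.
by rewrite (_ : imF _ = rbracket v (imF f))//; apply/funext => y; rewrite /imF bracket_realF.
Qed.

Lemma rbracket0 v y : rbracket v (fun=> 0 : R) y = 0.
Proof.
rewrite /rbracket derive1_cst0; have -> : lim ((fun=> 0 : R) @ y^'+) = 0.
  by apply: cvg_lim => //; exact: cvg_cst.
by rewrite !mulr0 subrr.
Qed.

Variables (a b : \bar R) (V : R -> R) (I : set int) (x : int -> R).
Hypothesis hV : locally_integrable (oint a b) V.
Hypothesis hx : interaction_points a b I x.
Let M := x @` I.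
Let cM : countable M := interaction_countable I x.
Let hM : discrete_in (oint a b) M := interaction_discrete hx.
Local Notation sol A := (rsol V M (matrix_at I x A)).
Local Notation "'tail'" := (tail a b).
Local Notation "'tl'" := (tl a).
Local Notation "'tr'" := (tr b).
Local Notation lcc := (lcc a b V I x).
Implicit Types (A : int -> 'M[R]_2) (sd : bool) (u h : R -> R).
Variable vs : bool -> R -> R.
Variable E : R.

(** [vs true] and [vs false] are the functions of the boundary conditions at
    the left and right end-points. *)
Definition real_eigenfunction A u : Prop :=
  [/\ sol A a b (fun y => E * u y) u,
      mu.-integrable (oint a b) (EFin \o (fun y => u y ^+ 2)),
      forall sd, lcc sd A -> rbracket (vs sd) u @ endF a b sd --> (0 : R) &
      exists y, [/\ oint a b y, ~ M y & u y != 0]].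

Lemma rsol_measurable_ab A k u : sol A a b k u -> measurable_fun (oint a b) u.
Proof. exact: (rsol_measurable hM cM (@subset_refl _ (oint a b))). Qed.

(** The equation, the interface conditions and the boundary conditions are real,
    so the real and imaginary parts of an eigenfunction satisfy them too, and
    one of the parts does not vanish. *)
Lemma eigenvalue_real_eigenfunction A :
  sigma_p a b V I x A (vs true) (vs false) E%:C -> exists u, real_eigenfunction A u.
Proof.
move=> [f [[[Lf rf _ int] bl br] nz ev]].
have sf : solution_on V I x A a b E%:C f.
  split => //; last by move=> n In _; exact: int.
  apply: aeS ev.
  by move=> y h py; rewrite h// subrr.
have [s1 s2] := solution_real hx (@subset_refl _ (oint a b)) sf.
have {}s1 : sol A a b (fun y => E * reF f y) (reF f).
  apply: (rsol_eq hM cM (@subset_refl _ (oint a b)) _ s1) => y _ _.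
  by rewrite mul0r subr0.
have {}s2 : sol A a b (fun y => E * imF f y) (imF f).
  apply: (rsol_eq hM cM (@subset_refl _ (oint a b)) _ s2) => y _ _.
  by rewrite mul0r addr0.
have [i1 i2] := L2_parts (@oint_measurable _ a b) (rsol_measurable_ab s1)
  (rsol_measurable_ab s2) Lf.
have bc sd : lcc sd A -> rbracket (vs sd) (reF f) @ endF a b sd --> (0 : R) /\
    rbracket (vs sd) (imF f) @ endF a b sd --> (0 : R).
  by case: sd => l; apply/cvgF_bracket; [exact: bl|exact: br].
have [y [py My [r0|r0]]] : exists y, [/\ oint a b y, ~ M y & reF f y != 0 \/ imF f y != 0].
  apply: contrapT => h; apply: nz.
  apply: aeS (ae_notin_countable cM).
  move=> y My py; apply/eqP; rewrite eq_complex /=; apply: contrapT => hn.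
  apply: h; exists y; split => //; apply/orP; rewrite -negb_and; exact/negP.
- by exists (reF f); split => //; [move=> sd /bc[]|exists y].
- by exists (imF f); split => //; [move=> sd /bc[]|exists y].
Qed.

Lemma real_eigenfunction_eigenvalue A u : real_eigenfunction A u ->
  sigma_p a b V I x A (vs true) (vs false) E%:C.
Proof.
move=> [su iu bc [y0 [py0 My0 u0]]].
have [rf ae1 int] := real_solution hx (@subset_refl _ (oint a b)) su.
have mab := @oint_measurable _ a b.
have mu_ := rsol_measurable_ab su.
have ev : {ae mu, forall y, oint a b y -> tau V (realF u) y = E%:C * realF u y}.
  apply: aeS ae1.
  by move=> y h py; apply/eqP; rewrite -subr_eq0 h.
have bcF sd : lcc sd A -> cvgF (endF a b sd) (bracket (realF (vs sd)) (realF u)) 0.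
  move=> l; apply/cvgF_bracket; rewrite reF_realF imF_realF; split; first exact: bc.
  have pf := endF_proper a b sd.
  by apply: cvg_near_cst; apply: nearW => y; exact: rbracket0.
exists (realF u); split => //.
- split.
  + split => //.
    * exact: realF_L2.
    * have [g [g1 g2 ig eg]] : L2 (oint a b) (realF (fun y => E * u y)).
        apply: realF_L2 => //.
          by apply: measurable_funM => //; exact: measurable_cst.
        apply: (@integrable_sqr_le _ _ _ u (E ^+ 2)) => //.
          by apply: measurable_funM => //; exact: measurable_cst.
        by move=> y _; rewrite exprMn.
      exists g; split => //; apply: aeS2 ev eg.
      move=> y h1 h2 py; rewrite h1// -h2//; apply/eqP; rewrite eq_complex /=.
      by apply/andP; split; apply/eqP; ring.
    * by move=> n In; apply: int => //; have [_ h _] := hx; apply: h; exists n.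
  + by move=> l; exact: (bcF true).
  + by move=> l; exact: (bcF false).
- move=> nul; have [[r1 _ _ _] _ _] := su.
  have cu : {for y0, continuous u}.
    by apply: differentiable_continuous; apply/derivable1_diffP; exact: r1.
  have near0 : \forall y \near y0, u y != 0.
    exact: (cvgr_neq0 _ cu).
  have [e /= e0 he] := near0.
  have [e' e'0 he'] := open_ball_ex (@open_oint _ a b) py0.
  pose m := Num.min e e'; have m0 : 0 < m by rewrite lt_min e0.
  have ym : oint (y0 - m)%:E (y0 + m)%:E y0 by rewrite ointE; between.
  have [z] := ae_meets_open (@open_oint _ _ _) ym nul.
  rewrite ointE -ltr_distl lt_min => /andP[ze ze'] /(_ (he' z ze')).
  move=> /(congr1 (@complex.Re R))/= uz.
  by have := he z; rewrite /= distrC ze uz eqxx => /(_ isT).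
Qed.

(** * Two eigenfunctions for parameters that differ at one point *)

Variable n0 : int.
Hypothesis hn0 : I n0.
Let s := x n0.
Let ps : oint a b s := interaction_in hx hn0.
Variables (A0 : int -> 'M[R]_2) (lambda : R).
Hypothesis hvs : forall sd, exists c, [/\ oint a b c, tail sd c `<=` tail sd s,
  solution_on V I x A0 (tl sd c) (tr sd c) lambda%:C (realF (vs sd)) &
  ~ ae_null (tail sd c) (realF (vs sd))].

(** Otherwise the two eigenfunctions would span the solutions on this side, so
    that the end-point would be in the limit circle case; but then the boundary
    condition makes the bracket of [vs sd] with every solution vanish at the
    end-point, and [vs sd] itself vanishes. *)
Lemma wr_eigenfunctions A1 A2 u1 u2 sd y :
  agree_off I n0 A0 A1 -> agree_off I n0 A0 A2 ->
  (forall n, I n -> unimodular (A1 n)) -> (forall n, I n -> unimodular (A2 n)) ->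
  real_eigenfunction A1 u1 -> real_eigenfunction A2 u2 ->
  tail sd s y -> ~ M y -> wr u1 u2 y = 0.
Proof.
move=> ag1 ag2 uA1 uA2 [s1 i1 bc1 _] [s2 i2 bc2 _] ty My.
apply/eqP; apply: contrapT => /negP w0.
have ag12 : agree_off I n0 A1 A2 by move=> n In nn; rewrite -ag1// ag2.
have sub := @tail_sub _ _ _ sd s ps.
have t1 := rsolS sub s1.
have t2 : sol A1 (tl sd s) (tr sd s) (fun y => E * u2 y) u2.
  by apply: (agree_rsol (agree_offC ag12)); exact: rsolS sub s2.
have uM := @matrix_at_unimodular R I x A1 uA1.
have mt := @tail_measurable _ a b.
have ig : mu.-integrable (tail sd s) (EFin \o (fun y => (`|u1 y| + `|u2 y|) ^+ 2)).
  apply: integrable_abs_sum_sqr => //.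
  - exact: (rsol_measurable hM cM sub t1).
  - exact: (rsol_measurable hM cM sub t2).
  - by apply: integrableS i1; [exact: oint_measurable|exact: tail_measurable|exact: sub].
  - by apply: integrableS i2; [exact: oint_measurable|exact: tail_measurable|exact: sub].
have l1 : lcc sd A1 := weyl_lcc hx uA1 ps ps t1 t2 ig ty My w0.
have l2 : lcc sd A2 := lcc_transfer hV hx hn0 ag12 uA1 uA2 l1.
have [c [pc tcs sv nv]] := hvs sd.
have subc := @tail_sub _ _ _ sd c pc.
set v := vs sd in sv nv.
have {}sv : sol A1 (tl sd c) (tr sd c) (fun y => lambda * v y) v.
  have [+ _] := solution_real hx subc sv; rewrite reF_realF imF_realF => sv'.
  apply: (@rsol_matrix _ _ _ (matrix_at I x A0)).
    by move=> t /tcs /tail_neq ts; exact: (agree_matrix ag1).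
  by apply: (rsol_eq hM cM subc _ sv') => z _ _; rewrite mulr0 subr0.
have [d [z [pd td [tz Mz wz] igd sm]]] :=
  weyl_tail hx `|lambda| uA1 ps ps pc t1 t2 ig ty My w0.
have tds : tail sd d `<=` tail sd s by move=> t /td[].
have tdc : tail sd d `<=` tail sd c by move=> t /td[].
have subd := @tail_sub _ _ _ sd d pd.
have svd := rsolS tdc sv.
have mv := rsol_measurable hM cM subd svd.
have wrv u k A y' : sol A a b k u -> tail sd d y' -> ~ M y' ->
    rbracket v u y' = wr v u y'.
  move=> su ty' My'.
  have [c1 c2] := rsol_right_continuous hM (@subset_refl _ (oint a b)) su (subd _ ty') My'.
  have [c3 c4] := rsol_right_continuous hM subd svd ty' My'.
  have E1 := cvg_lim (@norm_hausdorff _ _) c1; have E2 := cvg_lim (@norm_hausdorff _ _) c2.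
  have E3 := cvg_lim (@norm_hausdorff _ _) c3; have E4 := cvg_lim (@norm_hausdorff _ _) c4.
  by rewrite /rbracket /wr E1 E2 E3 E4.
have v0 : forall y, tail sd d y -> ~ M y -> v y = 0.
  apply: (weyl_vanish hM cM uM subd (rsolS tds t1) (rsolS tds t2) svd svd _ _ _ tz Mz wz igd sm).
  - by apply: measurable_funM => //; exact: measurable_cst.
  - by apply: measurable_funM => //; exact: measurable_cst.
  - by move=> t _; rewrite normrM; split; rewrite ler_wpM2l// lerDl.
  - move=> e e0.
    have n1 : \forall y \near endF a b sd, `|rbracket v u1 y| < e /\ `|rbracket v u2 y| < e.
      have pf := endF_proper a b sd.
      move/cvgr0_norm_lt : (bc1 sd l1) => /(_ e e0) h1.
      by move/cvgr0_norm_lt : (bc2 sd l2) => /(_ e e0) h2; apply: filterS2 h1 h2.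
    have [d' pd' hd'] := endF_basis pd n1.
    have [d2 pd2 [t2d t2d']] := tail_meet sd pd pd'.
    have [y' [ty' My']] := tail_point sd hM pd2.
    exists y'; have [hy1 hy2] := hd' y' (t2d' _ ty').
    rewrite (wrv _ _ _ _ s1 (t2d _ ty') My') in hy1.
    rewrite (wrv _ _ _ _ s2 (t2d _ ty') My') in hy2.
    by split => //; exact: t2d.
have v'0 : derive1 v z = 0.
  have oD := open_discrete_inD (@open_oint _ (tl sd d) (tr sd d)) (discrete_inS subd hM).
  have [|_ ->] := @eq_on_open _ _ v (fun=> 0) oD _ z (conj tz Mz).
    by move=> t [h1 h2]; exact: v0.
  by rewrite derive1_cst0.
have dz : dsize v z = 0 by rewrite /dsize v'0 (v0 _ tz Mz) normr0 addr0.
apply: nv; apply: aeS (ae_notin_countable cM).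
move=> t Mt tt; have := eig_unique hV hM uM subc sv (tdc _ tz) Mz dz tt Mt.
rewrite /dsize => h; have : v t = 0.
  by apply/eqP; rewrite -normr_eq0; have := normr_ge0 (v t); have := normr_ge0 (derive1 v t); lra.
by rewrite /realF => ->.
Qed.

Definition left_data u (l l' : R) := u @ s^'- --> l /\ derive1 u @ s^'- --> l'.

Definition right_data u (l l' : R) := u @ s^'+ --> l /\ derive1 u @ s^'+ --> l'.

Definition jump A (l l' : R) : R * R :=
  (A n0 0 0 * l + A n0 0 1 * l', A n0 1 0 * l + A n0 1 1 * l').

Lemma solution_data A k u : sol A a b k u -> exists l l', left_data u l l'.
Proof. by move=> [_ _ /(_ s ps)[l [l' [_ [_ [h _ _ _]]]]]]; exists l, l'. Qed.

Lemma solution_jump A k u l l' : sol A a b k u -> left_data u l l' ->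
  right_data u (jump A l l').1 (jump A l l').2.
Proof.
move=> [_ _ /(_ s ps)]; rewrite (matrix_at_point hx A hn0).
move=> [m [m' [t [t' [[c1 c2] c3 e1 e2]]]]] [d1 d2].
have <- := cvg_unique (@norm_hausdorff _ _) c1 d1.
by have <- := cvg_unique (@norm_hausdorff _ _) c2 d2; rewrite /= -e1 -e2.
Qed.

Lemma near_left : \forall y \near s^'-, tail true s y /\ ~ M y.
Proof.
have [e [e0 he _]] := punctured_sides hM (@subset_refl _ (oint a b)) ps.
exists e => // y /=; rewrite ltr_distlC => /andP[h1 h2] h3.
have [|/andP[ay _] My] := he y; first by between.
by split => //; apply/andP; rewrite lte_fin.
Qed.

Lemma near_right : \forall y \near s^'+, tail false s y /\ ~ M y.
Proof.
have [e [e0 _ he]] := punctured_sides hM (@subset_refl _ (oint a b)) ps.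
exists e => // y /=; rewrite ltr_distlC => /andP[h1 h2] h3.
have [|/andP[_ yb] My] := he y; first by between.
by split => //; apply/andP; rewrite lte_fin.
Qed.

Lemma wr_cvg (F : set_system R) {FF : Filter F} u h (l l' m m' : R) :
  u @ F --> l -> derive1 u @ F --> l' -> h @ F --> m -> derive1 h @ F --> m' ->
  wr u h @ F --> l * m' - l' * m.
Proof. by move=> h1 h2 h3 h4; apply: cvgB; exact: cvgM. Qed.

(** Otherwise the Wronskian with any other solution would tend to 0 at [s-], hence
    be 0 everywhere; but the solution with data [0] and [1] at a point [y0] where
    [u] does not vanish has Wronskian [u y0] with [u]. *)
Lemma left_data_neq0 A u l l' : (forall n, I n -> unimodular (A n)) ->
  real_eigenfunction A u -> left_data u l l' -> l = 0 -> l' = 0 -> False.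
Proof.
move=> uA [su _ _ [y0 [py0 My0 uy0]]] [c1 c2] l0 l'0.
have uM := @matrix_at_unimodular R I x A uA.
have [h [sh hy h'y]] :=
  eig_exists hV hM cM (@matrix_at_off _ I x A) uM E 0 1 py0 My0.
have [m [m' [d1 d2]]] := solution_data sh.
have cw : wr u h @ s^'- --> 0 * m' - 0 * m.
  by rewrite -{1}l0 -l'0; exact: wr_cvg.
have w0 : wr u h y0 = u y0 by rewrite /wr hy h'y mulr1 mulr0 subr0.
have : \forall y \near s^'-, wr u h y - u y0 = 0.
  apply: filterS near_left => y [ty My]; rewrite -w0.
  rewrite (wr_eig_const hM uM (@subset_refl _ (oint a b)) su sh (tail_sub ps ty) py0)//.
  exact: subrr.
have cw' : (fun y => wr u h y - u y0) @ s^'- --> 0 * m' - 0 * m - u y0.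
  by apply: cvgB; [exact: cw|exact: cvg_cst].
move/(lim_zero _ cw')/eqP; rewrite !mul0r subr0 sub0r oppr_eq0; exact/negP.
Qed.

(** The Wronskian vanishes on both sides of [s]: the left data of [u1] and [u2]
    are proportional, and so are their right data. *)
Lemma eigenfunctions_jump A1 A2 u1 u2 l l' :
  agree_off I n0 A0 A1 -> agree_off I n0 A0 A2 ->
  (forall n, I n -> unimodular (A1 n)) -> (forall n, I n -> unimodular (A2 n)) ->
  real_eigenfunction A1 u1 -> real_eigenfunction A2 u2 -> left_data u1 l l' ->
  (jump A1 l l').1 * (jump A2 l l').2 = (jump A1 l l').2 * (jump A2 l l').1.
Proof.
move=> ag1 ag2 uA1 uA2 e1 e2 d1.
have wz sd y := @wr_eigenfunctions A1 A2 u1 u2 sd y ag1 ag2 uA1 uA2 e1 e2.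
have [s1 _ _ _] := e1; have [s2 _ _ _] := e2.
have [m [m' d2]] := solution_data s2.
have [r1 r1'] := solution_jump s1 d1; have [r2 r2'] := solution_jump s2 d2.
have n1 := left_data_neq0 uA1 e1 d1; have n2 := left_data_neq0 uA2 e2 d2.
have [c1 c1'] := d1; have [c2 c2'] := d2.
have L : l * m' - l' * m = 0.
  apply: (lim_zero _ (wr_cvg c1 c1' c2 c2')).
  by apply: filterS near_left => y [ty My]; exact: wz ty My.
have : (jump A1 l l').1 * (jump A2 m m').2 - (jump A1 l l').2 * (jump A2 m m').1 = 0.
  apply: (lim_zero _ (wr_cvg r1 r1' r2 r2')).
  by apply: filterS near_right => y [ty My]; exact: wz ty My.
rewrite /jump /= => H; have [t t0 [mE m'E]] : exists2 t : R, t != 0 & m = t * l /\ m' = t * l'.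
  have [l0|l0] := eqVneq l 0.
    have l'0 : l' != 0 by apply/eqP => l'0; exact: n1 l0 l'0.
    have m0 : m = 0.
      by move/eqP: L; rewrite l0 mul0r sub0r oppr_eq0 mulf_eq0 (negPf l'0) => /eqP.
    exists (m' / l'); last by rewrite l0 mulr0 divfK.
    by rewrite mulf_neq0 ?invr_eq0//; apply/eqP; exact: n2.
  have mE : m' = m / l * l'.
    by apply: (mulfI l0); rewrite mulrA mulrCA divff// mulr1; lra.
  exists (m / l); last by rewrite divfK.
  rewrite mulf_neq0 ?invr_eq0//; apply/eqP => m0; apply: n2 => //.
  by rewrite mE m0 !mul0r.
by apply: (mulfI t0); move: H; rewrite mE m'E; lra.
Qed.

Lemma cvg_scaled (F : set_system R) {FF : Filter F} (c t : R) u h :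
  u @ F --> t -> (\forall y \near F, h y = c * u y) -> h @ F --> c * t.
Proof.
move=> cu uh; have cv : (fun y => c * u y) @ F --> c * t by apply: cvgM cu; exact: cvg_cst.
apply: cvg_trans cv; apply: near_eq_cvg.
by apply: filterS uh => y ->.
Qed.

(** If the two matrices at the varied point send the left data of an
    eigenfunction to proportional vectors, rescaling it beyond that point gives
    an eigenfunction for the other parameters. *)
Lemma eigenfunction_transfer A1 A2 u l l' kappa : agree_off I n0 A1 A2 ->
  (forall n, I n -> unimodular (A1 n)) -> (forall n, I n -> unimodular (A2 n)) ->
  real_eigenfunction A1 u -> left_data u l l' -> kappa != 0 ->
  (jump A2 l l').1 = kappa * (jump A1 l l').1 ->
  (jump A2 l l').2 = kappa * (jump A1 l l').2 ->
  exists u2, real_eigenfunction A2 u2.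
Proof.
move=> ag uA1 uA2 [su iu bc [y0 [py0 My0 uy0]]] dl k0 j1 j2.
pose u2 y := if y < s then u y else kappa * u y.
pose co sd : R := if sd then 1 else kappa.
have Ms : M s by exists n0.
have sub sd := @tail_sub _ _ _ sd s ps.
have p1 sd y : tail sd s y -> u2 y = co sd * u y.
  rewrite /tail /tl /tr /u2 /co; case: sd => /andP[h1 h2].
    by rewrite lte_fin in h2; rewrite h2 mul1r.
  by rewrite lte_fin in h1; rewrite ltNge (ltW h1).
have [[r1 _ _ _] _ _] := su.
have p2 sd y : tail sd s y -> ~ M y -> derive1 u2 y = co sd * derive1 u y.
  move=> ty My; have dy := r1 y (conj (sub sd _ ty) My).
  have [dl1 dl2] := derivable_lin (co sd) 0 dy dy.
  have [|_ <-] := @eq_on_open _ _ (fun z => co sd * u z + 0 * u z) u2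
    (@open_oint _ (tl sd s) (tr sd s)) _ y ty.
    by move=> z tz; rewrite (p1 sd z tz) mul0r addr0.
  by rewrite dl2 mul0r addr0.
have st sd : sol A2 (tl sd s) (tr sd s) (fun y => E * u2 y) u2.
  apply: (agree_rsol ag).
  have su' := rsolS (sub sd) su.
  apply: (rsol_eq hM cM (sub sd) _ (rsol_lin hM cM (co sd) 0 (sub sd) su' su')).
  by move=> y ty _; rewrite (p1 sd y ty); split; ring.
have [dl1 dl2] := dl; have [dr1 dr2] := solution_jump su dl.
have su2 : sol A2 a b (fun y => E * u2 y) u2.
  apply: (rsol_join cM (@subset_refl _ (oint a b)) ps Ms (st true) (st false)).
  rewrite (matrix_at_point hx A2 hn0).
  exists (co true * l), (co true * l'), (co false * (jump A1 l l').1),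
    (co false * (jump A1 l l').2); split.
  - split; [apply: (cvg_scaled dl1)|apply: (cvg_scaled dl2)];
      apply: filterS near_left => y [ty My]; [exact: p1|exact: p2].
  - split; [apply: (cvg_scaled dr1)|apply: (cvg_scaled dr2)];
      apply: filterS near_right => y [ty My]; [exact: p1|exact: p2].
  - by rewrite /co -j1 /= !mul1r.
  - by rewrite /co -j2 /= !mul1r.
exists u2; split => //.
- apply: (@integrable_sqr_le _ _ _ u (1 + kappa ^+ 2)) => //.
  + exact: oint_measurable.
  + exact: rsol_measurable_ab su2.
  + move=> y _; rewrite /u2; have := sqr_ge0 (kappa * u y); have := sqr_ge0 (u y).
    by rewrite exprMn; case: ifP => _; rewrite ?exprMn; lra.
- move=> sd /(lcc_transfer hV hx hn0 (agree_offC ag) uA2 uA1) /bc cb.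
  have pf := endF_proper a b sd.
  have := @cvg_scaled _ _ (co sd) 0 _ (rbracket (vs sd) u2) cb.
  rewrite mulr0; apply; apply: filterS (endF_tail sd ps) => y ty.
  have [_ _ /(_ y (sub sd y ty))] := su.
  move=> [_ [_ [t [t' [_ [c1 c2] _ _]]]]].
  have [e [e0 _ he]] := punctured_sides hM (sub sd) ty.
  have ne : \forall z \near y^'+, tail sd s z /\ ~ M z.
    exists e => // z /=; rewrite ltr_distlC => /andP[h1 h2] h3.
    by have [|tz Mz] := he z; first by between.
  have C1 : u2 @ y^'+ --> co sd * t.
    by apply: (cvg_scaled c1); apply: filterS ne => z [tz Mz]; exact: p1.
  have C2 : derive1 u2 @ y^'+ --> co sd * t'.
    by apply: (cvg_scaled c2); apply: filterS ne => z [tz Mz]; exact: p2.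
  have E1 := cvg_lim (@norm_hausdorff _ _) c1; have E2 := cvg_lim (@norm_hausdorff _ _) c2.
  have E3 := cvg_lim (@norm_hausdorff _ _) C1; have E4 := cvg_lim (@norm_hausdorff _ _) C2.
  by rewrite /rbracket E1 E2 E3 E4; ring.
- exists y0; split => //; rewrite /u2; case: ifP => // _.
  by rewrite mulf_neq0.
Qed.

End RealEigenfunctions.

(** * Eigenvalues along the three parameter lines *)

Section ParameterLines.
Context {R : realType}.

(** The only zero of [sin] in the interval from -2 to 2 is 0, so the points of
    [X] are at distance at least 2 and have distinct integer parts. *)
Lemma sin_separated (X : set R) :
  (forall t t', X t -> X t' -> sin (t' - t) = 0) -> countable X.
Proof.
move=> sin0.
have lt_sep t t' : X t -> X t' -> t < t' -> Num.floor t < Num.floor t'.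
  move=> Xt Xt' tt'; have [t2|t2] := ltP (t' - t) 2.
    have := sin2_gt0 (x := t' - t); rewrite (sin0 _ _ Xt Xt') ltxx t2 subr_gt0 tt'.
    by move=> /(_ isT).
  have := ge_floor t; have := floorD1_gt t'.
  rewrite -(ltr_int R) intrD; lra.
have inj : {in X &, injective (@Num.floor R)}.
  move=> t t'; rewrite !inE => Xt Xt' ft.
  have [h|h|//] := ltgtP t t'.
    by have := lt_sep _ _ Xt Xt' h; rewrite ft ltxx.
  by have := lt_sep _ _ Xt' Xt h; rewrite ft ltxx.
by rewrite -(eq_countable (inj_card_eq inj)); exact: countableP.
Qed.

(** The coordinates of [(l, l')] rotated by [th]. *)
Definition rot1 (th l l' : R) := cos th * l - sin th * l'.
Definition rot2 (th l l' : R) := sin th * l + cos th * l'.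

Lemma rot_cross th th' l l' :
  rot1 th l l' * rot2 th' l l' - rot2 th l l' * rot1 th' l l' =
  (l ^+ 2 + l' ^+ 2) * sin (th' - th).
Proof. by rewrite /rot1 /rot2 sinB; ring. Qed.

Variables (a b : \bar R) (V : R -> R) (I : set int) (x : int -> R).
Hypothesis hV : locally_integrable (oint a b) V.
Hypothesis hx : interaction_points a b I x.
Variables (alpha r theta : int -> R) (n0 : int).
Hypothesis hr : forall n, I n -> 0 < r n.
Hypothesis hn0 : I n0.
Variables (lambda : R) (v w : R -> R).
Hypothesis hv : exists c : R, [/\ (a < c%:E)%E, c <= x n0,
  solution_on V I x (interface_family alpha r theta) a c%:E
    (lambda%:C) (realF v) &
  ~ ae_null (oint a c%:E) (realF v)].
Hypothesis hw : exists d : R, [/\ (d%:E < b)%E, x n0 <= d,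
  solution_on V I x (interface_family alpha r theta) d%:E b
    (lambda%:C) (realF w) &
  ~ ae_null (oint d%:E b) (realF w)].
Variable E : R.

Let P := P_set a b V I x alpha r theta v w n0 E.
Let vs (sd : bool) := if sd then v else w.
Let A0 := interface_family alpha r theta.

Let family (al s th : R) : int -> 'M[R]_2 :=
  interface_family [eta alpha with n0 |-> al] [eta r with n0 |-> s]
    [eta theta with n0 |-> th].

Let family_off al s th : agree_off I n0 A0 (family al s th).
Proof. by move=> n _ nn; rewrite /family /A0 /interface_family /= (negPf nn). Qed.

Let family_agree al s th al' s' th' :
  agree_off I n0 (family al s th) (family al' s' th').
Proof. by move=> n In nn; rewrite -!(family_off _ _ _ In nn). Qed.

Let family_unimodular al s th : 0 < s -> forall n, I n -> unimodular (family al s th n).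
Proof.
move=> s0 n In; rewrite /family /interface_family /=.
by case: eqVneq => _; apply: interface_mx_unimodular => //; exact: hr.
Qed.

Let family_jump al s th l l' : jump n0 (family al s th) l l' =
  (s * rot1 th l l' + al / s * rot2 th l l', s^-1 * rot2 th l l').
Proof.
rewrite /jump /family /interface_family /= eqxx.
by have [-> -> -> ->] := interface_mxE al s th; rewrite /rot1 /rot2; congr pair; ring.
Qed.

Let boundary_solutions sd : exists c : R, [/\ oint a b c,
  tail a b sd c `<=` tail a b sd (x n0),
  solution_on V I x A0 (tl a sd c) (tr b sd c) lambda%:C (realF (vs sd)) &
  ~ ae_null (tail a b sd c) (realF (vs sd))].
Proof.
have /andP[ax xb] := interaction_in hx hn0; case: sd.
  have [c [ac cx sv nv]] := hv; exists c; split => //.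
    by apply/andP; split => //; apply: le_lt_trans xb; rewrite lee_fin.
  move=> y /andP[ay yc]; apply/andP; split => //.
  by apply: (lt_le_trans yc); rewrite lee_fin.
have [d [db xd sw nw]] := hw; exists d; split => //.
  by apply/andP; split => //; apply: (lt_le_trans ax); rewrite lee_fin.
move=> y /andP[dy yb]; apply/andP; split => //.
by apply: le_lt_trans dy; rewrite lee_fin.
Qed.

Let eigenfunction al s th := real_eigenfunction a b V I x vs E (family al s th).

Let P_eigenfunction al s th : P (al, s, th) ->
  0 < s /\ exists u, eigenfunction al s th u.
Proof. by move=> [s0 /(eigenvalue_real_eigenfunction (vs := vs) hx)]. Qed.

(** All that the three cases need to know about eigenfunctions: [(l, l')] are the
    left data of one of them, and the formulas compare the images of these data
    under the interface matrices of two triples. *)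
Lemma P_data al s th : P (al, s, th) -> exists l l',
  [/\ ~ (l = 0 /\ l' = 0),
    forall al' s' th', P (al', s', th') ->
      (s * rot1 th l l' + al / s * rot2 th l l') * (s'^-1 * rot2 th' l l') =
      (s^-1 * rot2 th l l') * (s' * rot1 th' l l' + al' / s' * rot2 th' l l') &
    forall al' s' th' k, 0 < s' -> k != 0 ->
      s' * rot1 th' l l' + al' / s' * rot2 th' l l' =
        k * (s * rot1 th l l' + al / s * rot2 th l l') ->
      s'^-1 * rot2 th' l l' = k * (s^-1 * rot2 th l l') -> P (al', s', th')].
Proof.
move=> /P_eigenfunction[s0 [u eu]]; have [su _ _ _] := eu.
have uA := family_unimodular al th s0.
have [l [l' dl]] := solution_data hx hn0 su.
exists l, l'; split.
- by move=> [l0 l'0]; exact: (left_data_neq0 hV hx hn0 uA eu dl l0 l'0).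
- move=> al' s' th' /P_eigenfunction[s'0 [u' eu']].
  have := eigenfunctions_jump hV hx hn0 boundary_solutions (family_off al s th)
    (family_off al' s' th') uA (family_unimodular al' th' s'0) eu eu' dl.
  by rewrite !family_jump.
- move=> al' s' th' k s'0 k0 j1 j2; split => //.
  have [|| u2 eu2] := eigenfunction_transfer hV hx hn0 (family_agree al s th al' s' th') uA
    (family_unimodular al' th' s'0) eu dl k0.
  + by rewrite !family_jump.
  + by rewrite !family_jump.
  + exact: (real_eigenfunction_eigenvalue (vs := vs) hx eu2).
Qed.

Lemma countable_angles al s : 0 < s ->
  countable ([set (al, s, t) | t in [set: R]] `&` P).
Proof.
move=> s0; pose X := [set t | P (al, s, t)].
have cX : countable X.
  apply: sin_separated => t t' Xt Xt'; have [l [l' [nz cr _]]] := P_data Xt.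
  have := cr _ _ _ Xt'; have := rot_cross t t' l l'.
  set p := rot1 t _ _; set q := rot2 t _ _; set p' := rot1 _ _ _; set q' := rot2 _ _ _.
  move=> E1 E2; have pq : p * q' - q * p' = 0.
    have -> : p * q' - q * p' = (s * p + al / s * q) * (s^-1 * q') -
        (s^-1 * q) * (s * p' + al / s * q') by field; exact: lt0r_neq0.
    by rewrite E2 subrr.
  move: E1; rewrite pq => /esym/eqP; rewrite mulf_eq0 => /orP[|/eqP//].
  rewrite paddr_eq0 ?sqr_ge0// !sqrf_eq0 => /andP[/eqP l0 /eqP l'0].
  by case: nz.
apply: (@sub_countable _ _ _ X _ cX).
apply: (@card_le_trans _ _ _ ((fun t => (al, s, t)) @` X)).
  by apply: subset_card_le => _ [[t _ <-] Pt]; exists t.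
exact: card_image_le.
Qed.

(** Two parameters in [P] force one coordinate of the rotated data to vanish, and
    then changing [s] only rescales the right data. *)
Lemma scale_line al th :
  let L := [set (al, s, th) | s in [set s : R | 0 < s]] in
  is_subset1 (L `&` P) \/ L `&` P = L.
Proof.
move=> L; have [|h] := pselect (is_subset1 (L `&` P)); [by left|right].
apply/seteqP; split; [by move=> p []|move=> p Lp; split => //].
have [s1 [s2 [P1 P2 s12]]] : exists s1 s2, [/\ P (al, s1, th), P (al, s2, th) & s1 != s2].
  apply: contrapT => h'; apply: h => _ _ [[s1 _ <-] P1] [[s2 _ <-] P2].
  by have [->//|s12] := eqVneq s1 s2; case: h'; exists s1, s2.
have [s10 _] := P1; have [s20 _] := P2; rewrite /= in s10 s20.
have [l [l' [nz cr tf]]] := P_data P1.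
have := cr _ _ _ P2; set m1 := rot1 _ _ _ in tf *; set m2 := rot2 _ _ _ in tf *.
move=> E1; have m12 : m1 * m2 = 0.
  have : m1 * m2 * ((s1 - s2) * (s1 + s2)) = 0.
    have -> : m1 * m2 * ((s1 - s2) * (s1 + s2)) = s1 * s2 *
        ((s1 * m1 + al / s1 * m2) * (s2^-1 * m2) - s1^-1 * m2 * (s2 * m1 + al / s2 * m2)).
      by field; rewrite !lt0r_neq0.
    by rewrite E1 subrr mulr0.
  move/eqP; rewrite mulf_eq0 => /orP[/eqP//|].
  by rewrite mulf_eq0 subr_eq0 (negPf s12) (gt_eqF (addr_gt0 s10 s20)).
case: Lp => s s0 <-; move/eqP: m12; rewrite mulf_eq0 => /orP[] /eqP m0.
- apply: (tf _ _ _ (s1 / s)) => //; rewrite -?/m1 -?/m2 ?m0.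
  + by rewrite mulf_neq0 ?invr_eq0 ?lt0r_neq0.
  + by field; rewrite !lt0r_neq0.
  + by field; rewrite !lt0r_neq0.
- apply: (tf _ _ _ (s / s1)) => //; rewrite -?/m1 -?/m2 ?m0.
  + by rewrite mulf_neq0 ?invr_eq0 ?lt0r_neq0.
  + by field; rewrite !lt0r_neq0.
  + by field; rewrite !lt0r_neq0.
Qed.

(** Two parameters in [P] force the second coordinate of the rotated data to
    vanish, and the right data do not see [al]. *)
Lemma strength_line s th : 0 < s ->
  let L := [set (al, s, th) | al in [set: R]] in
  is_subset1 (L `&` P) \/ L `&` P = L.
Proof.
move=> s0 L; have [|h] := pselect (is_subset1 (L `&` P)); [by left|right].
apply/seteqP; split; [by move=> p []|move=> p Lp; split => //].
have [a1 [a2 [P1 P2 a12]]] : exists a1 a2, [/\ P (a1, s, th), P (a2, s, th) & a1 != a2].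
  apply: contrapT => h'; apply: h => _ _ [[a1 _ <-] P1] [[a2 _ <-] P2].
  by have [->//|a12] := eqVneq a1 a2; case: h'; exists a1, a2.
have [l [l' [nz cr tf]]] := P_data P1.
have := cr _ _ _ P2; set m1 := rot1 _ _ _ in tf *; set m2 := rot2 _ _ _ in tf *.
move=> E1; have m0 : m2 = 0.
  have : (a1 - a2) * m2 ^+ 2 = 0.
    have -> : (a1 - a2) * m2 ^+ 2 = s ^+ 2 *
        ((s * m1 + a1 / s * m2) * (s^-1 * m2) - s^-1 * m2 * (s * m1 + a2 / s * m2)).
      by field; rewrite !lt0r_neq0.
    by rewrite E1 subrr mulr0.
  by move/eqP; rewrite mulf_eq0 subr_eq0 (negPf a12) /= sqrf_eq0 => /eqP.
case: Lp => a3 _ <-; apply: (tf _ _ _ 1) => //; rewrite -?/m1 -?/m2 ?m0 ?oner_neq0//.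
  by rewrite !mulr0 !addr0 mul1r.
by rewrite !mulr0.
Qed.

End ParameterLines.

Theorem theorem5p1 (R : realType) (a b : \bar R) (hab : (a < b)%E)
  (V : R -> R) (hV : locally_integrable (oint a b) V)
  (I : set int) (x : int -> R) (hx : interaction_points a b I x)
  (alpha r theta : int -> R) (hr : forall n, I n -> 0 < r n)
  (n0 : int) (hn0 : I n0)
  (lambda : R) (v w : R -> R)
  (hv : exists c : R, [/\ (a < c%:E)%E, c <= x n0,
     solution_on V I x (interface_family alpha r theta) a c%:E
       (lambda%:C) (realF v) &
     ~ ae_null (oint a c%:E) (realF v)])
  (hw : exists d : R, [/\ (d%:E < b)%E, x n0 <= d,
     solution_on V I x (interface_family alpha r theta) d%:E b
       (lambda%:C) (realF w) &
     ~ ae_null (oint d%:E b) (realF w)])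
  (E : R) :
  let P := P_set a b V I x alpha r theta v w n0 E in
  [/\ (forall alpha0 r0 : R, 0 < r0 ->
         let S := [set (alpha0, r0, t) | t in [set: R]] `&` P in
         S = set0 \/ countable S),
      (forall alpha0 theta0 : R,
         let L := [set (alpha0, s, theta0) | s in [set s : R | 0 < s]] in
         is_subset1 (L `&` P) \/ L `&` P = L) &
      (forall r0 theta0 : R, 0 < r0 ->
         let L := [set (s, r0, theta0) | s in [set: R]] in
         is_subset1 (L `&` P) \/ L `&` P = L)].
Proof.
split.
- by move=> al s s0; right; exact: (countable_angles hV hx hr hn0 hv hw).
- by move=> al th; exact: (scale_line hV hx hr hn0 hv hw).
- by move=> s th s0; exact: (strength_line hV hx hr hn0 hv hw).
Qed.
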